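(* Let $p$ be a prime, $a\ge1$, $q=p^a$, $n\ge1$, $d\ge2$, $\lambda\in\mathbb{F}_q^N$, $f_\lambda=\sum_{j=1}^N\lambda_jx^{{\bf a}_j}\in\mathbb{F}_q[x_0,\dots,x_n]$ homogeneous of degree $d$, $X_\lambda\subseteq\mathbb{P}^n$ its zero locus, and $Z(X_\lambda/\mathbb{F}_q,t)=P_\lambda(t)^{(-1)^n}/\big((1-t)(1-qt)\cdots(1-q^{n-1}t)\big)$. Let $\hat\lambda=(\hat\lambda_1,\dots,\hat\lambda_N)$ be the Teichmüller lifting of $\lambda$. If $n$ is not divisible by $d$, then $$P_\lambda(q^{-\mu}t)\equiv\det\big(I-tA^S(\hat\lambda^{p^{a-1}})A^S(\hat\lambda^{p^{a-2}})\cdots A^S(\hat\lambda)\big)\pmod p.$$ If $n$ is divisible by $d$, then $$P_\lambda(q^{-\mu}t)\equiv\frac{\det\big(I-tA^S(\hat\lambda^{p^{a-1}})\cdots A^S(\hat\lambda)\big)}{\prod_{i=0}^n\det\big(I-tA^{S\setminus\{i\}}(\hat\lambda^{p^{a-1}})\cdots A^{S\setminus\{i\}}(\hat\lambda)\big)}\pmod p.$$ Congruences are coefficientwise congruences of power series in $t$ with $p$-integral coefficients.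
   Context: ${\bf a}_j\in\mathbb{N}^{n+1}$ have coordinate sum $d$, ${\bf a}_j^+=({\bf a}_j,1)\in\mathbb{N}^{n+2}$, $S=\{0,\dots,n\}$. For $I\subseteq S$, $\mu_I$ is defined by $\lceil|I|/d\rceil=\mu_I+1$, and $\mu=\mu_S$. $U^I$ is the set of $u\in\mathbb{N}^{n+2}$ with $\sum_{i=0}^nu_i=du_{n+1}$ and $u_i>0$ for $i\in I$; $U^I_{\min}=\{u\in U^I:u_{n+1}=\mu_I+1\}$. $A^I(\Lambda)=[A^I_{uv}(\Lambda)]_{u,v\in U^I_{\min}}$ with $$A^I_{uv}(\Lambda)=(-1)^{\mu_I+1}\sum_{\nu\in\mathbb{N}^N,\ \sum_j\nu_j{\bf a}_j^+=pu-v}\frac{\Lambda^\nu}{\nu_1!\cdots\nu_N!}.$$ The Teichmüller lifting $\hat\lambda_j$ is the unique element of $\{0\}\cup\mu_{q-1}\subset\mathbb{Q}_p(\zeta_{q-1})$ reducing to $\lambda_j$; $\hat\lambda^{p^i}$ is componentwise. *)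

(* Defs.v *)
From HB Require Import structures.
From mathcomp Require Import all_boot all_order all_algebra all_field.
Set Implicit Arguments. Unset Strict Implicit. Unset Printing Implicit Defensive.
Import Order.TTheory GRing.Theory Num.Theory.
Local Open Scope ring_scope.

Definition series := nat -> algC.
Definition sone : series := fun k => (k == 0)%:R.
Definition smul (f g : series) : series :=
  fun k => \sum_(i < k.+1) f i * g (k - i)%N.
Definition spow (f : series) (m : nat) : series := iter m (smul f) sone.
(* exp f = sum_m f^m / m!  (meaningful when f 0 = 0; the sum is finite coefficientwise) *)
Definition sexp (f : series) : series :=
  fun k => \sum_(m < k.+1) spow f m k / (m`!)%:R.
(* 1/f = sum_m (1 - f)^m  (meaningful when f 0 = 1) *)
Definition sinv (f : series) : series :=
  fun k => \sum_(m < k.+1) spow (fun i => sone i - f i) m k.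
Definition polyser (P : {poly algC}) : series := fun k => P`_k.

Definition hyp_eval (K : fieldType) (n N : nat) (expo : 'I_N -> 'I_n.+1 -> nat)
  (c : 'I_N -> K) (x : 'I_n.+1 -> K) : K :=
  \sum_(j < N) c j * \prod_(i < n.+1) x i ^+ expo j i.

Definition affine_count (K : finFieldType) (n N : nat) (expo : 'I_N -> 'I_n.+1 -> nat)
  (c : 'I_N -> K) : nat :=
  #|[set x : {ffun 'I_n.+1 -> K} | [exists i, x i != 0] && (hyp_eval expo c x == 0)]|.

Definition proj_count (K : finFieldType) (n N : nat) (expo : 'I_N -> 'I_n.+1 -> nat)
  (c : 'I_N -> K) : algC :=
  (affine_count expo c)%:R / (#|K|.-1)%:R.

Definition zeta_series (cnt : nat -> algC) : series :=
  sexp (fun r => if r == 0%N then 0 else cnt r / r%:R).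

(* P(t) defined by Z(t) = P(t)^((-1)^n) / ((1-t)(1-qt)...(1-q^(n-1)t)) *)
Definition P_series (n q : nat) (cnt : nat -> algC) : series :=
  let W := smul (zeta_series cnt)
                (polyser (\prod_(i < n) (1 - ((q ^ i)%N)%:R%:P * 'X))) in
  if odd n then sinv W else W.

(* ---------- p-adic data ----------
   zeta : primitive (q-1)-th root of unity in algC, beta : generator of F^*.
   Z[zeta] -> F, g(zeta) |-> g(beta) (g in Z[X]) is a surjective ring map whose kernel
   is a prime P above p; completing at P gives Q_p(zeta_{q-1}) with residue field F. *)
Definition polyCa (g : {poly int}) : {poly algC} := map_poly (fun z : int => z%:~R) g.
Definition polyF (F : fieldType) (g : {poly int}) : {poly F} :=
  map_poly (fun z : int => z%:~R) g.

(* x is p-integral (lies in the localization of Z[zeta] at P, i.e. in Z_p[zeta]) *)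
Definition p_integral (F : fieldType) (beta : F) (zeta : algC) (x : algC) : Prop :=
  exists g h : {poly int},
    (polyF F h).[beta] != 0 /\ x * (polyCa h).[zeta] = (polyCa g).[zeta].

(* x lies in p Z_p[zeta] (= P-adic maximal ideal, p being unramified) *)
Definition p_cong0 (F : fieldType) (beta : F) (zeta : algC) (x : algC) : Prop :=
  exists g h : {poly int},
    [/\ (polyF F h).[beta] != 0, (polyF F g).[beta] = 0 &
        x * (polyCa h).[zeta] = (polyCa g).[zeta]].

Definition cong_mod_p (F : fieldType) (beta : F) (zeta : algC) (f g : series) : Prop :=
  forall k, [/\ p_integral beta zeta (f k), p_integral beta zeta (g k) &
               p_cong0 beta zeta (f k - g k)].

Definition dlog (F : finFieldType) (beta x : F) : nat :=
  if [pick k : 'I_(#|F|.-1) | beta ^+ k == x] is Some k then val k else 0%N.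
Definition teich (F : finFieldType) (beta : F) (zeta : algC) (x : F) : algC :=
  if x == 0 then 0 else zeta ^+ dlog beta x.

(* mu_I with ceil(|I|/d) = mu_I + 1 *)
Definition muI (n d : nat) (I : {set 'I_n.+1}) : nat := ((#|I| + d.-1) %/ d).-1.
Definition Ubound (n d : nat) (I : {set 'I_n.+1}) : nat := (d * (muI d I).+1)%N.
(* U^I_min, recorded by its first n+1 coordinates (u_{n+1} = mu_I + 1) *)
Definition Upred (n d : nat) (I : {set 'I_n.+1})
  (u : {ffun 'I_n.+1 -> 'I_(Ubound d I).+1}) : bool :=
  ((\sum_(i < n.+1) (u i : nat) == Ubound d I)%N && [forall i in I, 0 < u i]%N).
Definition Umin (n d : nat) (I : {set 'I_n.+1}) :=
  {u : {ffun 'I_n.+1 -> 'I_(Ubound d I).+1} | Upred u}.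

(* A^I_{uv}(L) = (-1)^(mu_I+1) sum_{nu : sum_j nu_j a_j^+ = p u - v} L^nu / prod nu_j!
   The last coordinate forces sum_j nu_j = (p-1)(mu_I+1) =: M, so nu_j <= M. *)
Definition Aentry (n d N p : nat) (expo : 'I_N -> 'I_n.+1 -> nat) (I : {set 'I_n.+1})
  (u v : Umin d I) (L : 'I_N -> algC) : algC :=
  let m := muI d I in
  let M := (p.-1 * m.+1)%N in
  (-1) ^+ m.+1 *
  \sum_(nu : {ffun 'I_N -> 'I_M.+1} |
          (\sum_(j < N) (nu j : nat) == M)%N &&
          [forall i, \sum_(j < N) (nu j : nat) * expo j i + (val v i : nat)
                     == p * (val u i : nat)]%N)
     \prod_(j < N) (L j ^+ nu j / ((nu j)`!)%:R).

Definition Amx (n d N p : nat) (expo : 'I_N -> 'I_n.+1 -> nat) (I : {set 'I_n.+1})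
  (L : 'I_N -> algC) : 'M[algC]_#|{: Umin d I}| :=
  \matrix_(i, j) Aentry p expo (enum_val i) (enum_val j) L.

Definition Aprod (n d N p : nat) (expo : 'I_N -> 'I_n.+1 -> nat) (I : {set 'I_n.+1})
  (L : 'I_N -> algC) (e : nat) : 'M[algC]_#|{: Umin d I}| :=
  foldr (fun i acc => acc *m Amx d p expo I (fun j => L j ^+ (p ^ i))) 1%:M (iota 0 e).

Definition Adet (n d N p : nat) (expo : 'I_N -> 'I_n.+1 -> nat) (I : {set 'I_n.+1})
  (L : 'I_N -> algC) (e : nat) : {poly algC} :=
  \det (1%:M - 'X *: map_mx polyC (Aprod d p expo I L e)).

(* Main.v *)
(* Dwork's method over a finite-level ring.  Fix a coefficient index k and work
   modulo a high power p^M in the discrete valuation ring O obtained from the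
   localization of Z[zeta] by adjoining a primitive p-th root of unity y.
   Newton's method gives pi in O with AH(pi) = y mod p^M, AH being a truncation of
   the Artin-Hasse series exp(sum_i t^(p^i) / p^i).  The products of the values
   AH(tau(c)^(p^i) pi) are then, modulo p^M, values of an additive character of the
   field with q^r elements (tau is the Teichmüller lift), and counting zeros with
   this character gives
     q^r N_r = sum_I (-1)^|I| q^(r(n+1-|I|)) tr(Theta_I^r) + q^r (1 + ... + q^(r(n-1)))
   where N_r counts projective points.  Theta_I is a product of a transfer matrices
   indexed by exponent vectors that are positive on I; only boundedly many vectors
   lie on closed walks, so the matrices are finite.  Hence P(q^-mu t) is, up to a
   factor that is 1 mod (y - 1), the alternating product over I of
     det(1 - q^(n-|I|-mu) t Theta_I).
   Theta_I is divisible by q^c with c = ceil(|I|/d), and as pi^(p-1)/p = -1 mod (y - 1),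
   the quotient reduces to the matrix product in A^I up to Sylvester's identity.  The
   exponent n - |I| - mu + c is nonnegative; it vanishes only for I = S, and for
   |I| = n if d divides n, which leaves the asserted determinants.  The coefficients of
   P are rational, so the congruence descends from y - 1 to p. *)

Require Import Defs.
From HB Require Import structures.
From mathcomp Require Import all_boot all_order all_algebra all_field.
From mathcomp Require Import cyclic perm boolp ring zify.
Import Order.TTheory GRing.Theory Num.Theory.
Set Implicit Arguments.
Unset Strict Implicit.
Unset Printing Implicit Defensive.
Local Open Scope ring_scope.

(** * Congruences and truncated power series *)

(** Nothing is completed: all numbers stay in [algC], and p-adic approximation becomes congruence
    modulo p^M inside the subring O. The price is the choice of M, since recovering a coefficient of
    P from traces divides by powers of q and by small integers. The Artin-Hasse series replaces
    Dwork's exponential because its coefficients are p-integral: its truncation is a polynomial over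
    O, and pi is found without adjoining a (p-1)-st root of -p. A sum of Teichmüller conjugates is
    only a p-adic integer, so it cannot serve as an exponent of y; it is replaced by a natural
    number B, congruent to it modulo a power of p that makes the correction factor 1 modulo p^M. The
    character sum over the field with q^r elements lives in a ring that grows with r. Its congruence
    is brought back to the one ring O because y - 1 remains a nonunit above, and the Teichmüller
    lifts agree along the embeddings, so that one Theta_I serves all r. *)

Section CongruenceModuloScalar.

Variables (R : comNzRingType) (S : subringClosed R).
Implicit Types c x y z : R.

(** The cofactor is confined to the subring [S]: in the ambient field every nonzero [c] divides
    everything. *)
Definition eqm c x y := exists2 w, w \in S & x = y + c * w.

Lemma eqm_refl c x : eqm c x x.
Proof. by exists 0; rewrite ?rpred0 // mulr0 addr0. Qed.

Lemma eqm_sym c x y : eqm c x y -> eqm c y x.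
Proof. by case=> w Sw ->; exists (- w); rewrite ?rpredN //; ring. Qed.

Lemma eqm_trans c y x z : eqm c x y -> eqm c y z -> eqm c x z.
Proof.
by case=> w Sw -> [v Sv ->]; exists (w + v); rewrite ?rpredD //; ring.
Qed.

Lemma eqmD c x x' y y' : eqm c x x' -> eqm c y y' -> eqm c (x + y) (x' + y').
Proof.
by case=> w Sw -> [v Sv ->]; exists (w + v); rewrite ?rpredD //; ring.
Qed.

Lemma eqmN c x x' : eqm c x x' -> eqm c (- x) (- x').
Proof. by case=> w Sw ->; exists (- w); rewrite ?rpredN //; ring. Qed.

Lemma eqmB c x x' y y' : eqm c x x' -> eqm c y y' -> eqm c (x - y) (x' - y').
Proof. by move=> xx' yy'; apply: eqmD => //; apply: eqmN. Qed.

Lemma eqm_mem c x x' : c \in S -> eqm c x x' -> x \in S -> x' \in S.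
Proof.
move=> Sc [w Sw ->] Sx.
by rewrite -(addrK (c * w) x'); apply: rpredB => //; apply: rpredM.
Qed.

(** By xy - x'y' = x(y - y') + (x - x')y', one factor on each side is enough. *)
Lemma eqmM c x x' y y' : x \in S -> y' \in S ->
  eqm c x x' -> eqm c y y' -> eqm c (x * y) (x' * y').
Proof.
move=> Sx Sy' [w Sw Ex] [v Sv ->]; exists (w * y' + x * v).
  by rewrite rpredD // rpredM.
by rewrite mulrDr {1}Ex; ring.
Qed.

Lemma eqmMl c x y y' : x \in S -> eqm c y y' -> eqm c (x * y) (x * y').
Proof. by move=> Sx [w Sw ->]; exists (x * w); rewrite ?rpredM //; ring. Qed.

Lemma eqm_weak a c x y : a \in S -> eqm (c * a) x y -> eqm c x y.
Proof. by move=> Sa [w Sw ->]; exists (a * w); rewrite ?rpredM //; ring. Qed.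

Lemma eqm_sum c (I : Type) (r : seq I) (P : pred I) (F G : I -> R) :
  (forall i, P i -> eqm c (F i) (G i)) ->
  eqm c (\sum_(i <- r | P i) F i) (\sum_(i <- r | P i) G i).
Proof.
move=> FG; apply: (big_ind2 (eqm c)) => //; first exact: eqm_refl.
by move=> *; apply: eqmD.
Qed.

Lemma eqm_sum0 c (I : Type) (r : seq I) (P : pred I) (F : I -> R) :
  (forall i, P i -> eqm c (F i) 0) -> eqm c (\sum_(i <- r | P i) F i) 0.
Proof.
move=> F0; apply: (big_ind (eqm c ^~ 0)) => //; first exact: eqm_refl.
by move=> x y x0 y0; rewrite -[0]addr0; apply: eqmD.
Qed.

Lemma eqm0M c x y : y \in S -> eqm c x 0 -> eqm c (x * y) 0.
Proof. by move=> Sy [w Sw ->]; exists (w * y); rewrite ?rpredM //; ring. Qed.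

Lemma eqm_prod c (I : Type) (r : seq I) (P : pred I) (F G : I -> R) :
  c \in S -> (forall i, P i -> F i \in S) ->
  (forall i, P i -> eqm c (F i) (G i)) ->
  eqm c (\prod_(i <- r | P i) F i) (\prod_(i <- r | P i) G i).
Proof.
move=> Sc SF FG.
pose K x y := x \in S /\ eqm c x y.
suff [//] : K (\prod_(i <- r | P i) F i) (\prod_(i <- r | P i) G i).
apply: (big_ind2 K) => [|x x' y y' [Sx xx'] [Sy yy']|i Pi].
- by split; [exact: rpred1 | exact: eqm_refl].
- by split; [exact: rpredM|apply: eqmM => //; exact: (eqm_mem Sc yy')].
- by split; [exact: SF|exact: FG].
Qed.

Lemma eqmX c x y k : c \in S -> x \in S -> eqm c x y -> eqm c (x ^+ k) (y ^+ k).
Proof.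
move=> Sc Sx xy; rewrite -[k]card_ord -!prodr_const.
exact: eqm_prod.
Qed.

Lemma eqm_det c k (A B : 'M[R]_k) : c \in S -> (forall i j, A i j \in S) ->
  (forall i j, eqm c (A i j) (B i j)) -> eqm c (\det A) (\det B).
Proof.
move=> Sc SA AB; apply: eqm_sum => s _; apply: eqmMl.
  by rewrite rpredX // rpredN rpred1.
exact: eqm_prod.
Qed.

End CongruenceModuloScalar.

Section PolyPrefix.

Variable K : comNzRingType.
Implicit Types f g : {poly K}.

Definition eqX n f g := forall k, (k < n)%N -> f`_k = g`_k.

Lemma eqXP n f g : eqX n f g <-> exists h, f = g + 'X^n * h.
Proof.
split=> [fg|[h ->] k kn]; last by rewrite coefD coefXnM kn addr0.
exists (drop_poly n (f - g)).
have : take_poly n (f - g) = 0.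
  apply/polyP=> i; rewrite coef_take_poly coef0 coefB; case: ltnP => // /fg ->.
  exact: subrr.
move=> E; have := poly_take_drop n (f - g); rewrite E add0r => {}E.
by rewrite mulrC E addrC subrK.
Qed.

Lemma eqX_refl n f : eqX n f f. Proof. by []. Qed.
Lemma eqX_sym n f g : eqX n f g -> eqX n g f.
Proof. by move=> fg k /fg. Qed.
Lemma eqX_trans n g f h : eqX n f g -> eqX n g h -> eqX n f h.
Proof. by move=> fg gh k kn; rewrite fg ?gh. Qed.
Lemma eqX_weak m n f g : (m <= n)%N -> eqX n f g -> eqX m f g.
Proof. by move=> mn fg k km; apply: fg; apply: leq_trans km mn. Qed.
Lemma eqXD n f f' g g' : eqX n f f' -> eqX n g g' -> eqX n (f + g) (f' + g').
Proof. by move=> ff gg k kn; rewrite !coefD ff ?gg. Qed.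
Lemma eqXM n f f' g g' : eqX n f f' -> eqX n g g' -> eqX n (f * g) (f' * g').
Proof.
move=> /eqXP[h ->] /eqXP[l ->]; apply/eqXP.
exists (h * g' + f' * l + h * 'X^n * l); ring.
Qed.
Lemma eqX_prod n (I : Type) (r : seq I) (P : pred I) (F G : I -> {poly K}) :
  (forall i, P i -> eqX n (F i) (G i)) ->
  eqX n (\prod_(i <- r | P i) F i) (\prod_(i <- r | P i) G i).
Proof. by move=> FG; apply: (big_ind2 (eqX n)) => // *; apply: eqXM. Qed.
End PolyPrefix.

(** * Formal exponentials through logarithmic derivatives *)

Section Series.
Implicit Types (f g A : series) (n k : nat).

Definition truncs n f : {poly algC} := \poly_(k < n) f k.

Lemma coef_truncs n f k : (k < n)%N -> (truncs n f)`_k = f k.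
Proof. by move=> kn; rewrite coef_poly kn. Qed.

Lemma eqX_truncs n f (G : {poly algC}) :
  (forall k, (k < n)%N -> f k = G`_k) -> eqX n (truncs n f) G.
Proof. by move=> fG k kn; rewrite coef_truncs ?fG. Qed.

Lemma truncs_smul n f g : eqX n (truncs n (smul f g)) (truncs n f * truncs n g).
Proof.
apply: eqX_truncs => k kn; rewrite coefM; apply: eq_bigr => i _.
by rewrite !coef_truncs // (leq_ltn_trans _ kn) // ?leq_subr // -ltnS.
Qed.

Lemma truncs_spow n f m : eqX n (truncs n (spow f m)) (truncs n f ^+ m).
Proof.
elim: m => [|m IH].
  by apply: eqX_truncs => k kn; rewrite expr0 coef1.
rewrite exprS; apply: eqX_trans (truncs_smul f (spow f m)) _.
exact: eqXM.
Qed.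

Lemma expr_low (G : {poly algC}) m k : G`_0 = 0 -> (k < m)%N -> (G ^+ m)`_k = 0.
Proof.
move=> G0 km; have /eqXP[h ->] : eqX 1 G 0 by case=> // _; rewrite coef0.
by rewrite add0r expr1 exprMn coefXnM km.
Qed.

Lemma truncs_sexp n f : (0 < n)%N -> f 0 = 0 ->
  eqX n (truncs n (sexp f)) (\sum_(m < n) (m`!)%:R^-1 *: truncs n f ^+ m).
Proof.
move=> n0 f0; have P0 : (truncs n f)`_0 = 0 by rewrite coef_truncs.
apply: eqX_truncs => k kn; rewrite /sexp coef_sum.
have E m : spow f m k = (truncs n f ^+ m)`_k.
  by rewrite -(truncs_spow f m kn) coef_truncs.
rewrite (big_ord_widen n (fun m => spow f m k / m`!%:R)) //.
rewrite big_mkcond /=; apply: eq_bigr => m _; rewrite coefZ ltnS E mulrC.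
by case: leqP => // km; rewrite expr_low ?mulr0.
Qed.

Lemma truncs_sinv n f : (0 < n)%N -> f 0 = 1 ->
  eqX n (truncs n f * truncs n (sinv f)) 1.
Proof.
move=> n0 f0; pose G := truncs n (fun i => sone i - f i).
have G0 : G`_0 = 0 by rewrite coef_truncs // f0 /sone eqxx subrr.
have EG : eqX n G (1 - truncs n f).
  by apply: eqX_truncs => k kn; rewrite coefB coef1 coef_truncs.
have E1 : eqX n (truncs n (sinv f)) (\sum_(m < n) G ^+ m).
  apply: eqX_truncs => k kn; rewrite /sinv coef_sum.
  have E m : spow (fun i => sone i - f i) m k = (G ^+ m)`_k.
    by rewrite -(truncs_spow _ m kn) coef_truncs.
  rewrite (big_ord_widen n (fun m => spow (fun i => sone i - f i) m k)) //.
  rewrite big_mkcond /=; apply: eq_bigr => m _; rewrite ltnS E.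
  by case: leqP => // km; rewrite expr_low.
apply: (@eqX_trans _ _ ((1 - G) * \sum_(m < n) G ^+ m)).
  apply: eqXM => // k kn; rewrite coefB EG // coefB; ring.
have -> : (1 - G) * \sum_(m < n) G ^+ m = 1 - G ^+ n.
  have := subrXX 1 G n; rewrite expr1n => ->.
  congr (_ * _); apply: eq_bigr => i _.
  by rewrite expr1n mul1r.
by move=> k kn; rewrite coefB expr_low // subr0.
Qed.

(** The equation X f' = A f with A_0 = 0 expresses (k+1) f_(k+1) through earlier coefficients, so
    the constant term determines f in characteristic 0. Identities between zeta series are proved by
    this uniqueness. *)
Lemma eqX_logder_unique n (A f g : {poly algC}) :
  f`_0 = g`_0 -> eqX n ('X * f^`()) (A * f) -> eqX n ('X * g^`()) (A * g) ->
  A`_0 = 0 -> eqX n f g.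
Proof.
move=> fg0 Ef Eg A0; elim/ltn_ind=> -[//|k] IH kn.
have := Ef _ kn; have := Eg _ kn; rewrite !coefXM !coef_deriv !coefM /=.
have -> : \sum_(j < k.+2) A`_j * g`_(k.+1 - j) =
          \sum_(j < k.+2) A`_j * f`_(k.+1 - j).
  rewrite [LHS]big_ord_recl [RHS]big_ord_recl A0 !mul0r !add0r.
  apply: eq_bigr => i _.
  congr (_ * _); rewrite lift0 subSS; symmetry.
  apply: IH; last exact: leq_ltn_trans (leq_subr _ _) (ltnW kn).
  by rewrite ltnS leq_subr.
move=> <- /eqP; rewrite -subr_eq0 -mulrnBl mulrn_eq0 subr_eq0 => /eqP.
by move->.
Qed.

Definition logder n A := truncs n (fun k => if k == 0%N then 0 else A k).

Lemma logder0 n A : (logder n A)`_0 = 0.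
Proof. by rewrite /logder coef_poly; case: ifP. Qed.

Lemma eqX_deriv n (f g : {poly algC}) :
  eqX n f g -> eqX n ('X * f^`()) ('X * g^`()).
Proof. by move=> fg [|k] kn; rewrite !coefXM // !coef_deriv /= fg. Qed.

Lemma zeta_series0 A : zeta_series A 0 = 1.
Proof. by rewrite /zeta_series /sexp big_ord1 /= /sone eqxx fact0 divr1. Qed.

Lemma zeta_series_logder n A : eqX n ('X * (truncs n (zeta_series A))^`())
   (logder n A * truncs n (zeta_series A)).
Proof.
case: n => // n; set f := fun r => if r == 0%N then 0 else A r / r%:R.
have f0 : f 0%N = 0 by [].
have := @truncs_sexp n.+1 f (ltn0Sn n) f0; rewrite -/(zeta_series A).
set Z := truncs _ (sexp f); set G := truncs _ f => EZ.
have G0 : G`_0 = 0 by rewrite coef_truncs.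
have EL : eqX n.+1 (logder n.+1 A) ('X * G^`()).
  apply: eqX_truncs => -[|k] kn; rewrite coefXM //= coef_deriv coef_truncs //.
  by rewrite /f /= -[RHS]mulr_natr divfK // pnatr_eq0.
apply: eqX_trans (eqX_deriv EZ) _.
apply: (@eqX_trans _ _ ('X * G^`() * \sum_(m < n.+1) (m`!)%:R^-1 *: G ^+ m)); last first.
  by apply: eqXM; apply: eqX_sym.
rewrite linear_sum /= big_ord_recl [in X in eqX _ _ X]big_ord_recr /=.
rewrite expr0 derivZ derivC scaler0 add0r mulrDr.
rewrite (eq_bigr (fun m : 'I_n => G^`() * ((m`!)%:R^-1 *: G ^+ m))); last first.
  move=> m _; rewrite derivZ /bump leq0n add1n deriv_exp /= -scaler_nat.
  by rewrite -scalerAr scalerA factS natrM invfM mulrAC mulVf ?mul1r ?pnatr_eq0.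
rewrite -mulr_sumr mulrA -[X in eqX _ X _]addr0; apply: eqXD => //.
(* The only term left unmatched is X G' G^n / n!, of order at least n+1 because X divides G. *)
apply: eqX_sym; rewrite -scalerAr => k kn; rewrite coefZ coef0.
have /eqXP[h GE] : eqX 1 G 0 by case=> // _; rewrite coef0.
have -> : G = 'X * h by rewrite GE add0r expr1.
have -> : 'X * ('X * h)^`() * ('X * h) ^+ n = 'X^(n.+1) * (('X * h)^`() * h ^+ n).
  by rewrite exprMn exprS; ring.
by rewrite coefXnM kn mulr0.
Qed.

Lemma zeta_seriesS A k :
  zeta_series A k.+1 * k.+1%:R = \sum_(j < k.+1) A j.+1 * zeta_series A (k - j)%N.
Proof.
have /(_ k.+1 (leqnn _)) := @zeta_series_logder k.+2 A.
rewrite coefXM coef_deriv /= coef_truncs // mulr_natr => ->.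
rewrite coefM big_ord_recl logder0 mul0r add0r; apply: eq_bigr => i _.
have ik := ltn_ord i; rewrite lift0 subSS /logder coef_truncs; last by lia.
by rewrite coef_truncs //; lia.
Qed.

Lemma zeta_series_unique n A (f : {poly algC}) : f`_0 = 1 ->
  eqX n ('X * f^`()) (logder n A * f) -> eqX n (truncs n (zeta_series A)) f.
Proof.
case: n => // n f0 Ef.
have Z0 : (truncs n.+1 (zeta_series A))`_0 = f`_0.
  by rewrite coef_truncs // zeta_series0.
exact: eqX_logder_unique Z0 (@zeta_series_logder _ A) Ef (logder0 _ _).
Qed.

Lemma logderD n A B :
  logder n (fun k => A k + B k) = logder n A + logder n B.
Proof.
apply/polyP=> k; rewrite coefD !coef_poly;
by case: (k < n)%N; case: (k == 0)%N; rewrite ?addr0.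
Qed.

Lemma truncs_zeta_seriesD n A B :
  eqX n (truncs n (zeta_series (fun k => A k + B k)))
        (truncs n (zeta_series A) * truncs n (zeta_series B)).
Proof.
case: n => // n; apply: zeta_series_unique.
  by rewrite coefM big_ord1 !coef_truncs // !zeta_series0 mulr1.
set ZA := truncs _ (zeta_series A); set ZB := truncs _ (zeta_series B).
have -> : 'X * (ZA * ZB)^`() = 'X * ZA^`() * ZB + ZA * ('X * ZB^`()).
  by rewrite derivM; ring.
have -> : logder n.+1 (fun k => A k + B k) * (ZA * ZB) =
  logder n.+1 A * ZA * ZB + ZA * (logder n.+1 B * ZB) by rewrite logderD; ring.
by apply: eqXD; apply: eqXM => //; apply: zeta_series_logder.
Qed.

Lemma zeta_series_scale A c k :
  zeta_series (fun j => c ^+ j * A j) k = c ^+ k * zeta_series A k.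
Proof.
elim/ltn_ind: k => -[|k] IH; first by rewrite !zeta_series0 mul1r.
have k0 : (k.+1%:R : algC) != 0 by rewrite pnatr_eq0.
apply: (mulIf k0); rewrite -mulrA !zeta_seriesS mulr_sumr; apply: eq_bigr => i _.
rewrite IH ?ltnS ?leq_subr //.
have -> : c ^+ k.+1 = c ^+ i.+1 * c ^+ (k - i)%N.
  by rewrite -exprD addSn subnKC // -ltnS.
by ring.
Qed.

Lemma eq_zeta_series A B k :
  (forall j, (0 < j <= k)%N -> A j = B j) -> zeta_series A k = zeta_series B k.
Proof.
elim/ltn_ind: k => -[|k] IH AB; first by rewrite !zeta_series0.
have k0 : (k.+1%:R : algC) != 0 by rewrite pnatr_eq0.
apply: (mulIf k0); rewrite !zeta_seriesS; apply: eq_bigr => i _.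
rewrite AB ?ltn_ord // IH ?ltnS ?leq_subr // => j /andP[j0 jk].
by rewrite AB // j0 (leq_trans jk) // (leq_trans (leq_subr _ _)).
Qed.

(** The recursion for the k-th coefficient divides every earlier A_j by k, hence the hypothesis on
    all quotients A_j / k and not only on A_j / j. *)
Lemma zeta_series_small (S : subringClosed algC) c n A : c \in S ->
  (forall j k, (0 < j <= n)%N -> (0 < k <= n)%N -> eqm S c (A j / k%:R) 0) ->
  forall k, (0 < k <= n)%N -> eqm S c (zeta_series A k) 0.
Proof.
move=> Sc AS k; elim/ltn_ind: k => -[|k] IH // /= kn.
have k0 : (k.+1%:R : algC) != 0 by rewrite pnatr_eq0.
have -> : zeta_series A k.+1 =
    \sum_(j < k.+1) A j.+1 / k.+1%:R * zeta_series A (k - j)%N.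
  apply: (mulIf k0); rewrite zeta_seriesS mulr_suml; apply: eq_bigr => i _.
  by rewrite mulrAC divfK.
apply: eqm_sum0 => j _.
have SZ : zeta_series A (k - j)%N \in S.
  case E : (k - j)%N => [|l]; first by rewrite zeta_series0 rpred1.
  have [w Sw ->] : eqm S c (zeta_series A l.+1) 0.
    by apply: IH; rewrite -E ?ltnS ?leq_subr // E /= -E (leq_trans (leq_subr _ _)) // ltnW.
  by rewrite add0r rpredM.
apply: eqm0M => //; apply: AS => //=; exact: leq_trans (ltn_ord j) kn.
Qed.

End Series.

(** * Localized cyclotomic integers *)

(** A separate constant carries the subring instance, which lets [eqm] be used for polynomials with
    coefficients in [S]. *)
Definition polyO (R : comNzRingType) (S : {pred R}) : {pred {poly R}} :=
  fun f => f \is a polyOver S.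

Fact polyO_subring (R : comNzRingType) (S : subringClosed R) :
  subring_closed (polyO S).
Proof.
split=> [|f g Sf Sg|f g Sf Sg]; rewrite -topredE /= /polyO.
- exact: rpred1.
- exact: rpredB.
- exact: rpredM.
Qed.
HB.instance Definition _ (R : comNzRingType) (S : subringClosed R) :=
  GRing.isSubringClosed.Build {poly R} (polyO S) (@polyO_subring R S).

Lemma polyOP (R : comNzRingType) (S : subringClosed R) (f : {poly R}) :
  reflect (forall i, f`_i \in S) (f \in polyO S).
Proof. exact: polyOverP. Qed.

(** * Frobenius congruences modulo p *)

Section Frobenius.

Variables (p : nat) (pp : prime p).

Lemma eqm_expD (R : comNzRingType) (S : subringClosed R) (x y : R) :
  x \in S -> y \in S -> eqm S p%:R ((x + y) ^+ p) (x ^+ p + y ^+ p).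
Proof.
move=> Sx Sy; have p0 := prime_gt0 pp.
have nz : ord_max != ord0 :> 'I_p.+1 by rewrite -val_eqE /= -lt0n.
rewrite exprDn (bigD1 ord0) //= (bigD1 ord_max) //=.
rewrite subn0 expr0 mulr1 bin0 mulr1n subnn expr0 mul1r binn mulr1n.
rewrite addrA -[X in eqm _ _ _ X]addr0; apply: eqmD; first exact: eqm_refl.
apply: eqm_sum0 => i /andP[i0 im].
have /dvdnP[m ->] : (p %| 'C(p, i))%N.
  apply: prime_dvd_bin => //.
  by move: (ltn_ord i) i0 im; rewrite -!val_eqE /=; lia.
exists ((x ^+ (p - i) * y ^+ i) *+ m); first by rewrite rpredMn // rpredM ?rpredX.
by rewrite add0r mulrnA mulr_natl.
Qed.

Lemma eqm_exp_sum (R : comNzRingType) (S : subringClosed R) (I : Type)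
    (r : seq I) (P : pred I) (f : I -> R) : (forall i, P i -> f i \in S) ->
  eqm S p%:R ((\sum_(i <- r | P i) f i) ^+ p) (\sum_(i <- r | P i) f i ^+ p).
Proof.
move=> Sf; pose K x y := x \in S /\ eqm S p%:R (x ^+ p) y.
suff [] : K (\sum_(i <- r | P i) f i) (\sum_(i <- r | P i) f i ^+ p) by [].
apply: (big_ind2 K) => [|x x' y y' [Sx xx'] [Sy yy']|i Pi].
- split; first exact: rpred0.
  by rewrite expr0n eqn0Ngt prime_gt0 //; exact: eqm_refl.
- split; first exact: rpredD.
  by apply: eqm_trans (eqm_expD Sx Sy) _; apply: eqmD.
- by split; [exact: Sf|exact: eqm_refl].
Qed.

Lemma eqm_exp_poly (R : comNzRingType) (S : subringClosed R) (f : {poly R}) :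
  (forall a, a \in S -> eqm S p%:R (a ^+ p) a) -> f \in polyO S ->
  eqm (polyO S) p%:R (f ^+ p) (f \Po 'X^p).
Proof.
move=> SFr Sf; rewrite -[X in X ^+ p]coefK poly_def.
apply: eqm_trans (eqm_exp_sum (S := polyO S) _ _) _.
  move=> i _; apply: polyOverZ; first exact/polyOP.
  by rewrite rpredX // polyOverX.
rewrite comp_polyE; apply: eqm_sum => i _.
have /SFr [w Sw E] : f`_i \in S by apply/polyOP.
exists (w *: 'X^p ^+ i); first by apply: polyOverZ; rewrite // !rpredX // polyOverX.
rewrite exprZn E scalerDl -!exprM mulnC; congr (_ + _).
by rewrite -scalerA mulr_natl scaler_nat.
Qed.

Lemma eqm_exp_nat (R : comNzRingType) (S : subringClosed R) m :
  eqm S p%:R ((m%:R : R) ^+ p) m%:R.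
Proof.
elim: m => [|m IH].
  by rewrite expr0n eqn0Ngt prime_gt0 //; exact: eqm_refl.
rewrite -natr1; apply: eqm_trans (eqm_expD (rpred_nat _ _) (rpred1 _)) _.
by rewrite expr1n; apply: eqmD => //; exact: eqm_refl.
Qed.

Lemma eqm_exp_int (R : comNzRingType) (S : subringClosed R) (m : int) :
  eqm S p%:R ((m%:~R : R) ^+ p) m%:~R.
Proof.
have [k [l ->]] : exists k l : nat, m = k%:Z + p%:Z * (- l%:Z).
  have p0 := prime_gt0 pp.
  case: m => k; first by exists k, 0%N; rewrite oppr0 mulr0 addr0.
  by exists (k.+1 * p.-1)%N, k.+1; rewrite NegzE; nia.
rewrite rmorphD rmorphM rmorphN /=; set b := - _.
have Sb : b \in S by rewrite rpredN rpred_nat.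
have kb : eqm S p%:R (k%:~R + p%:~R * b) k%:R by exists b.
apply: eqm_trans (eqm_sym kb).
apply: eqm_trans (eqmX _ _ _ kb) (eqm_exp_nat _ _).
- exact: rpred_nat.
- by rewrite rpredD ?rpredM ?rpred_nat.
Qed.

End Frobenius.

(** The improper subring, for which [eqm] is ordinary congruence in [R]. *)
Definition all_pred (R : nzRingType) : {pred R} := fun=> true.
Fact all_pred_subring R : subring_closed (@all_pred R).
Proof. by []. Qed.
HB.instance Definition _ (R : nzRingType) :=
  GRing.isSubringClosed.Build R (@all_pred R) (@all_pred_subring R).

Lemma exp_prime_pow_poly p s (g : {poly int}) : prime p ->
  exists t, g ^+ (p ^ s) = (g \Po 'X^(p ^ s)) + p%:R * t.
Proof.
move=> pp; have Fr (f : {poly int}) : eqm (@all_pred {poly int}) p%:R (f ^+ p) (f \Po 'X^p).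
  have [||w _ ->] := @eqm_exp_poly p pp _ (@all_pred int) f.
  - by move=> a _; rewrite -[a]intz; exact: eqm_exp_int.
  - exact/polyOP.
  - by exists w.
elim: s => [|s [t IH]].
  by exists 0; rewrite expn0 mulr0 addr0 !expr1 comp_polyXr.
have [w _ E] := Fr (g \Po 'X^(p ^ s)).
suff [v _ ->] : eqm (@all_pred {poly int}) p%:R (g ^+ (p ^ s.+1)) ((g \Po 'X^(p ^ s)) \Po 'X^p).
  by exists v; rewrite -comp_polyA comp_Xn_poly -exprM -expnS.
rewrite expnSr exprM; apply: eqm_trans (Fr (g \Po 'X^(p ^ s))).
by apply: eqmX => //; exists t.
Qed.

Section LocalRing.

Variables (F : fieldType) (b : F) (z : algC).
Implicit Types g h : {poly int}.

Definition evC g : algC := (polyCa g).[z].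
Definition evF g : F := (polyF F g).[b].

Fact evC_is_zmod_morphism : zmod_morphism evC.
Proof. by move=> g h; rewrite /evC /polyCa rmorphB hornerD hornerN. Qed.
Fact evC_is_monoid_morphism : monoid_morphism evC.
Proof.
by split=> [|g h]; rewrite /evC /polyCa ?rmorph1 ?hornerC // rmorphM hornerM.
Qed.
HB.instance Definition _ := GRing.isZmodMorphism.Build _ _ evC evC_is_zmod_morphism.
HB.instance Definition _ := GRing.isMonoidMorphism.Build _ _ evC evC_is_monoid_morphism.
Fact evF_is_zmod_morphism : zmod_morphism evF.
Proof. by move=> g h; rewrite /evF /polyF rmorphB hornerD hornerN. Qed.
Fact evF_is_monoid_morphism : monoid_morphism evF.
Proof.
by split=> [|g h]; rewrite /evF /polyF ?rmorph1 ?hornerC // rmorphM hornerM.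
Qed.
HB.instance Definition _ := GRing.isZmodMorphism.Build _ _ evF evF_is_zmod_morphism.
HB.instance Definition _ := GRing.isMonoidMorphism.Build _ _ evF evF_is_monoid_morphism.

Lemma evCX : evC 'X = z.
Proof. by rewrite /evC /polyCa map_polyX hornerX. Qed.
Lemma evFX : evF 'X = b.
Proof. by rewrite /evF /polyF map_polyX hornerX. Qed.

(** The boolean form of [p_integral], so that it can be a subring with its closure lemmas. *)
Definition Oz : {pred algC} := fun x => `[< p_integral b z x >].

Lemma OzP x : reflect (exists g h, evF h != 0 /\ x * evC h = evC g) (x \in Oz).
Proof. exact: asboolP. Qed.

Fact Oz_subring : subring_closed Oz.
Proof.
split.
- by apply/OzP; exists 1, 1; rewrite !rmorph1 oner_eq0 mulr1.
- move=> x y /OzP[g [h [h0 E]]] /OzP[g' [h' [h0' E']]]; apply/OzP.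
  exists (g * h' - g' * h), (h * h'); rewrite rmorphM mulf_neq0 //; split=> //.
  by rewrite !(rmorphB, rmorphM) /= -E -E'; ring.
- move=> x y /OzP[g [h [h0 E]]] /OzP[g' [h' [h0' E']]]; apply/OzP.
  exists (g * g'), (h * h'); rewrite rmorphM mulf_neq0 //; split=> //.
  by rewrite !rmorphM /= -E -E'; ring.
Qed.
HB.instance Definition _ := GRing.isSubringClosed.Build algC Oz Oz_subring.

Lemma Oz_ev g : evC g \in Oz.
Proof. by apply/OzP; exists g, 1; rewrite !rmorph1 oner_eq0 mulr1. Qed.

Lemma Oz_root : z \in Oz.
Proof. by rewrite -{1}evCX Oz_ev. Qed.

(* [evC g |-> evF g] is a well defined ring homomorphism on Z[z]. *)
Definition reducible := forall g, evC g = 0 -> evF g = 0.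

Hypothesis red : reducible.

Lemma evC_neq0 h : evF h != 0 -> evC h != 0.
Proof. by apply: contra => /eqP/red ->. Qed.

Lemma Oz_evV h : evF h != 0 -> (evC h)^-1 \in Oz.
Proof.
move=> h0; apply/OzP; exists 1, h; split=> //.
by rewrite rmorph1 mulVf // evC_neq0.
Qed.

Lemma Oz_fracP x : x \in Oz -> exists g h, evF h != 0 /\ x = evC g / evC h.
Proof.
case/OzP=> g [h [h0 E]]; exists g, h; split=> //.
by rewrite -E mulfK // evC_neq0.
Qed.

(** The ring is local: a fraction whose numerator does not vanish in the residue field may be turned
    upside down. *)
Lemma Oz_cong0_or_unit x : x \in Oz -> p_cong0 b z x \/ x != 0 /\ x^-1 \in Oz.
Proof.
case/Oz_fracP=> g [h [h0 ->]]; have [g0|g0] := eqVneq (evF g) 0; [left|right].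
  by exists g, h; split=> //; rewrite -!/(evC _) divfK // evC_neq0.
have Cg := evC_neq0 g0; have Ch := evC_neq0 h0.
rewrite mulf_neq0 ?invr_eq0 //; split=> //; rewrite invfM invrK mulrC.
by rewrite rpredM ?Oz_ev ?Oz_evV.
Qed.

Lemma cong0_nunit x : p_cong0 b z x -> x != 0 -> x^-1 \notin Oz.
Proof.
case=> g [h [h0 g0 E]] x0; rewrite -!/(evC _) -!/(evF _) in h0 g0 E *.
apply/negP => /OzP[g' [h' [h0' E']]].
have : evC (h * h' - g * g') = 0.
  rewrite rmorphB !rmorphM /= -E -E'; move: x0 (evC h) (evC h') => x0 u v.
  by field.
move/red; rewrite rmorphB !rmorphM /= g0 mul0r subr0 => /eqP.
by rewrite mulf_eq0 (negPf h0) (negPf h0').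
Qed.

End LocalRing.

Lemma evF_comp (F : fieldType) (b : F) g k : evF b (g \Po 'X^k) = evF (b ^+ k) g.
Proof.
by rewrite /evF /polyF map_comp_poly map_polyXn horner_comp hornerXn.
Qed.
Lemma evC_comp z g k : evC z (g \Po 'X^k) = evC (z ^+ k) g.
Proof.
by rewrite /evC /polyCa map_comp_poly map_polyXn horner_comp hornerXn.
Qed.
Lemma evF_rmorph (F F' : fieldType) (e : {rmorphism F -> F'}) b g :
  evF (e b) g = e (evF b g).
Proof.
rewrite /evF /polyF -horner_map -map_poly_comp; congr (_.[_]).
by apply: eq_map_poly => m /=; rewrite rmorph_int.
Qed.

(** Substituting X^k in numerator and denominator turns fractions in z into fractions in z'; the
    relation between [b] and [b'] keeps the denominator nonzero in the larger residue field. *)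
Lemma Oz_sub (F F' : fieldType) (e : {rmorphism F -> F'}) b z b' z' k :
  z = z' ^+ k -> e b = b' ^+ k -> {subset Oz b z <= Oz b' z'}.
Proof.
move=> -> Eb x /OzP[g [h [h0 E]]]; apply/OzP.
exists (g \Po 'X^k), (h \Po 'X^k); rewrite !evC_comp evF_comp -Eb.
by rewrite evF_rmorph fmorph_eq0.
Qed.

Section Reduction.

Variables (F : fieldType) (b : F) (z : algC).

(** Divide g by the monic Phi_n over the integers. The remainder vanishes at z and has degree below
    that of the minimal polynomial of z, so it is 0, and g inherits the root b from Phi_n. *)
Lemma reducible_Cyclotomic n : n.-primitive_root z -> evF b 'Phi_n = 0 ->
  reducible b z.
Proof.
move=> zn b0 g g0; pose d := 'Phi_n; pose r := Pdiv.Ring.rmodp g d.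
have md : d \is monic by exact: Cyclotomic_monic.
have E := Pdiv.RingMonic.rdivp_eq md g; rewrite -/r in E.
have Cd : evC z d = 0.
  have := root_minCpoly z; rewrite (minCpoly_cyclotomic zn).
  by rewrite -(Cintr_Cyclotomic zn) => /rootP.
have r0 : evC z r = 0 by move: g0; rewrite E rmorphD rmorphM /= Cd mulr0 add0r.
suff -> : g = Pdiv.Ring.rdivp g d * d by rewrite rmorphM /= b0 mulr0.
rewrite [LHS]E; suff -> : r = 0 by rewrite addr0.
have [q [Eq _] qP] := minCpolyP z.
apply/eqP/negPn/negP => rn0.
pose rQ : {poly rat} := map_poly intr r.
have rQC : map_poly ratr rQ = polyCa r.
  by rewrite /polyCa -map_poly_comp; apply: eq_map_poly => m /=; rewrite ratr_int.
have qr : q %| rQ by rewrite -qP rQC; apply/rootP.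
have rQ0 : rQ != 0 by rewrite map_poly_eq0_id0 // ?intr_eq0 ?lead_coef_eq0.
have := dvdp_leq rQ0 qr.
have -> : size rQ = size r by rewrite size_map_poly_id0 // intr_eq0 lead_coef_eq0.
have -> : size q = size d.
  rewrite -(size_map_poly (ratr : rat -> algC)) -Eq (minCpoly_cyclotomic zn).
  by rewrite size_cyclotomic size_Cyclotomic.
by rewrite leqNgt Pdiv.Ring.ltn_rmodp monic_neq0.
Qed.

Lemma evF_prod_Cyclotomic n : (0 < n)%N ->
  \prod_(d <- divisors n) evF b 'Phi_d = b ^+ n - 1.
Proof.
move=> n0; rewrite -rmorph_prod prod_Cyclotomic // rmorphB rmorph1 rmorphXn /=.
by rewrite evFX.
Qed.

Lemma Cyclotomic_dvd n : (0 < n)%N -> evF b 'Phi_n = 0 -> b ^+ n = 1.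
Proof.
move=> n0 b0; apply/eqP; rewrite -subr_eq0 -evF_prod_Cyclotomic //.
rewrite (big_rem n) /= ?b0 ?mul0r //.
by rewrite -dvdn_divisors.
Qed.

Lemma prod_eq0_has (I : eqType) (R : idomainType) (s : seq I) (P : pred I) (f : I -> R) :
  \prod_(i <- s | P i) f i = 0 -> exists i, [/\ i \in s, P i & f i = 0].
Proof.
move/eqP; rewrite prodf_seq_eq0 => /hasP[i si /andP[Pi /eqP fi]].
by exists i.
Qed.

(** The root b of X^m - 1 is a root of Phi_d for some d dividing m; then b^d = 1, and primitivity
    forces d = m. *)
Lemma reducible_prim m : m.-primitive_root z -> m.-primitive_root b ->
  reducible b z.
Proof.
move=> zm bm; have m0 := prim_order_gt0 zm.
apply: (reducible_Cyclotomic zm).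
have : \prod_(d <- divisors m) evF b 'Phi_d = 0.
  by rewrite evF_prod_Cyclotomic // (prim_expr_order bm) subrr.
case/prod_eq0_has=> d [dm _ d0]; have := dvdn_divisors d m0; rewrite dm => dvm.
have /(Cyclotomic_dvd)/(_ d0)/eqP : (0 < d)%N by exact: dvdn_gt0 dvm.
rewrite -(prim_order_dvd bm) => md.
by have /eqP <- : d == m by rewrite eqn_dvd dvm.
Qed.

(** In characteristic p the m-th root b must be shown to be a root of Phi_(pm). The product of the
    Phi_d with d dividing pm and p dividing d is (X^(pm) - 1)/(X^m - 1), the sum of p powers of X^m,
    which takes the value p = 0 at b. If Phi_(pe) is the vanishing factor, then b^(pe) = 1,
    injectivity of Frobenius gives b^e = 1, and e = m. *)
Lemma reducible_prim_p p m : p \in [pchar F] -> coprime p m ->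
  (p * m).-primitive_root z -> m.-primitive_root b -> reducible b z.
Proof.
move=> pF co zm bm; have pp := pcharf_prime pF; have p0 := prime_gt0 pp.
have m0 := prim_order_gt0 bm; have pm0 := prim_order_gt0 zm.
apply: (reducible_Cyclotomic zm).
have : \prod_(d <- divisors (p * m) | (p %| d)%N) evF b 'Phi_d = 0.
  have EZ : \prod_(d <- divisors (p * m) | (p %| d)%N) 'Phi_d
     = \sum_(i < p) ('X^m : {poly int}) ^+ i.
    have X1 : 'X^m - 1 != 0 :> {poly int} by rewrite monic_neq0 // monicXnsubC.
    apply: (mulfI X1); rewrite -subrX1 -exprM [(m * p)%N]mulnC -(prod_Cyclotomic m0).
    rewrite -(prod_Cyclotomic pm0) [RHS](bigID (fun d => p %| d)%N) /= mulrC.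
    congr (_ * _); rewrite -[RHS]big_filter; apply: perm_big; apply: uniq_perm.
    - exact: divisors_uniq.
    - by rewrite filter_uniq // divisors_uniq.
    move=> d; rewrite mem_filter -!dvdn_divisors //; apply/idP/idP.
      move=> dm; rewrite (dvdn_mull _ dm) andbT; apply/negP => pd.
      by move: co; rewrite prime_coprime // (dvdn_trans pd dm).
    case/andP=> pd; rewrite Gauss_dvdr // coprime_sym prime_coprime //.
  rewrite -rmorph_prod EZ rmorph_sum /= (eq_bigr (fun=> 1)); last first.
    by move=> i _; rewrite !rmorphXn /= evFX (prim_expr_order bm) expr1n.
  by rewrite sumr_const card_ord; apply: pcharf0.
case/prod_eq0_has=> d [dm pd d0].
have := dvdn_divisors d pm0; rewrite dm => dvm.
have /(Cyclotomic_dvd)/(_ d0) : (0 < d)%N by exact: dvdn_gt0 dvm.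
case/dvdnP: pd d0 dvm => e ->; rewrite mulnC => d0 dvm bd.
have /eqP : b ^+ e = 1.
  apply: (fmorph_inj (pFrobenius_aut pF)).
  by rewrite rmorph1 /= pFrobenius_autE -exprM mulnC bd.
rewrite -(prim_order_dvd bm) => me; rewrite dvdn_pmul2l // in dvm.
by have /eqP <- : e == m by rewrite eqn_dvd dvm.
Qed.

End Reduction.

(* A zero of [g] in the residue field kills [g z * (1 - g z ^ (#|F| - 1))] modulo p, by Frobenius. *)
Lemma Oz_unramified (F : finFieldType) (b : F) z p s x : prime p ->
  #|F| = (p ^ s)%N -> (#|F|.-1).-primitive_root z ->
  (#|F|.-1).-primitive_root b ->
  p_cong0 b z x -> exists2 y, y \in Oz b z & x = p%:R * y.
Proof.
move=> pp cF zm bm [g [h []]]; rewrite -!/(evF _ _) -!/(evC _ _) => h0 g0 E.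
have red := reducible_prim zm bm.
have [t Et] := exp_prime_pow_poly s g pp.
have F1 := finNzRing_gt1 F.
have ps : (p ^ s = (p ^ s).-1.+1)%N by rewrite prednK // expn_gt0 prime_gt0.
have zs : z ^+ (p ^ s) = z.
  by rewrite ps exprSr -cF (prim_expr_order zm) mul1r.
pose k := 1 - g ^+ (p ^ s).-1.
have k0 : evF b k != 0.
  rewrite rmorphB rmorph1 rmorphXn /= g0 expr0n -cF.
  have -> : (#|F|.-1 == 0)%N = false by case: #|F| F1 => [|[]].
  by rewrite subr0 oner_eq0.
have Eg : evC z g * evC z k = p%:R * evC z (- t).
  have := congr1 (evC z) Et; rewrite rmorphXn rmorphD rmorphM /= evC_comp zs.
  rewrite rmorph_nat {1}ps exprS => Eg.
  rewrite rmorphB rmorph1 rmorphXn rmorphN mulrBr mulr1 Eg /=; ring.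
exists (evC z (- t) / (evC z k * evC z h)).
  by rewrite rpredM ?Oz_ev // -rmorphM Oz_evV // rmorphM mulf_neq0.
have Ch := evC_neq0 red h0; have Ck := evC_neq0 red k0.
apply: (mulIf Ch); rewrite E; apply: (mulIf Ck); rewrite Eg; field.
by rewrite Ch Ck.
Qed.

(** * The integers localized at p *)

Section RationalLocalRing.

Variable p : nat.
Hypothesis pp : prime p.

(** With both generators equal to 1 only the integers g(1) and h(1) matter, so these are the
    rationals with denominator prime to p. *)
Definition Zloc : {pred algC} := fun x => x \in Oz (1 : 'F_p) 1.
Fact Zloc_subring : subring_closed Zloc.
Proof.
split=> [|x y Zx Zy|x y Zx Zy]; rewrite -topredE /= /Zloc.
- exact: rpred1.
- exact: rpredB.
- exact: rpredM.
Qed.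
HB.instance Definition _ := GRing.isSubringClosed.Build algC Zloc Zloc_subring.

Lemma evF1 (F : fieldType) (g : {poly int}) : evF (1 : F) g = (g.[1])%:~R.
Proof. by rewrite /evF /polyF -[1]/(1%:~R) horner_map /=. Qed.
Lemma evC1 (g : {poly int}) : evC 1 g = (g.[1])%:~R.
Proof. by rewrite /evC /polyCa -[1]/(1%:~R) horner_map /=. Qed.

Lemma ZlocP x : reflect (exists (m : int) (k : nat), ~~ (p %| k)%N /\ x = m%:~R / k%:R)
  (x \in Zloc).
Proof.
have pF := pchar_Fp pp.
apply: (iffP (OzP _ _ _)) => [[g [h]]|[m [k [pk ->]]]].
  rewrite evF1 !evC1 -(dvdz_pcharf pF) => -[h0 E].
  have h1 : h.[1] != 0 by apply: contraNneq h0 => ->; rewrite dvdz0.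
  exists (Num.sg h.[1] * g.[1]), `|h.[1]|%N; split=> //.
  have -> : (`|h.[1]|%N%:R : algC) = (Num.sg h.[1] * h.[1])%:~R.
    by rewrite -normrEsg -abszE -pmulrn.
  rewrite !rmorphM /= -E invfM mulrACA divff ?intr_eq0 ?sgr_eq0 //.
  by rewrite mul1r mulfK // intr_eq0.
exists m%:P, k%:R%:P; rewrite evF1 !evC1 !hornerC /=.
have k0 : (k%:R : algC) != 0.
  by rewrite pnatr_eq0; apply: contraNneq pk => ->; rewrite dvdn0.
rewrite -[_%:~R](_ : k%:R = _); last by rewrite rmorph_nat.
rewrite -(dvdn_pcharf pF) pk; split=> //.
by rewrite rmorph_nat divfK.
Qed.

Lemma ZlocV k : ~~ (p %| k)%N -> k%:R^-1 \in Zloc.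
Proof. by move=> pk; apply/ZlocP; exists 1, k; rewrite mul1r. Qed.

Lemma Zloc_Oz (F : fieldType) (b : F) z : p \in [pchar F] ->
  {subset Zloc <= Oz b z}.
Proof.
move=> pF x /ZlocP[m [k [pk ->]]]; rewrite rpredM ?rpred_int //.
apply/OzP; exists 1, k%:R; rewrite rmorph1 !rmorph_nat -(dvdn_pcharf pF).
split=> //; rewrite mulVf // pnatr_eq0.
by apply: contraNneq pk => ->; rewrite dvdn0.
Qed.

Lemma Zloc_Fermat x : x \in Zloc -> eqm Zloc p%:R (x ^+ p) x.
Proof.
case/ZlocP=> m [k [pk ->]]; have k0 : (k%:R : algC) != 0.
  by rewrite pnatr_eq0; apply: contraNneq pk => ->; rewrite dvdn0.
have [u Su Eu] := @eqm_exp_int p pp _ Zloc m.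
have [v Sv Ev] := @eqm_exp_nat p pp _ Zloc k.
have Vk := ZlocV pk.
exists ((u - m%:~R / k%:R * v) / k%:R ^+ p).
  by rewrite rpredM ?rpredB ?rpredM ?rpred_int // -exprVn rpredX.
have kp : (k%:R : algC) ^+ p != 0 by rewrite expf_neq0.
rewrite exprMn Eu exprVn; set P := _ ^+ p in kp Ev *; set M := m%:~R / k%:R.
have -> : m%:~R = M * (P - p%:R * v) by rewrite Ev addrK divfK.
by field.
Qed.

End RationalLocalRing.

(** * The Artin-Hasse series *)

Section ArtinHasse.

Variable p : nat.
Hypothesis pp : prime p.
Let p0 := prime_gt0 pp.
Let p1 := prime_gt1 pp.

Lemma logn_fact_lt n : (0 < n)%N -> (logn p n`! < n)%N.
Proof.
move=> n0; rewrite logn_fact //.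
(* In Legendre's sum the current quotient n/p^L is kept as a reserve: it at least halves at each
   step and so pays for the next term. The [maxn 1] yields the strict inequality. *)
suff H L : (\sum_(1 <= k < L.+1) n %/ p ^ k + maxn 1 (n %/ p ^ L) <= n)%N.
  by apply: leq_trans (H n); rewrite -addn1 leq_add2l leq_maxl.
elim: L => [|L IH].
  by rewrite big_geq // expn0 divn1; lia.
rewrite big_nat_recr //=; apply: leq_trans IH.
have : (2 * (n %/ p ^ L.+1) <= n %/ p ^ L)%N.
  rewrite expnSr divnMA; apply: leq_trans (leq_divM _ p); rewrite mulnC.
  by rewrite leq_mul2l p1 orbT.
by move: (n %/ _)%N (n %/ _)%N (\sum_(1 <= k < _) _)%N => x y s; lia.
Qed.

Lemma Zloc_pow_div k m : (0 < k)%N -> (logn p k <= m)%N ->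
  p%:R ^+ m / k%:R \in Zloc p.
Proof.
move=> k0 km; have E : k%:R = (k`_p)%:R * (k`_p^')%:R :> algC.
  by rewrite -natrM partnC.
rewrite E invfM mulrA p_part natrX.
rewrite rpredM //; last first.
  by apply: ZlocV => //; have := part_pnat p^' k; rewrite p'natE.
rewrite -(subnK km) exprD mulfK ?rpredX ?rpred_nat //.
by rewrite expf_neq0 // pnatr_eq0 -lt0n.
Qed.

Definition ppow (k : nat) := k == (p ^ logn p k)%N.

Lemma ppowX i : ppow (p ^ i)%N.
Proof. by rewrite /ppow pfactorK. Qed.

Lemma ppowP k : reflect (exists i, k = p ^ i)%N (ppow k).
Proof.
by apply: (iffP eqP) => [->|[i ->]]; [exists (logn p k)|rewrite pfactorK].
Qed.

(* [zeta_series A] is exp(sum_k A_k t^k / k), so this is exp(w * sum_i t^(p^i) / p^i). *)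
Definition expAH (w : algC) : series := zeta_series (fun k => w * (ppow k)%:R).
Definition ah := expAH 1.

Lemma ah0 : ah 0%N = 1. Proof. exact: zeta_series0. Qed.

(** Below degree p only the term t of the exponent is visible, so the series agrees with exp t.
    These are the coefficients that survive in A^I. *)
Lemma ah_small k : (k < p)%N -> ah k = (k`!)%:R^-1.
Proof.
elim: k => [|k IH] kp; first by rewrite ah0 fact0 invr1.
have k0 : (k.+1%:R : algC) != 0 by rewrite pnatr_eq0.
apply: (mulIf k0); rewrite /ah /expAH zeta_seriesS big_ord_recl big1 => [|i _].
  rewrite addr0 subn0 -/(expAH 1) -/ah IH 1?ltnW // mul1r.
  rewrite -[1%N](expn0 p) ppowX mul1r factS natrM invfM mulrAC mulVf ?mul1r //.
rewrite mul1r lift0; case: ppowP => [[[|j] E]|]; rewrite ?mul0r //.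
have := ltn_ord i; have : (p <= i.+2)%N by rewrite E expnS leq_pmulr ?expn_gt0 ?p0.
by lia.
Qed.

Lemma eqX_comp n (f g : {poly algC}) : eqX n f g -> eqX n (f \Po 'X^p) (g \Po 'X^p).
Proof.
move/eqXP=> [h ->]; rewrite comp_polyD comp_polyM comp_Xn_poly -exprM.
apply: (@eqX_weak _ n (p * n)); first by rewrite leq_pmull.
by apply/eqXP; exists (h \Po 'X^p).
Qed.

Lemma coef_comp_Xn (f : {poly algC}) k :
  (f \Po 'X^p)`_k = if (p %| k)%N then f`_(k %/ p)%N else 0.
Proof. by rewrite coef_comp_poly_Xn. Qed.

Lemma expAH_pow n w m :
  eqX n (truncs n (expAH (w *+ m))) (truncs n (expAH w) ^+ m).
Proof.
elim: m => [|m IH].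
  case: n => // n; apply: zeta_series_unique; first by rewrite expr0 coef1.
  move=> k kn; rewrite expr0 mulr1 coefXM coef_deriv coef_poly kn coef1 /=.
  by case: eqP => // _; rewrite mulr0n mul0r mul0rn.
rewrite exprS mulrS; apply: eqX_trans (eqXM (@eqX_refl _ _ _) IH).
have := @truncs_zeta_seriesD n (fun k => w * (ppow k)%:R) (fun k => (w *+ m) * (ppow k)%:R).
apply: eqX_trans; apply: eqX_truncs => k kn; rewrite coef_truncs //.
by apply: eq_zeta_series => j _; rewrite mulrDl.
Qed.

(** This is exp(pt), the defect between E(t)^p and E(t^p) for the Artin-Hasse series E. *)
Definition expp : series := zeta_series (fun k => p%:R * (k == 1%N)%:R).

Lemma exppE k : expp k = p%:R ^+ k / (k`!)%:R.
Proof.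
elim: k => [|k IH]; first by rewrite /expp zeta_series0 fact0 divr1.
have k0 : (k.+1%:R : algC) != 0 by rewrite pnatr_eq0.
apply: (mulIf k0); rewrite /expp zeta_seriesS big_ord_recl big1 => [|i _].
  rewrite addr0 subn0 -/expp IH mulr1 factS natrM exprS invfM.
  by rewrite [X in _ = _ * X * _]mulrC -!mulrA mulVf // mulr1.
by rewrite mulr0 mul0r.
Qed.

Lemma expp_small k : (0 < k)%N -> eqm (Zloc p) p%:R (expp k) 0.
Proof.
case: k => // k _; exists (p%:R ^+ k / (k.+1`!)%:R).
  by rewrite Zloc_pow_div ?fact_gt0 // -ltnS logn_fact_lt.
by rewrite exppE add0r exprS mulrA.
Qed.

(** Multiplying the exponent by p gives pt plus the sum over i >= 1 of t^(p^i) / p^(i-1), and the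
    latter is the original exponent at t^p. [B] and [A] below are the logarithmic derivatives of
    these two parts. *)
Lemma ah_Frobenius n :
  eqX n (truncs n ah ^+ p) ((truncs n ah \Po 'X^p) * truncs n expp).
Proof.
apply: eqX_trans (eqX_sym (@expAH_pow n 1 p)) _.
pose A k : algC := p%:R * ((p %| k)%N && ppow (k %/ p)%N)%:R.
pose B k : algC := p%:R * (k == 1%N)%:R.
have EAB : eqX n (truncs n (expAH (1 *+ p))) (truncs n (zeta_series A) * truncs n expp).
  apply: eqX_trans (truncs_zeta_seriesD A B); apply: eqX_truncs => k kn.
  rewrite coef_truncs //; apply: eq_zeta_series => j _.
  rewrite /A /B -mulrDr; congr (_ * _); rewrite -natrD; congr (_%:R).
  have [->|j1] := eqVneq j 1%N.
    by rewrite -[1%N](expn0 p) ppowX dvdn1 expn0 gtn_eqF.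
  rewrite addn0; case: (ppowP j) => [[[|i] E]|nj].
  - by rewrite E eqxx in j1.
  - by rewrite E expnS dvdn_mulr // mulKn // ppowX.
  case: andP => // -[/dvdnP[m Em]]; rewrite Em mulnK // => /ppowP[i Ei].
  by case: nj; exists i.+1; rewrite Em Ei expnSr.
apply: eqX_trans EAB _; apply: eqXM => //; case: n => // n.
apply: zeta_series_unique; first by rewrite coef_comp_Xn dvdn0 div0n coef_truncs // ah0.
have -> : 'X * (truncs n.+1 ah \Po 'X^p)^`() =
    p%:R *: (('X * (truncs n.+1 ah)^`()) \Po 'X^p).
  rewrite deriv_comp derivXn comp_polyM comp_polyX scaler_nat.
  set Y := _ \Po _; have -> : 'X^p = 'X * 'X^(p.-1) :> {poly algC}.
    by rewrite -exprS prednK.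
  by rewrite !mulrnAr; congr (_ *+ _); ring.
apply: (@eqX_trans _ _ (p%:R *: ((logder n.+1 (fun k => 1 * (ppow k)%:R) * truncs n.+1 ah) \Po 'X^p))).
  move=> k kn; rewrite !coefZ; congr (_ * _).
  exact: (eqX_comp (@zeta_series_logder _ _)).
rewrite comp_polyM scalerAl; apply: eqXM => // k kn.
rewrite coefZ coef_comp_Xn !coef_poly kn; have [->|kn0] := eqVneq k 0%N.
  by rewrite dvdn0 div0n /= mulr0.
rewrite /A; case: dvdnP => [[m Em]|]; rewrite ?mulr0 //= Em mulnK //.
have m0 : (m == 0)%N = false by apply: contraNF kn0 => /eqP m0; rewrite Em m0.
rewrite m0 mul1r; suff -> : (m < n.+1)%N by [].
by apply: leq_ltn_trans kn; rewrite Em leq_pmulr.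
Qed.

(** Dwork's argument. Let E be the part below degree m, integral by induction, and c the coefficient
    in degree m. In E(t)^p = E(t^p) exp(pt), the left side contributes (E^p)_m + pc. The right side
    does not involve c, as m/p < m, and is congruent to the m-th coefficient of E(t^p) modulo p.
    Since E(t)^p and E(t^p) agree modulo p, pc is p times an integral element. *)
Lemma ah_Zloc k : ah k \in Zloc p.
Proof.
elim/ltn_ind: k => -[|n] IH; first by rewrite ah0 rpred1.
set m := n.+1; set c := ah m; set E := truncs m ah.
have SE : E \in polyO (Zloc p).
  apply/polyOP => i; rewrite coef_poly; case: ifP => [im|_]; last exact: rpred0.
  exact: IH.
have EE : truncs m.+1 ah = E + c *: 'X^m.
  apply/polyP=> i; rewrite coefD coefZ coefXn !coef_poly ltnS leq_eqVlt.
  by case: eqP => [->|_] /=; rewrite ?ltnn ?add0r ?mulr1 // mulr0 addr0.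
have E0 : E`_0 = 1 by rewrite coef_truncs // ah0.
have Epow j : eqX m.+1 ((E + c *: 'X^m) ^+ j) (E ^+ j + (c *+ j) *: 'X^m).
  elim: j => [|j IHj]; first by rewrite !expr0 scale0r addr0.
  rewrite exprS; apply: eqX_trans (eqXM (@eqX_refl _ _ _) IHj) _.
  have Ej0 k : (E ^+ k)`_0 = 1 by rewrite -horner_coef0 horner_exp horner_coef0 E0 expr1n.
  move=> k km; rewrite mulrDl !mulrDr -exprS -!scalerAl -!scalerAr scalerA !coefD !coefZ.
  rewrite -exprD !coefXn [E * 'X^m]mulrC !coefXnM; move: km; rewrite ltnS leq_eqVlt.
  case/orP=> [/eqP ->|km].
    rewrite ltnn subnn Ej0 E0 eqxx mulrS -[X in (X == _)]addn0 eqn_add2l /=; ring.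
  rewrite km; have -> : (k == m + m)%N = false by apply/eqP => E1; move: km; rewrite E1; lia.
  have -> : (k == m)%N = false by apply: ltn_eqF.
  by rewrite !mulr0n !mulr0 !addr0.
have /(_ m (leqnn _)) := @ah_Frobenius m.+1.
rewrite EE Epow // coefD coefZ coefXn eqxx mulr1 -mulr_natl => H.
have SX : E \Po 'X^p \in polyO (Zloc p).
  apply/polyOP => i; rewrite coef_comp_Xn; case: ifP => _; last exact: rpred0.
  exact: (polyOP _ _ SE).
have Ec i : (i <= m)%N -> ((E + c *: 'X^m) \Po 'X^p)`_i = (E \Po 'X^p)`_i.
  move=> im; rewrite !coef_comp_Xn coefD coefZ coefXn; case: ifP => // _.
  rewrite ltn_eqF ?mulr0 ?addr0 //; apply: leq_ltn_trans (leq_div2r p im) _.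
  by rewrite ltn_Pdiv.
have R1 : eqm (Zloc p) p%:R (((E + c *: 'X^m) \Po 'X^p) * truncs m.+1 expp)`_m (E \Po 'X^p)`_m.
  rewrite coefM big_ord_recr /= subnn coef_truncs // exppE fact0 expr0 divr1 mulr1.
  rewrite Ec // -[X in eqm _ _ _ X]add0r; apply: eqmD; last exact: eqm_refl.
  apply: eqm_sum0 => i _; rewrite mulrC; apply: eqm0M.
    by rewrite Ec ?(ltnW (ltn_ord i)) //; apply/polyOP.
  by rewrite coef_truncs ?ltnS ?leq_subr //; apply: expp_small; rewrite subn_gt0.
have R2 : eqm (Zloc p) p%:R (E ^+ p)`_m (E \Po 'X^p)`_m.
  have [w Sw ->] := eqm_exp_poly pp (@Zloc_Fermat p pp) SE.
  exists w`_m; first exact/polyOP.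
  by rewrite coefD mulr_natl coefMn mulr_natl.
have : eqm (Zloc p) p%:R ((E ^+ p)`_m + p%:R * c) (E ^+ p)`_m.
  by rewrite H; apply: eqm_trans R1 (eqm_sym R2).
case=> w Sw /addrI; have pn0 : (p%:R : algC) != 0 by rewrite pnatr_eq0 -lt0n.
by move/(mulfI pn0) ->.
Qed.

End ArtinHasse.

(** * Teichmüller representatives *)

(** The p elements of the prime field already exhaust the roots of X^p - X. *)
Lemma prime_field_root (F : fieldType) p (c : F) : p \in [pchar F] ->
  c ^+ p = c -> exists2 k : nat, (k < p)%N & c = k%:R.
Proof.
move=> pF cp; have pp := pcharf_prime pF.
pose rs : seq F := [seq i%:R | i <- iota 0 p].
have [/mapP[i]|crs] := boolP (c \in rs).
  by rewrite mem_iota => ip ->; exists i.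
have inj i j : (i < p)%N -> (j < p)%N -> i%:R = j%:R :> F -> i = j.
  wlog ij : i j / (i <= j)%N => [H ip jp E|_ jp /esym/eqP].
    by case: (leqP i j) => [|/ltnW] h; [apply: H|symmetry; apply: H].
  rewrite -subr_eq0 -natrB // -(dvdn_pcharf pF) => /dvdn_leq.
  by case: (ltngtP i j) ij => // ij _ /(_ ltac:(by rewrite subn_gt0)); lia.
have urs : uniq (c :: rs).
  rewrite /= crs map_inj_in_uniq ?iota_uniq // => i j.
  by rewrite !mem_iota /= => ip jp; apply: inj.
pose P : {poly F} := 'X^p - 'X.
have sP : size P = p.+1.
  by rewrite size_polyDl ?size_polyXn // size_polyN size_polyX ltnS prime_gt1.
have P0 : P != 0 by rewrite -size_poly_eq0 sP.
have : all (root P) (c :: rs).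
  rewrite /= /root !hornerE cp subrr eqxx /=.
  apply/allP => _ /mapP[i _ ->]; rewrite /root !hornerE.
  by rewrite -(pFrobenius_autE pF) rmorph_nat subrr.
by move/(max_poly_roots P0)/(_ urs); rewrite sP /= size_map size_iota ltnn.
Qed.

Lemma primitive_rootM (F : fieldType) (z y : F) m p k l :
  m.-primitive_root z -> p.-primitive_root y ->
  (z * y) ^+ k = z -> (z * y) ^+ l = y -> coprime p m ->
  (p * m).-primitive_root (z * y).
Proof.
move=> zm yp zk yl co; set x := z * y.
have xpm : x ^+ (p * m) = 1.
  rewrite exprMn mulnC exprM (prim_expr_order zm) expr1n mul1r.
  by rewrite mulnC exprM (prim_expr_order yp) expr1n.
have pm0 : (0 < p * m)%N by rewrite muln_gt0 (prim_order_gt0 zm) (prim_order_gt0 yp).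
have [n xn nd] := prim_order_exists pm0 xpm.
suff /eqP <- : n == (p * m)%N by [].
rewrite eqn_dvd nd /= Gauss_dvd //; apply/andP; split.
  by rewrite (prim_order_dvd yp) -yl -exprM mulnC exprM (prim_expr_order xn) expr1n.
by rewrite (prim_order_dvd zm) -zk -exprM mulnC exprM (prim_expr_order xn) expr1n.
Qed.

Lemma prim_root_neq0 (F : fieldType) (x : F) m : m.-primitive_root x -> x != 0.
Proof.
move=> xm; apply: contra_eq_neq (prim_expr_order xm) => ->.
by rewrite expr0n gtn_eqF ?(prim_order_gt0 xm) // eq_sym oner_eq0.
Qed.

Section Teichmuller.

Variables (F : finFieldType) (b : F) (z : algC).
Let q := #|F|.
Hypotheses (zq : q.-1.-primitive_root z) (bq : q.-1.-primitive_root b).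
Let q1 : (1 < q)%N := finNzRing_gt1 F.
Let qE : q = q.-1.+1. Proof. by rewrite prednK // ltnW. Qed.

Let red : reducible b z := reducible_prim zq bq.

Lemma dlogK x : x != 0 -> b ^+ dlog b x = x.
Proof.
move=> x0; rewrite /dlog; case: pickP => [k /eqP //|H].
have : x ^+ q.-1 = 1.
  by apply: (mulfI x0); rewrite -exprS -qE mulr1 expf_card.
by case/(prim_rootP bq)=> i E; have := H i; rewrite E eqxx.
Qed.

Local Notation tau := (teich b z).

Lemma teich0 : tau 0 = 0. Proof. by rewrite /teich eqxx. Qed.

Lemma teich_exp k : tau (b ^+ k) = z ^+ k.
Proof.
have b0 : b ^+ k != 0 by rewrite expf_neq0 // (prim_root_neq0 bq).
rewrite /teich (negPf b0); apply/eqP.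
by rewrite (eq_prim_root_expr zq) -(eq_prim_root_expr bq) dlogK.
Qed.

Lemma teich1 : tau 1 = 1.
Proof. by rewrite -(expr0 b) teich_exp expr0. Qed.

Lemma teichM x y : tau (x * y) = tau x * tau y.
Proof.
have [->|x0] := eqVneq x 0; first by rewrite mul0r teich0 mul0r.
have [->|y0] := eqVneq y 0; first by rewrite mulr0 teich0 mulr0.
by rewrite -(dlogK x0) -(dlogK y0) -exprD !teich_exp exprD.
Qed.

Lemma teichX x k : tau (x ^+ k) = tau x ^+ k.
Proof. by elim: k => [|k IH]; rewrite ?expr0 ?teich1 // !exprS teichM IH. Qed.

Lemma teich_prod (I : Type) (r : seq I) (P : pred I) (f : I -> F) :
  tau (\prod_(i <- r | P i) f i) = \prod_(i <- r | P i) tau (f i).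
Proof. by apply: (big_morph tau teichM teich1). Qed.

Lemma teich_card x : tau x ^+ q = tau x.
Proof. by rewrite -teichX expf_card. Qed.

Lemma teich_lift x : exists g, evC z g = tau x /\ evF b g = x.
Proof.
have [->|x0] := eqVneq x 0; first by exists 0; rewrite !rmorph0 teich0.
exists ('X^(dlog b x)).
by rewrite !rmorphXn /= evCX evFX dlogK // -teich_exp dlogK.
Qed.

Lemma teich_Oz x : tau x \in Oz b z.
Proof. by have [g [<- _]] := teich_lift x; apply: Oz_ev. Qed.

Lemma teich_eq0 x : (tau x == 0) = (x == 0).
Proof.
apply/eqP/eqP => [|->]; last exact: teich0.
have [g [Eg Fg]] := teich_lift x; rewrite -Eg -Fg; exact: red.
Qed.

Lemma sum_teich_unit k :
  \sum_(x | x != 0) tau x ^+ k = if (q.-1 %| k)%N then q.-1%:R else 0.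
Proof.
case: ifP => [qk|nqk].
  rewrite (eq_bigr (fun=> 1)) => [|x x0].
    rewrite sumr_const; congr (_%:R); rewrite /q [in RHS](cardD1 0) inE add1n /=.
    by apply: eq_card => x; rewrite !inE andbT.
  case/dvdnP: qk => m ->; rewrite -(dlogK x0) teich_exp -exprM mulnC mulnAC.
  by rewrite mulnC exprM (prim_expr_order zq) expr1n.
set S := \sum_(x | _) _; have zk1 : z ^+ k != 1 by rewrite -(prim_order_dvd zq) nqk.
have b0 := prim_root_neq0 bq.
have : S = z ^+ k * S.
  rewrite mulr_sumr {1}/S (reindex_onto ( *%R b) ( *%R b^-1)) => [|x _] /=; last first.
    by rewrite mulrA mulfV // mul1r.
  apply: eq_big => x; first by rewrite mulrA mulVf // mul1r eqxx andbT mulf_eq0 (negPf b0).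
  by move=> _; rewrite teichM -[b in tau b]expr1 teich_exp expr1 exprMn.
move/eqP; rewrite -subr_eq0 -{1}[S]mul1r -mulrBl mulf_eq0 subr_eq0 eq_sym.
by rewrite (negPf zk1) => /eqP.
Qed.

Lemma sum_teich k : \sum_x tau x ^+ k =
  if (q.-1 %| k)%N then q%:R - (0 < k)%N%:R else 0.
Proof.
rewrite (bigD1 0) //= sum_teich_unit teich0 expr0n.
case: posnP => [->|k0] /=; first by rewrite dvdn0 subr0 nat1r -qE.
by rewrite add0r; case: ifP => // _; rewrite -subn1 natrB // ltnW.
Qed.

End Teichmuller.

Lemma eqm_residue (F : fieldType) (b : F) z p g g' :
  p \in [pchar F] -> reducible b z ->
  eqm (Oz b z) p%:R (evC z g) (evC z g') -> evF b g = evF b g'.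
Proof.
move=> pF red [w Sw E]; have [u [h [h0 Ew]]] := Oz_fracP red Sw.
have Ch := evC_neq0 red h0.
have : evC z ((g - g') * h - p%:R * u) = 0.
  rewrite !(rmorphB, rmorphM) /= E Ew rmorph_nat; by field.
move/red; rewrite !(rmorphB, rmorphM) /= rmorph_nat (pcharf0 pF) mul0r subr0.
by move/eqP; rewrite mulf_eq0 (negPf h0) orbF subr_eq0 => /eqP.
Qed.

Lemma natC_neq0 k : (0 < k)%N -> (k%:R : algC) != 0.
Proof. by rewrite pnatr_eq0 lt0n. Qed.

Lemma coef_comp_cX (R : comNzRingType) (f : {poly R}) c k :
  (f \Po (c *: 'X))`_k = f`_k * c ^+ k.
Proof.
rewrite comp_polyE coef_sum (eq_bigr (fun i : 'I__ => f`_i * (c ^+ i * (k == i)%:R))).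
  have [kf|fk] := ltnP k (size f).
    rewrite (bigD1 (Ordinal kf)) //= eqxx mulr1 big1 ?addr0 // => i ik.
    suff -> : (k == i)%N = false by rewrite !mulr0.
    by apply: contraNF ik => /eqP E; apply/eqP/val_inj.
  rewrite nth_default // mul0r big1 // => i _.
  by rewrite gtn_eqF ?mulr0 // (leq_trans (ltn_ord i)).
by move=> i _; rewrite coefZ exprZn coefZ coefXn.
Qed.

(** * Products of Artin-Hasse series at Teichmüller points *)

Section Character.

Variables (F : finFieldType) (b : F) (z : algC) (p s : nat).
Hypotheses (pp : prime p) (cF : #|F| = (p ^ s)%N).
Hypotheses (zq : (#|F|.-1).-primitive_root z) (bq : (#|F|.-1).-primitive_root b).

Let p0 := prime_gt0 pp.

Lemma pcharF_card : p \in [pchar F].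
Proof. exact: card_finPcharP cF pp. Qed.
Let pF := pcharF_card.

Let red : reducible b z := reducible_prim zq bq.

Lemma coprime_p_card : coprime p #|F|.-1.
Proof.
have F1 := finNzRing_gt1 F.
rewrite prime_coprime //; apply/negP => pq.
have : (p %| #|F|)%N.
  rewrite cF; case: s cF F1 => [->|s' _ _] //; by rewrite expnS dvdn_mulr.
rewrite -(prednK (ltnW F1)) -addn1 dvdn_addr // dvdn1 => /eqP p1.
by move: pp; rewrite p1.
Qed.

Section Frobenius.

Variable sigma : {rmorphism algC -> algC}.
Hypothesis sigmaE : forall x, x ^+ (#|F|.-1) = 1 -> sigma x = x ^+ p.

Lemma sigma_evC g : sigma (evC z g) = evC z (g \Po 'X^p).
Proof.
rewrite evC_comp -sigmaE ?(prim_expr_order zq) //.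
rewrite /evC /polyCa -horner_map -map_poly_comp; congr (_.[_]).
by apply: eq_map_poly => m /=; rewrite rmorph_int.
Qed.

(** [sigma] lifts Frobenius, so the residue c of a fixed element satisfies c^p = c and is the
    residue of some natural k. Unramifiedness gives v = k + p y with y again fixed; M rounds produce
    the first M p-adic digits of v. *)
Lemma frob_fixed_nat M v : v \in Oz b z -> sigma v = v ->
  exists B : nat, eqm (Oz b z) (p%:R ^+ M) v B%:R.
Proof.
elim: M v => [|M IH] v Ov sv.
  by exists 0%N, v => //; rewrite expr0 mul1r add0r.
have [g [h [h0 Ev]]] := Oz_fracP red Ov; have Ch := evC_neq0 red h0.
have Frob f : evF b (f \Po 'X^p) = evF b f ^+ p.
  by rewrite evF_comp -[b ^+ p](pFrobenius_autE pF) evF_rmorph.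
have Ch' : evC z (h \Po 'X^p) != 0.
  by apply: (evC_neq0 red); rewrite Frob expf_neq0.
set c := evF b g / evF b h.
have cp : c ^+ p = c.
  have : evC z (g * (h \Po 'X^p) - (g \Po 'X^p) * h) = 0.
    rewrite rmorphB !rmorphM /=; move: sv; rewrite Ev fmorph_div /= !sigma_evC.
    move/eqP; rewrite eqr_div // => /eqP ->; ring.
  move/red; rewrite rmorphB !rmorphM /= !Frob => /eqP; rewrite subr_eq0 => /eqP E.
  apply/eqP; rewrite /c expr_div_n eqr_div ?expf_neq0 //; by rewrite E.
have [k _ ck] := prime_field_root pF cp.
have : p_cong0 b z (v - k%:R).
  exists (g - k%:R * h), h; rewrite -!/(evF _ _) -!/(evC _ _); split=> //.
    by rewrite rmorphB rmorphM rmorph_nat /= -ck divfK // subrr.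
  by rewrite rmorphB rmorphM rmorph_nat /= Ev mulrBl divfK.
case/(Oz_unramified pp cF zq bq) => y Oy Ey.
have pn0 : (p%:R : algC) != 0 by rewrite natC_neq0.
have sy : sigma y = y.
  apply: (mulfI pn0); rewrite -Ey -[in LHS](rmorph_nat sigma p) -rmorphM /= -Ey.
  by rewrite rmorphB /= sv rmorph_nat.
have [B [w Ow Ew]] := IH y Oy sy; exists (k + p * B)%N, w => //.
by rewrite natrD natrM -[LHS](subrK k%:R) Ey Ew exprS; ring.
Qed.

End Frobenius.

Local Notation tau := (teich b z).

(** Frobenius permutes the s conjugates of a Teichmüller lift cyclically, so their sum is fixed. The
    second clause ties B to the trace in the finite field, on which the additive character
    depends. *)
Lemma teich_trace_nat (J : finType) (mm : J -> F) M : (0 < M)%N ->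
  exists B : nat,
    eqm (Oz b z) (p%:R ^+ M) (\sum_j \sum_(i < s) tau (mm j) ^+ (p ^ i)) B%:R /\
    B%:R = \sum_j \sum_(i < s) mm j ^+ (p ^ i).
Proof.
move=> M0; have [sigma sigmaE] := Qn_aut_exists coprime_p_card.
have s0 : (0 < s)%N by case: s cF (finNzRing_gt1 F) => [->|].
set w := \sum_j _.
have Ow : w \in Oz b z.
  by apply: rpred_sum => j _; apply: rpred_sum => i _; rewrite rpredX ?teich_Oz.
have tp x : sigma (tau x) = tau x ^+ p.
  have [->|x0] := eqVneq x 0.
    by rewrite teich0 rmorph0 expr0n eqn0Ngt p0.
  apply: sigmaE; have t0 : tau x != 0 by rewrite teich_eq0.
  apply: (mulfI t0); rewrite -exprS prednK ?mulr1 ?teich_card //.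
  exact: ltnW (finNzRing_gt1 F).
have sw : sigma w = w.
  rewrite rmorph_sum /=; apply: eq_bigr => j _; rewrite rmorph_sum /=.
  case: s cF s0 => // s' cF' _.
  rewrite big_ord_recr [RHS]big_ord_recl /= addrC expn0 expr1; congr (_ + _).
    by rewrite rmorphXn /= tp -exprM -expnS -cF' teich_card.
  by apply: eq_bigr => i _; rewrite rmorphXn /= tp -exprM -expnS.
have [B BE] := frob_fixed_nat sigmaE M Ow sw; exists B; split=> //.
have [g [Eg Fg]] : exists g, evC z g = w /\
    evF b g = \sum_j \sum_(i < s) mm j ^+ (p ^ i).
  have /all_sig [G GE] : forall j, {g | evC z g = tau (mm j) /\ evF b g = mm j}.
    by move=> j; apply: cid; apply: teich_lift.
  exists (\sum_j \sum_(i < s) G j ^+ (p ^ i)).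
  by split; rewrite rmorph_sum; apply: eq_bigr => j _; rewrite rmorph_sum;
    apply: eq_bigr => i _; rewrite rmorphXn /= ?(GE j).1 ?(GE j).2.
rewrite -Fg -(rmorph_nat (evF b) B); symmetry.
apply: (eqm_residue pF red); rewrite Eg rmorph_nat.
case: M M0 BE => // M _; rewrite exprS; apply: eqm_weak.
by rewrite rpredX ?rpred_nat.
Qed.

Lemma truncs_zeta_prod n (I : finType) (A : I -> series) :
  eqX n (\prod_i truncs n (zeta_series (A i)))
        (truncs n (zeta_series (fun k => \sum_i A i k))).
Proof.
have H r : eqX n (\prod_(i <- r) truncs n (zeta_series (A i)))
        (truncs n (zeta_series (fun k => \sum_(i <- r) A i k))); last exact: H.
elim: r => [|i r IH].
  case: n => // n; apply: eqX_sym.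
  apply: zeta_series_unique; first by rewrite big_nil coef1.
  move=> k kn; rewrite big_nil mulr1 coefXM coef_deriv coef_poly kn coef1 /=.
  by case: eqP => // _; rewrite big_nil mul0rn.
rewrite big_cons; apply: eqX_trans (eqXM (@eqX_refl _ _ _) IH) _.
apply: eqX_trans (eqX_sym (@truncs_zeta_seriesD n _ _)) _.
apply: eqX_truncs => k kn; rewrite coef_truncs //.
by apply: eq_zeta_series => j _; rewrite big_cons.
Qed.

Lemma Zloc_Ozb : {subset Zloc p <= Oz b z}.
Proof. exact: Zloc_Oz. Qed.

(** Up to degree D the exponential divides only by integers at most D, whose p-parts divide p^D; the
    surplus D in the exponent absorbs them. *)
Lemma expAH_small M D y k : y \in Oz b z -> (0 < k <= D)%N ->
  eqm (Oz b z) (p%:R ^+ M) (expAH p (p%:R ^+ (M + D) * y) k) 0.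
Proof.
move=> Oy kD; apply: (zeta_series_small (n := D)); rewrite ?rpredX ?rpred_nat //.
move=> j l _ /andP[l0 lD]; exists (p%:R ^+ D / l%:R * (y * (ppow p j)%:R)).
  apply: rpredM; last by rewrite rpredM ?rpred_nat.
  apply: Zloc_Ozb; apply: Zloc_pow_div => //.
  by apply: leq_trans (ltnW (ltn_logl _ _)) lD.
by rewrite add0r exprD; field; rewrite natC_neq0.
Qed.

Definition AHpoly D := truncs D.+1 (ah p).

Lemma AHpoly_Oz D : AHpoly D \in polyO (Oz b z).
Proof.
apply/polyOP => i; rewrite coef_poly; case: ifP => _; last exact: rpred0.
by apply: Zloc_Ozb; apply: ah_Zloc.
Qed.

(** The product is the exponential of w times the Artin-Hasse exponent, w being the sum of all
    conjugates. Writing w = B + p^(M+D) y splits off the B-th power and leaves a factor that is 1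
    modulo p^M. *)
Lemma AHpoly_prod (J : finType) (mm : J -> F) M D : (0 < M)%N ->
  exists B : nat, exists2 g, g \in polyO (Oz b z) &
    eqX D.+1 (\prod_j \prod_(i < s) (AHpoly D \Po (tau (mm j) ^+ (p ^ i) *: 'X)))
             (AHpoly D ^+ B + (p%:R ^+ M) *: g) /\
    B%:R = \sum_j \sum_(i < s) mm j ^+ (p ^ i).
Proof.
move=> M0; have MD0 : (0 < M + D)%N by rewrite addn_gt0 M0.
have [B [[y Oy Ey] EB]] := teich_trace_nat mm MD0.
exists B; set w := \sum_j _ in Ey.
pose g1 : {poly algC} := \poly_(k < D.+1)
  (if k == 0%N then 0 else expAH p (p%:R ^+ (M + D) * y) k / p%:R ^+ M).
have Og1 : g1 \in polyO (Oz b z).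
  apply/polyOP => k; rewrite coef_poly; case: ifP => kD; last exact: rpred0.
  case: eqP => [_|/eqP k0]; first exact: rpred0.
  have [|v Ov ->] := @expAH_small M D y k Oy; first by rewrite lt0n k0.
  by rewrite add0r mulrC mulKf ?expf_neq0 ?natC_neq0.
have E1 : eqX D.+1 (truncs D.+1 (expAH p (p%:R ^+ (M + D) * y))) (1 + (p%:R ^+ M) *: g1).
  apply: eqX_truncs => k kD; rewrite coefD coef1 coefZ coef_poly kD.
  case: eqP => [->|_]; first by rewrite mulr0 addr0 /expAH zeta_series0.
  by rewrite add0r [RHS]mulrC divfK // expf_neq0 ?natC_neq0.
exists (AHpoly D ^+ B * g1); last split=> //.
  by rewrite rpredM ?rpredX ?AHpoly_Oz.
have -> : AHpoly D ^+ B + p%:R ^+ M *: (AHpoly D ^+ B * g1) =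
  AHpoly D ^+ B * (1 + p%:R ^+ M *: g1) by rewrite mulrDr mulr1 scalerAr.
apply: eqX_trans (eqXM (@expAH_pow p D.+1 1 B) E1).
apply: eqX_trans (@truncs_zeta_seriesD _ _ _).
apply: (@eqX_trans _ _ (truncs D.+1 (expAH p w))); last first.
  apply: eqX_truncs => k kD; rewrite coef_truncs //; apply: eq_zeta_series => j _.
  by rewrite Ey; ring.
rewrite pair_bigA /=.
apply: (@eqX_trans _ _ (\prod_(i : J * 'I_s) truncs D.+1 (zeta_series
   (fun k => (tau (mm i.1) ^+ (p ^ i.2)) ^+ k * (1 * (ppow p k)%:R))))).
  apply: eqX_prod => -[j i] _ /=; apply: eqX_sym; apply: eqX_truncs => k kD.
  rewrite zeta_series_scale; set c := tau _ ^+ _.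
  by rewrite coef_comp_cX coef_truncs // mulrC.
apply: eqX_trans (@truncs_zeta_prod _ _ _) _.
apply: eqX_truncs => k kD; rewrite coef_truncs //; apply: eq_zeta_series => l _.
case: (ppowP pp l) => [[t ->]|_]; last by rewrite mulr0n !mulr0 big1 // => i _; rewrite mulr0.
rewrite [RHS]mulr1; transitivity (\sum_j \sum_(i < s) (tau (mm j) ^+ (p ^ i)) ^+ (p ^ t)).
  by rewrite pair_bigA; apply: eq_bigr => -[j i] _; rewrite !mulr1.
(* Raising each of the s conjugates to the power p^t only permutes them, so the coefficient of every
   t^(p^t) in the exponent is the same w. *)
apply: eq_bigr => j _; elim: t => [|t IHt].
  by apply: eq_bigr => i _; rewrite expn0 expr1.
rewrite -{}IHt; case: s cF => [_|s' cF']; first by rewrite !big_ord0.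
rewrite big_ord_recr [RHS]big_ord_recl /= addrC; congr (_ + _).
  by rewrite expn0 expr1 -exprM -expnD addnS -addSn expnD exprM -cF' teich_card.
by apply: eq_bigr => i _; rewrite -!exprM -!expnD addnS.
Qed.

End Character.

(** * Adjoining a p-th root of unity *)

Lemma eqm_sub (R : comNzRingType) (S S' : subringClosed R) c x y :
  {subset S <= S'} -> eqm S c x y -> eqm S' c x y.
Proof. by move=> SS' [w Sw ->]; exists w; rewrite ?SS'. Qed.

Section Cong0.

Variables (F : fieldType) (b : F) (z : algC).
Hypothesis red : reducible b z.

Lemma cong0D x y : p_cong0 b z x -> p_cong0 b z y -> p_cong0 b z (x + y).
Proof.
case=> g [h [h0 g0 E]] [g' [h' [h0' g0' E']]].
rewrite -!/(evC _ _) -!/(evF _ _) in h0 g0 E h0' g0' E'.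
exists (g * h' + g' * h), (h * h'); rewrite -!/(evC _ _) -!/(evF _ _).
rewrite !(rmorphD, rmorphM) /= g0 g0' !mul0r addr0 mulf_neq0 //; split=> //.
by rewrite -E -E'; ring.
Qed.

Lemma cong0M x y : p_cong0 b z x -> y \in Oz b z -> p_cong0 b z (x * y).
Proof.
case=> g [h [h0 g0 E]] /OzP[g' [h' [h0' E']]].
rewrite -!/(evC _ _) -!/(evF _ _) in h0 g0 E.
exists (g * g'), (h * h'); rewrite -!/(evC _ _) -!/(evF _ _).
rewrite !rmorphM /= g0 mul0r mulf_neq0 //; split=> //.
by rewrite -E -E'; ring.
Qed.

Lemma cong0_ev g : evF b g = 0 -> p_cong0 b z (evC z g).
Proof.
move=> g0; exists g, 1; rewrite -!/(evC _ _) -!/(evF _ _).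
by rewrite !rmorph1 oner_eq0 mulr1.
Qed.

Lemma cong0_1 : ~ p_cong0 b z 1.
Proof.
move/(cong0_nunit red)/(_ (oner_neq0 _)); rewrite invr1; apply/negP.
by rewrite negbK rpred1.
Qed.

Lemma cong0_p p : p \in [pchar F] -> p_cong0 b z p%:R.
Proof.
move=> pF; rewrite -(rmorph_nat (evC z)); apply: cong0_ev.
by rewrite rmorph_nat pcharf0.
Qed.

(** If p divided the denominator, the numerator would be a unit and 1 would be p times an element of
    the ring, against [cong0_1]. *)
Lemma Oz_rat p x : p \in [pchar F] -> x \in Crat -> x \in Oz b z -> x \in Zloc p.
Proof.
move=> pF /CratP[a ->] Oa; have pp := pcharf_prime pF.
have E : ratr a * (denq a)%:~R = (numq a)%:~R :> algC.
  by rewrite /ratr divfK // intr_eq0 denq_neq0.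
have [pd|pd] := boolP (p %| `|denq a|)%N; last first.
  apply/(ZlocP pp); exists (numq a), `|denq a|%N; split=> //.
  by rewrite -E natr_absz ger0_norm ?denq_ge0 // mulfK // intr_eq0 denq_neq0.
have pn : ~~ (p %| `|numq a|)%N.
  apply/negP => pn; have := coprime_num_den a; rewrite /coprime.
  have := dvdn_gcd p `|numq a| `|denq a|; rewrite pn pd => /= pg /eqP E1.
  by move: pg; rewrite E1 dvdn1 => /eqP p1; move: pp; rewrite p1.
have n0 : numq a != 0 by apply: contraNneq pn => ->; rewrite dvdn0.
have [m Em] : exists m : int, denq a = m * p%:Z.
  by apply/dvdzP; rewrite dvdzE.
case: cong0_1.
have Vn : ((numq a)%:~R : algC)^-1 = (Num.sg (numq a))%:~R / `|numq a|%N%:R.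
  rewrite natr_absz normrEsg rmorphM /= invfM mulrA divff ?mul1r //.
  by rewrite intr_eq0 sgr_eq0.
have : p_cong0 b z (p%:R * (ratr a * m%:~R / (numq a)%:~R)).
  apply: cong0M; first exact: cong0_p.
  apply: rpredM; first exact: rpredM Oa (rpred_int _ _).
  rewrite Vn; apply: rpredM; first exact: rpred_int.
  exact: (Zloc_Oz pp b z pF) (ZlocV pp pn).
have E2 : p%:R * (ratr a * m%:~R) = (numq a)%:~R :> algC.
  by rewrite -E Em rmorphM mulrA [RHS]mulrA mulrC mulrA -[in RHS]mulrA [in RHS]mulrC -!mulrA.
by rewrite mulrA E2 divff // intr_eq0.
Qed.

End Cong0.

Lemma horner_eqm (S : subringClosed algC) c x y g : x \in S -> y \in S -> c \in S ->
  eqm S c x y -> eqm S c (evC x g) (evC y g).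
Proof.
move=> Sx Sy Sc xy; rewrite /evC !horner_coef; apply: eqm_sum => i _.
apply: eqmMl; last exact: eqmX.
by rewrite /polyCa coef_map_id0 // rpred_int.
Qed.

(* The norm of x, divided by x, is a polynomial in x. *)
Lemma algC_dvd_int (x : algC) : x != 0 ->
  exists2 D : int, D != 0 & exists g, D%:~R = x * evC x g.
Proof.
move=> x0; have [q [Eq mq] _] := minCpolyP x^-1.
have rq : root (map_poly ratr q) x^-1 by rewrite -Eq root_minCpoly.
have [f [a a0 Ef]] := rat_poly_scale q.
have fx : (polyCa f).[x^-1] = 0.
  have Ef2 : polyCa f = a%:~R *: map_poly ratr q.
    rewrite Ef /polyCa linearZ /= -map_poly_comp /= fmorphV /= ratr_int scalerA.
    rewrite mulfV ?scale1r ?intr_eq0 //; apply: eq_map_poly => m /=.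
    by rewrite ratr_int.
  by rewrite Ef2 hornerZ (eqP rq) mulr0.
have q0 : q != 0 by rewrite monic_neq0.
have f0 : f != 0 by apply: contraNneq q0 => f0; rewrite Ef f0 rmorph0 scaler0.
exists (lead_coef f); first by rewrite lead_coef_eq0.
case sf : (size f) => [|n]; first by move: f0; rewrite -size_poly_eq0 sf.
exists (- \sum_(i < n) (f`_i)%:P * 'X^(n.-1 - i)%N).
have := fx; rewrite horner_coef size_map_poly_id0; last first.
  by rewrite intr_eq0 lead_coef_eq0.
rewrite sf big_ord_recr /= => /(congr1 (fun y => y * x ^+ n)).
rewrite mul0r mulrDl -mulrA -exprMn mulVf // expr1n mulr1.
rewrite lead_coefE sf /= coef_map_id0 // => /eqP; rewrite addrC addr_eq0 => /eqP ->.
rewrite rmorphN rmorph_sum mulrN mulr_sumr mulr_suml /=; congr (- _).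
apply: eq_bigr => i _; rewrite rmorphM rmorphXn /= evCX.
have -> : evC x (f`_i)%:P = (f`_i)%:~R by rewrite /evC /polyCa map_polyC hornerC.
rewrite coef_map_id0 // mulrCA -exprS -mulrA; congr (_ * _).
have En : n = (i + (n.-1 - i).+1)%N by have := ltn_ord i; lia.
by rewrite [X in _ * x ^+ X = _]En exprD mulrA -exprMn mulVf // expr1n mul1r.
Qed.

Section RamifiedRing.

Variables (F : finFieldType) (b : F) (z y : algC) (p s : nat).
Hypotheses (pp : prime p) (cF : #|F| = (p ^ s)%N).
Hypotheses (zq : (#|F|.-1).-primitive_root z) (bq : (#|F|.-1).-primitive_root b).
Hypothesis yp : p.-primitive_root y.

Local Notation O := (Oz b (z * y)).
Local Notation lam := (y - 1).

Let p0 := prime_gt0 pp.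
Let p1 := prime_gt1 pp.
Let pF := pcharF_card pp cF.
Let F1 := finNzRing_gt1 F.
Let co := coprime_p_card pp cF.

(** The product z y generates both roots: the exponent q kills y and fixes z, while (q-1)(p-1),
    which is 1 modulo p, kills z and fixes y. So the ring with y adjoined is again of the form
    [Oz]. *)
Lemma zy_card : (z * y) ^+ #|F| = z.
Proof.
have s0 : (0 < s)%N by case: s cF F1 => [->|].
rewrite exprMn {2}cF -(prednK s0) expnS exprM (prim_expr_order yp) expr1n mulr1.
by rewrite -(prednK (ltnW F1)) exprS (prim_expr_order zq) mulr1.
Qed.

Lemma zy_y : (z * y) ^+ (#|F|.-1 * p.-1) = y.
Proof.
rewrite exprMn exprM (prim_expr_order zq) expr1n mul1r.
rewrite -{2}[y]expr1; apply/eqP; rewrite (eq_prim_root_expr yp).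
apply/eqP; have /dvdnP[m Em] : (p %| #|F|)%N.
  by rewrite cF; case: s cF F1 => [->|s' _ _] //; rewrite expnS dvdn_mulr.
have -> : (#|F|.-1 * p.-1 = (m * p - m - 1) * p + 1)%N.
  by move: F1; rewrite Em; case: m {Em} => // m _; case: p p1 => // k k1 /=; nia.
by rewrite modnMDl.
Qed.

Lemma zy_primitive : (p * #|F|.-1).-primitive_root (z * y).
Proof. exact: primitive_rootM zq yp zy_card zy_y co. Qed.

Lemma red_zy : reducible b (z * y).
Proof. exact: reducible_prim_p pF co zy_primitive bq. Qed.
Let red := red_zy.

Lemma Oz_zy : {subset Oz b z <= O}.
Proof.
apply: (@Oz_sub F F idfun b z b (z * y) #|F|); first by rewrite zy_card.
by rewrite expf_card.
Qed.

Lemma y_O : y \in O.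
Proof. by rewrite -{1}zy_y rpredX // Oz_root. Qed.

Lemma lam_O : lam \in O. Proof. by rewrite rpredB ?rpred1 ?y_O. Qed.

Lemma lam_neq0 : lam != 0.
Proof.
rewrite subr_eq0; apply: contraTneq yp => ->; apply/negP => /prim_order_dvd /(_ 1%N).
by rewrite expr1 eqxx dvdn1 => /eqP E; move: pp; rewrite E.
Qed.

Lemma lam_cong0 : p_cong0 b (z * y) lam.
Proof.
have -> : lam = evC (z * y) ('X ^+ (#|F|.-1 * p.-1) - 1).
  by rewrite rmorphB rmorphXn rmorph1 /= evCX zy_y.
apply: cong0_ev; rewrite rmorphB rmorphXn rmorph1 /= evFX exprM.
by rewrite (prim_expr_order bq) expr1n subrr.
Qed.

Lemma eqm_lam_cong0 x : eqm O lam x 0 -> p_cong0 b (z * y) x.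
Proof. by case=> w Ow ->; rewrite add0r; apply: cong0M => //; apply: lam_cong0. Qed.

Lemma eqm_lam_unit x : eqm O lam x (-1) -> x \in O /\ x^-1 \in O.
Proof.
move=> x1; have Ox : x \in O.
  by apply: (eqm_mem lam_O (eqm_sym x1)); rewrite rpredN rpred1.
split=> //; case: (Oz_cong0_or_unit red Ox) => [x0|[]] //.
case: (cong0_1 red); have -> : 1 = (- x) + (x + 1) by ring.
apply: cong0D; first by rewrite -mulN1r [-1 * x]mulrC; apply: cong0M => //; rewrite rpredN rpred1.
apply: eqm_lam_cong0; have -> : 0 = -1 + 1 :> algC by ring.
by apply: eqmD => //; apply: eqm_refl.
Qed.

(** Evaluating (X^p - 1)/(X - 1) at 1 writes p as the product of the 1 - y^i. Taking lam out of each
    factor leaves -(1 + ... + y^(i-1)), which is -i modulo lam, and Wilson's theorem evaluates the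
    product. The sign (-1)^(p-1) is 1 modulo lam also for p = 2, as lam divides 2 then. *)
Lemma p_lam : eqm O lam (p%:R / lam ^+ p.-1) (-1).
Proof.
have E : p%:R = \prod_(1 <= i < p) (1 - y ^+ i).
  have X1 : 'X - 1 != 0 :> {poly algC} by rewrite monic_neq0 // monicXsubC.
  have := factor_Xn_sub_1 yp; rewrite big_ltn // expr0 subrX1 => /(mulfI X1).
  move/(congr1 (fun f => f.[1])); rewrite horner_prod horner_sum => E.
  transitivity (\sum_(i < p) ('X^i : {poly algC}).[1]).
    by rewrite (eq_bigr (fun=> 1)) ?sumr_const ?card_ord // => i _; rewrite hornerXn expr1n.
  by rewrite -E; apply: eq_bigr => i _; rewrite hornerXsubC.
pose S i := \sum_(j < i) y ^+ j.
have E2 : p%:R = lam ^+ p.-1 * ((-1) ^+ p.-1 * \prod_(1 <= i < p) S i).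
  rewrite E; transitivity (\prod_(1 <= i < p) (lam * (-1 * S i))).
    by apply: eq_bigr => i _; rewrite mulrCA /S -subrX1 mulN1r opprB.
  by rewrite !big_split /= !prodr_const_nat subn1.
rewrite E2 [X in eqm _ _ X _]mulrC mulKf ?expf_neq0 ?lam_neq0 //.
have SO i : S i \in O by apply: rpred_sum => j _; rewrite rpredX ?y_O.
have y1 : eqm O lam y 1 by exists 1; rewrite ?rpred1 // mulr1 addrC subrK.
have S1 i : eqm O lam (S i) i%:R.
  rewrite -[in X in eqm _ _ _ X](card_ord i) -sumr_const; apply: eqm_sum => j _.
  by have := eqmX j lam_O y_O y1; rewrite expr1n.
have pl : eqm O lam p%:R 0.
  rewrite E2; exists (lam ^+ p.-2 * ((-1) ^+ p.-1 * \prod_(1 <= i < p) S i)).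
    by rewrite !rpredM ?rpredX ?rpredN ?rpred1 ?lam_O // rpred_prod.
  by rewrite add0r [RHS]mulrA -exprS prednK // -subn1 subn_gt0.
have P1 : eqm O lam (\prod_(1 <= i < p) S i) (p.-1`!)%:R.
  rewrite fact_prod prednK // natr_prod; apply: eqm_prod => [|i _|i _] //.
  exact: lam_O.
have W : eqm O lam (p.-1`!)%:R (-1).
  have := Wilson p1; rewrite pp => /esym/dvdnP[m Em].
  have -> : (p.-1`!)%:R = -1 + p%:R * m%:R :> algC.
    by rewrite -natrM mulnC -Em -natr1; ring.
  rewrite -[X in eqm _ _ _ X]addr0; apply: eqmD; first exact: eqm_refl.
  by apply: eqm0M => //; apply: rpred_nat.
have sgn : eqm O lam ((-1) ^+ p.-1) 1.
  case: (even_prime pp) => [p2|op].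
    have E3 : -1 = 1 - p%:R :> algC by rewrite p2; ring.
    rewrite [X in eqm _ _ (_ ^+ X) _](_ : _ = 1%N) ?p2 // expr1 [X in eqm _ _ X _]E3.
    by have := eqmB (@eqm_refl _ O lam 1) pl; rewrite subr0.
  by rewrite -signr_odd -subn1 oddB // op expr0; exact: eqm_refl.
rewrite -[X in eqm _ _ _ X]mul1r; apply: eqmM => //.
- by rewrite rpredX // rpredN rpred1.
- by rewrite rpredN rpred1.
- exact: eqm_trans P1 W.
Qed.

End RamifiedRing.

(** * The uniformizer y - 1 and the choice of pi *)

Section Uniformizer.

Variables (F : finFieldType) (b : F) (z y : algC) (p s : nat).
Hypotheses (pp : prime p) (cF : #|F| = (p ^ s)%N).
Hypotheses (zq : (#|F|.-1).-primitive_root z) (bq : (#|F|.-1).-primitive_root b).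
Hypothesis yp : p.-primitive_root y.

Local Notation O := (Oz b (z * y)).
Local Notation lam := (y - 1).

Let p0 := prime_gt0 pp.
Let p1 := prime_gt1 pp.
Let pF := pcharF_card pp cF.
Let red := red_zy pp cF zq bq yp.
Let lamO := lam_O pp cF zq bq yp : lam \in O.
Let lam0 := lam_neq0 pp yp.
Let pn0 : (p%:R : algC) != 0 := natC_neq0 p0.

Lemma p_lam_unit : exists2 u, u \in O /\ u^-1 \in O & p%:R = lam ^+ p.-1 * u.
Proof.
have [Ou OVu] := eqm_lam_unit pp cF zq bq yp (p_lam pp cF zq bq yp).
by exists (p%:R / lam ^+ p.-1) => //; rewrite [RHS]mulrC divfK // expf_neq0.
Qed.

(** So lam generates the maximal ideal: modulo lam a numerator g(zy) may be replaced by g(z), which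
    is a multiple of p because the ring of z is unramified, hence a multiple of lam. *)
Lemma cong0_lam x : p_cong0 b (z * y) x -> eqm O lam x 0.
Proof.
case=> g [h [h0 g0 E]]; rewrite -!/(evC _ _) -!/(evF _ _) in h0 g0 E.
have Ch := evC_neq0 red h0; have -> : x = evC (z * y) g / evC (z * y) h.
  by rewrite -E mulfK.
apply: eqm0M; first exact: Oz_evV.
have zO : z \in O by apply: (Oz_zy cF zq yp); exact: Oz_root.
apply: (@eqm_trans _ _ _ (evC z g)).
  apply: horner_eqm => //; first exact: Oz_root.
  by exists z => //; ring.
have [w Ow ->] := Oz_unramified pp cF zq bq (cong0_ev z g0).
have [u [Ou _] ->] := p_lam_unit; exists (lam ^+ p.-2 * (u * w)).
  by rewrite rpredM ?rpredX ?rpredM // (Oz_zy cF zq yp).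
by rewrite add0r -(prednK (_ : 0 < p.-1)%N) ?exprS; [ring|rewrite -subn1 subn_gt0].
Qed.

(** The numerator of x divides a nonzero integer D. If lam^((p-1)|D|), a unit times p^|D|, divided
    x, then p^|D| would divide D, although p^|D| > |D|. *)
Lemma lam_valuation_bound x : x \in O -> x != 0 -> exists N, x / lam ^+ N \notin O.
Proof.
move=> /(Oz_fracP red)[g [h [h0 Ex]]] x0; have Ch := evC_neq0 red h0.
have Cg : evC (z * y) g != 0 by apply: contra x0; rewrite Ex => /eqP ->; rewrite mul0r.
have [D D0 [f Ef]] := algC_dvd_int Cg.
exists (p.-1 * `|D|)%N; apply/negP => H; have [u [Ou OVu] Eu] := p_lam_unit.
have u0 : u != 0 by apply: contraNneq pn0 => u0; rewrite Eu u0 mulr0.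
have HO : D%:~R / p%:R ^+ `|D| \in O.
  have -> : D%:~R / p%:R ^+ `|D| =
     x / lam ^+ (p.-1 * `|D|) * (evC (z * y) h * evC (evC (z * y) g) f * u^-1 ^+ `|D|).
    rewrite Ef Ex Eu exprMn -exprM exprVn; field.
    by rewrite Ch !expf_neq0.
  rewrite rpredM // !rpredM ?Oz_ev ?rpredX //.
  rewrite /evC; apply: rpred_horner; last exact: Oz_ev.
  by apply/polyOverP => i; rewrite coef_map_id0 // rpred_int.
have Qx : D%:~R / p%:R ^+ `|D| \in Crat.
  by rewrite rpredM ?rpredV ?rpredX ?rpred_nat ?Crat_int ?rpred_int.
have /(ZlocP pp)[m [k [pk E]]] := Oz_rat red pF Qx HO.
have k0 : (k%:R : algC) != 0.
  by rewrite pnatr_eq0; apply: contraNneq pk => ->; rewrite dvdn0.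
have {}E : D * k%:Z = m * p%:Z ^+ `|D|.
  apply: (@intr_inj algC); rewrite !rmorphM rmorphXn /=.
  apply/eqP; rewrite -eqr_div ?expf_neq0 //; apply/eqP.
  by rewrite E.
have : (p ^ `|D| %| `|D| * k)%N.
  have -> : (`|D| * k)%N = (`|m| * p ^ `|D|)%N.
    by have := congr1 absz E; rewrite !abszM abszX.
  exact: dvdn_mull.
rewrite Gauss_dvdl; last by rewrite coprimeXl // prime_coprime.
move/dvdn_leq; rewrite absz_gt0 => /(_ D0); rewrite leqNgt ltn_expl //.
Qed.

Lemma lam_valuation x : x \in O -> x != 0 ->
  exists k u, [/\ u \in O, u^-1 \in O & x = lam ^+ k * u].
Proof.
move=> Ox x0; have [N NP] := lam_valuation_bound Ox x0.
elim: N x Ox x0 NP => [|N IH] x Ox x0; first by rewrite divr1 Ox.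
case: (Oz_cong0_or_unit red Ox) => [/cong0_lam[w Ow Ex]|[_ OVx]] NP; last first.
  by exists 0%N, x; rewrite mul1r.
rewrite add0r in Ex; have w0 : w != 0 by apply: contraNneq x0 => w0; rewrite Ex w0 mulr0.
have [|k [u [Ou OVu Ew]]] := IH w Ow w0.
  by apply: contra NP; rewrite Ex exprS -mulf_div divff // mul1r.
by exists k.+1, u; split=> //; rewrite Ex Ew exprS mulrA.
Qed.

(** The series starts with 1 + t, so at arguments divisible by lam a change u of the argument
    changes the value by u modulo lam u. Subtracting the current error therefore gains one power of
    lam. The start is pi = lam, where 1 + lam = y. *)
Lemma AHpoly_Newton D T : (0 < D)%N ->
  exists pi w, [/\ w \in O, pi = lam * (1 + lam * w) &
    eqm O (lam ^+ T.+2) (AHpoly p D).[pi] y].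
Proof.
move=> D0; set P := AHpoly p D.
have OP : P \in polyO O.
  apply/polyOP=> i; rewrite coef_poly; case: ifP => _; last exact: rpred0.
  by apply: (Zloc_Oz pp _ _ pF); exact: ah_Zloc.
have P0 : P`_0 = 1 by rewrite coef_truncs // ah0.
have P1 : P`_1 = 1 by rewrite coef_truncs // ah_small // invr1.
have step w h : w \in O -> h \in O ->
    eqm O (lam * (lam * h)) P.[lam * w + lam * h] (P.[lam * w] + lam * h).
  move=> Ow Oh; rewrite !horner_coef; case sP : (size P) => [|[|n]].
  - by move: P0; rewrite nth_default ?sP // => /esym/eqP; rewrite oner_eq0.
  - by move: P1; rewrite nth_default ?sP // => /esym/eqP; rewrite oner_eq0.
  rewrite !big_ord_recl /= P0 P1 /bump /= !expr0 !expr1 !mul1r.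
  set x := lam * w; set u := lam * h; set S1 := \sum_(i < n) _; set S2 := \sum_(i < n) _.
  suff S12 : eqm O (lam * u) S1 S2.
    rewrite (_ : 1 + (x + u + S1) = 1 + x + u + S1); last by ring.
    rewrite (_ : 1 + (x + S2) + u = 1 + x + u + S2); last by ring.
    by apply: eqmD => //; exact: eqm_refl.
  have Olw : w + h \in O by exact: rpredD.
  apply: eqm_sum => i _; apply: eqmMl; first exact/polyOP.
  rewrite !add1n; set k := i.+1; rewrite /x /u -mulrDr !exprMn.
  have [v Ov Ev] : eqm O h ((w + h) ^+ k.+1) (w ^+ k.+1).
    by apply: eqmX => //; exists 1; rewrite ?rpred1 // mulr1.
  exists (lam ^+ i * v); first by rewrite rpredM ?rpredX.
  by rewrite Ev !exprS; ring.
elim: T => [|T [pi [w [Ow Epi [e Oe Ee]]]]].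
  exists lam, 0; split; [exact: rpred0|by rewrite mulr0 addr0 mulr1|].
  have := step 0 1 (rpred0 _) (rpred1 _).
  have E : 1 + lam = y by ring.
  by rewrite !mulr0 !mulr1 add0r horner_coef0 P0 E expr2.
exists (pi - lam ^+ T.+2 * e), (w - lam ^+ T * e); split.
- by rewrite rpredB // rpredM ?rpredX.
- by rewrite Epi !exprS; ring.
have Ow1 : 1 + lam * w \in O by rewrite rpredD ?rpred1 ?rpredM.
have Oh : - (lam ^+ T.+1 * e) \in O by rewrite rpredN rpredM ?rpredX.
have := step _ _ Ow1 Oh; rewrite -Epi => -[v Ov Ev].
exists (- e * v); first by rewrite rpredM ?rpredN.
have -> : pi - lam ^+ T.+2 * e = pi + lam * (- (lam ^+ T.+1 * e)) by rewrite !exprS; ring.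
by rewrite Ev Ee !exprS; ring.
Qed.

(** Up to a unit, lam^((p-1)M) is p^M, which fixes the number of Newton steps. The lower bound on D
    makes pi^(D+1) a multiple of p^M, so that identities modulo X^(D+1) can be evaluated at pi. *)
Lemma exists_pi M D : (0 < M)%N -> (0 < D)%N -> (p.-1 * M <= D.+1)%N ->
  exists2 pi, eqm O lam pi 0 & [/\ pi \in O, pi != 0, eqm O (p%:R ^+ M) (AHpoly p D).[pi] y,
    eqm O lam (pi ^+ p.-1 / p%:R) (-1) & eqm O (p%:R ^+ M) (pi ^+ D.+1) 0].
Proof.
move=> M0 D0 MD; have [pi [w [Ow Epi [e Oe Ee]]]] := AHpoly_Newton (p.-1 * M) D0.
have Ow1 : 1 + lam * w \in O by rewrite rpredD ?rpred1 ?rpredM.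
have w10 : 1 + lam * w != 0.
  apply/eqP => E; case: (cong0_1 red).
  have <- : lam * (- w) = 1 by apply: (addIr (lam * w)); rewrite E; ring.
  by apply: cong0M; rewrite ?rpredN //; exact: (lam_cong0 pp cF zq bq yp).
have [Ou OVu] := eqm_lam_unit pp cF zq bq yp (p_lam pp cF zq bq yp).
set u := p%:R / _ in Ou OVu.
have lp : lam ^+ p.-1 = p%:R / u by rewrite /u invfM invrK mulrA divff // mul1r.
have u1 : eqm O lam u^-1 (-1).
  have [v Ov Ev] : eqm O lam u (-1) := p_lam pp cF zq bq yp.
  have u0 : u != 0 by rewrite mulf_neq0 // invr_eq0 expf_neq0.
  exists (u^-1 * v); first by rewrite rpredM.
  by apply: (mulfI u0); rewrite divff // mulrDr mulrCA [u * (_ * _)]mulrA divff // {1}Ev; ring.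
have pi1 : eqm O lam (pi ^+ p.-1 / p%:R) (-1).
  have -> : pi ^+ p.-1 / p%:R = u^-1 * (1 + lam * w) ^+ p.-1.
    by rewrite Epi exprMn lp; field; rewrite pn0 mulf_neq0 // invr_eq0 expf_neq0.
  rewrite -[X in eqm _ _ _ X]mulr1; apply: eqmM => //; first exact: rpred1.
  have w1 : eqm O lam (1 + lam * w) 1 by exists w.
  by have := eqmX p.-1 lamO Ow1 w1; rewrite expr1n.
exists pi.
  by exists (1 + lam * w); rewrite // add0r.
split=> //.
- by rewrite Epi rpredM.
- by rewrite Epi mulf_neq0.
- exists (lam ^+ 2 * (u^-1 ^+ M * e)); first by rewrite rpredM ?rpredX ?rpredM ?rpredX.
  by rewrite Ee -addn2 exprD exprM lp exprMn; ring.
rewrite -(subnKC MD) exprD; apply: eqm0M; first by rewrite rpredX // Epi rpredM.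
have [Opi _] := eqm_lam_unit pp cF zq bq yp pi1.
exists ((pi ^+ p.-1 / p%:R) ^+ M); first by rewrite rpredX.
by rewrite add0r -exprMn [p%:R * _]mulrC divfK // exprM.
Qed.

End Uniformizer.

(** * Residue field extensions *)

(** Let t be the product of the primes of m that do not divide j. A prime of m then divides exactly
    one of j and t, and one that divides j does not divide k, so none divides j + kt. *)
Lemma coprime_lift j k m : (0 < m)%N -> coprime j k -> exists t, coprime (j + k * t) m.
Proof.
move=> m0 jk; pose t := (\prod_(l <- primes m | ~~ (l %| j)%N) l)%N.
have tP l : prime l -> (l %| m)%N -> (l %| t)%N = ~~ (l %| j)%N.
  move=> pl lm; apply/idP/idP => [lt|lj].
    have [l' [pl' lj' ll']] : exists l', [/\ prime l', ~~ (l' %| j)%N & (l %| l')%N].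
      move: lt; rewrite /t big_seq_cond.
      apply: (big_ind (fun n => l %| n -> _)%N) => [|n n' IH IH'|i /andP[]].
      - by rewrite dvdn1 => /eqP l1; move: pl; rewrite l1.
      - by rewrite Euclid_dvdM // => /orP[/IH|/IH'].
      - by rewrite mem_primes => /and3P[pi _ _] ij li; exists i.
    by move: ll'; rewrite dvdn_prime2 // => /eqP ->.
  rewrite /t (big_rem l) ?mem_primes ?pl ?m0 ?lm //= lj.
  exact: dvdn_mulr.
exists t; rewrite coprime_sym; apply/negPn/negP => co.
have g1 : (1 < gcdn m (j + k * t))%N.
  by rewrite ltn_neqAle eq_sym co gcdn_gt0 m0.
have pl := pdiv_prime g1; have := pdiv_dvd (gcdn m (j + k * t)).
set l := pdiv _ in pl *; rewrite dvdn_gcd => /andP[lm].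
have [lj|lj] := boolP (l %| j)%N; last first.
  by rewrite dvdn_addl ?(negPf lj) // dvdn_mull // tP.
rewrite dvdn_addr // Euclid_dvdM // tP // lj orbF => lk.
have := dvdn_gcd l j k; rewrite lj lk (eqP jk) dvdn1 => /eqP l1.
by move: pl; rewrite l1.
Qed.

(** Here x = (x0^c)^j with j prime to k. Changing j modulo k makes it prime to ck, and x0 to that
    power is the root sought. *)
Lemma prim_root_lift (K : fieldType) c k (x x0 : K) :
  (c * k).-primitive_root x0 -> k.-primitive_root x ->
  exists2 x', (c * k).-primitive_root x' & x' ^+ c = x.
Proof.
move=> x0m xk; have ck0 := prim_order_gt0 x0m.
have [c0 k0] : (0 < c /\ 0 < k)%N by apply/andP; rewrite -muln_gt0.
have x0c : k.-primitive_root (x0 ^+ c).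
  have := dvdn_prim_root x0m (dvdn_mull c (dvdnn k)).
  by rewrite mulnK.
have [j Ej] := prim_rootP x0c (prim_expr_order xk).
have jk : coprime j k by rewrite -(prim_root_exp_coprime j x0c) -Ej.
have [t jt] := coprime_lift ck0 jk.
exists (x0 ^+ (j + k * t)); first by rewrite prim_root_exp_coprime.
rewrite -exprM mulnC mulnDr exprD exprM -Ej mulnA [(c * k * t)%N]mulnC exprM.
by rewrite -exprM mulnC exprM (prim_expr_order x0m) expr1n mulr1.
Qed.

Lemma finField_prim_root (E : finFieldType) : exists x : E, (#|E|.-1).-primitive_root x.
Proof.
pose rs := [seq x <- enum E | x != 0].
have E1 := finNzRing_gt1 E.
have srs : (#|E|.-1 <= size rs)%N.
  rewrite -(leq_add2l 1) add1n prednK; last exact: ltnW.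
  rewrite cardE -(count_predC (fun x : E => x == 0)) size_filter leq_add2r.
  by rewrite -/(count_mem 0 _) count_uniq_mem ?enum_uniq // leq_b1.
have /hasP[x _ xp] : has (#|E|.-1).-primitive_root rs.
  apply: has_prim_root => //; first by rewrite -subn1 subn_gt0.
  - apply/allP=> x; rewrite mem_filter => /andP[x0 _]; apply/unity_rootP.
    by apply: (mulfI x0); rewrite -exprS prednK ?mulr1 ?expf_card // ltnW.
  - by rewrite filter_uniq // enum_uniq.
by exists x.
Qed.

Section Tower.

Variables (F E : finFieldType) (emb : {rmorphism F -> E}) (b : F) (z : algC).
Variables (p a r : nat).
Hypotheses (pp : prime p) (a0 : (0 < a)%N) (cF : #|F| = (p ^ a)%N).
Hypotheses (r0 : (0 < r)%N) (cE : #|E| = (p ^ (a * r))%N).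
Hypotheses (zq : (#|F|.-1).-primitive_root z) (bq : (#|F|.-1).-primitive_root b).

(** A common exponent c for the generator and for the root of unity is what makes the Teichmüller
    lifts of the two fields agree. *)
Lemma tower_exists : exists (g : E) (z' : algC) (c : nat),
  [/\ (#|E|.-1).-primitive_root g, (#|E|.-1).-primitive_root z',
      g ^+ c = emb b & z' ^+ c = z].
Proof.
have : (#|F|.-1 %| #|E|.-1)%N.
  rewrite cE expnM -cF -!subn1 -{2}(exp1n r) subn_exp.
  exact: dvdn_mulr.
case/dvdnP=> c Ec; have [g0 gq] := finField_prim_root E.
have E0 := prim_order_gt0 gq; have [z0 z0q] := C_prim_root_exists E0.
rewrite Ec in gq z0q *.
have ebq : (#|F|.-1).-primitive_root (emb b) by rewrite fmorph_primitive_root.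
have [g gP gb] := prim_root_lift gq ebq.
have [z' zP zb] := prim_root_lift z0q zq.
by exists g, z', c.
Qed.

Variables (g : E) (z' : algC) (c : nat).
Hypotheses (gq : (#|E|.-1).-primitive_root g) (zq' : (#|E|.-1).-primitive_root z').
Hypotheses (gc : g ^+ c = emb b) (zc : z' ^+ c = z).

Lemma teich_emb x : teich g z' (emb x) = teich b z x.
Proof.
have [->|x0] := eqVneq x 0; first by rewrite rmorph0 !teich0.
rewrite -(dlogK bq x0) rmorphXn /= -gc -exprM (teich_exp zq' gq).
by rewrite (teich_exp zq bq) exprM zc.
Qed.

Variable y : algC.
Hypothesis yp : p.-primitive_root y.

Lemma tower_exp : exists2 k, (z' * y) ^+ k = z * y & g ^+ k = emb b.
Proof.
exists (#|E| * c + #|E|.-1 * p.-1)%N.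
  by rewrite exprD exprM (zy_card cE zq' yp) zc (zy_y pp cE zq' gq yp).
by rewrite exprD [(#|E| * _)%N]mulnC !exprM (prim_expr_order gq) expr1n mulr1 gc expf_card.
Qed.

Lemma tower_sub : {subset Oz b (z * y) <= Oz g (z' * y)}.
Proof. by have [k kz kg] := tower_exp; apply: (@Oz_sub _ _ emb _ _ _ _ k). Qed.

(** Write x = lam^k u with a unit u of the small ring. If k < (p-1)M, divisibility by p^M in the
    large ring would make lam invertible there. *)
Lemma tower_descent M x : x \in Oz b (z * y) ->
  eqm (Oz g (z' * y)) (p%:R ^+ M) x 0 -> eqm (Oz b (z * y)) (p%:R ^+ M) x 0.
Proof.
move=> Ox [w Ow]; rewrite add0r => Ex.
have [x0|x0] := eqVneq x 0.
  by exists 0; rewrite ?rpred0 // x0 mulr0 addr0.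
have [k [u [Ou OVu Eu]]] := lam_valuation pp cF zq bq yp Ox x0.
have [v [Ov OVv] Ev] := p_lam_unit pp cF zq bq yp.
set lam := y - 1 in Eu Ev.
have lam0 : lam != 0 := lam_neq0 pp yp.
have u0 : u != 0 by apply: contraNneq x0 => u0; rewrite Eu u0 mulr0.
have v0 : v != 0.
  apply: contraNneq (natC_neq0 (prime_gt0 pp)) => v0; by rewrite Ev v0 mulr0.
have [kM|kM] := leqP (p.-1 * M) k.
  exists (lam ^+ (k - p.-1 * M) * u * v^-1 ^+ M).
    by rewrite !rpredM ?rpredX // (lam_O pp cF zq bq yp).
  rewrite add0r Eu Ev exprMn -exprM exprVn -{1}(subnKC kM) exprD.
  by field; rewrite expf_neq0.
have lE := lam_cong0 pp cE zq' gq yp; rewrite -/lam in lE.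
have redE := red_zy pp cE zq' gq yp.
have := cong0_nunit redE lE lam0; rewrite -/lam.
suff -> : lam^-1 = lam ^+ (p.-1 * M - k.+1) * w * v ^+ M * u^-1.
  rewrite !rpredM ?rpredX ?(tower_sub Ov) ?(tower_sub OVu) //.
  exact: (lam_O pp cE zq' gq yp).
have : lam ^+ k * u = lam ^+ k * (lam * (lam ^+ (p.-1 * M - k.+1) * w * v ^+ M)).
  rewrite -Eu Ex Ev exprMn -exprM -{1}(subnKC kM) exprD exprSr; ring.
move/(mulfI (expf_neq0 k lam0)) => E1.
by apply: (mulfI lam0); rewrite divff // mulrA -E1 divff.
Qed.

End Tower.

(** * Transfer matrices *)

Section FfunRecr.

Variables (X : finType) (k : nat).

Definition ffun_rcons (f : {ffun 'I_k -> X}) (x : X) : {ffun 'I_k.+1 -> X} :=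
  [ffun i => if unlift ord_max i is Some j then f j else x].

Lemma ffun_rcons_max f x : ffun_rcons f x ord_max = x.
Proof. by rewrite ffunE unlift_none. Qed.

Lemma ffun_rcons_widen f x j : ffun_rcons f x (widen_ord (leqnSn k) j) = f j.
Proof.
rewrite ffunE; have -> : widen_ord (leqnSn k) j = lift ord_max j.
  by apply: val_inj; rewrite [RHS]lift_max.
by rewrite liftK.
Qed.

Lemma sum_ffun_rcons (R : nmodType) (F : {ffun 'I_k.+1 -> X} -> R) :
  \sum_f F f = \sum_f \sum_x F (ffun_rcons f x).
Proof.
rewrite pair_bigA /=.
rewrite (reindex (fun fx : {ffun 'I_k -> X} * X => ffun_rcons fx.1 fx.2)) //=.
exists (fun f : {ffun 'I_k.+1 -> X} => ([ffun j => f (widen_ord (leqnSn k) j)], f ord_max)).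
  move=> [f x] _ /=; rewrite ffun_rcons_max; congr (_, _).
  by apply/ffunP=> j; rewrite ffunE ffun_rcons_widen.
move=> f _ /=; apply/ffunP=> i; rewrite ffunE; case: unliftP => [j ->|->] //.
rewrite ffunE; congr (f _); apply: val_inj; by rewrite [RHS]lift_max.
Qed.

End FfunRecr.

Lemma sum_enum_val (T : finType) (R : nmodType) (F : T -> R) :
  \sum_(i < #|T|) F (enum_val i) = \sum_t F t.
Proof. by rewrite -(big_enum_val (A := predT)) //=; apply: eq_bigl. Qed.

Lemma mulr_exchange (R : comPzRingType) (x x' y y' c e : R) :
  x * x' = y * y' -> x * c * e * x' = y * c * (e * y').
Proof.
move=> E; have -> : x * c * e * x' = x * x' * (c * e) by ring.
by rewrite E; ring.
Qed.

Section Transfer.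

Variables (p n d N D T : nat) (expo : 'I_N -> 'I_n.+1 -> nat) (pi : algC).
Hypotheses (p1 : (1 < p)%N) (d0 : (0 < d)%N) (pi0 : pi != 0).
Hypothesis expoE : forall j, (\sum_l expo j l = d)%N.
Hypothesis TP : (N * D * d <= T)%N.

Local Notation letter := {ffun 'I_N -> 'I_D.+1}.
Local Notation state := {ffun 'I_n.+1 -> 'I_T.+1}.
Implicit Types (nu : letter) (u v : state) (I : {set 'I_n.+1}).

Definition wt nu l : nat := (\sum_j nu j * expo j l)%N.
Definition deg nu : nat := (\sum_j nu j)%N.
(** The coordinate u_(n+1), which states omit; [inU] ensures that the division is exact. *)
Definition ht u : nat := ((\sum_l u l) %/ d)%N.
Definition inU I u : bool := (d %| \sum_l u l)%N && [forall l in I, 0 < u l]%N.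

Lemma sum_wt nu : (\sum_l wt nu l = d * deg nu)%N.
Proof.
rewrite /wt exchange_big /= big_distrr /=; apply: eq_bigr => j _.
by rewrite -big_distrr /= expoE mulnC.
Qed.

Lemma wt_bound nu l : (wt nu l <= T)%N.
Proof.
apply: leq_trans TP; rewrite -mulnA -[X in (_ <= X * _)%N]card_ord -sum_nat_const.
apply: leq_sum => j _; apply: leq_mul; first by rewrite -ltnS.
by rewrite -(expoE j) (bigD1 l) //= leq_addr.
Qed.

Definition step nu u v : bool := [forall l, wt nu l + u l == p * v l]%N.
Definition coefAH nu (L : 'I_N -> algC) : algC := \prod_j (ah p (nu j) * L j ^+ nu j).

(** A step naturally carries pi^(deg nu). On U^I the relation deg nu = p ht(v) - ht(u) lets one
    conjugate by the diagonal matrix of the pi^(ht u); the factor that remains depends on the row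
    only and shows its divisibility by p^(ht v) up to a unit. *)
Definition entry (L : 'I_N -> algC) v u : algC :=
  pi ^+ (p.-1 * ht v) * \sum_(nu | step nu u v) coefAH nu L.

(** All states index the matrix, whatever I is. Zeroing the rows outside U^I already gives nonempty
    products the traces of the products of the submatrices. *)
Definition Bmx I L : 'M[algC]_#|{: state}| :=
  \matrix_(i, j) (if inU I (enum_val i) then entry L (enum_val i) (enum_val j) else 0).

Fixpoint Bprod I (Ls : nat -> 'I_N -> algC) k : 'M[algC]_#|{: state}| :=
  if k is k'.+1 then Bmx I (Ls k') *m Bprod I Ls k' else 1%:M.

Lemma step_deg I nu u v : inU I u -> inU I v -> step nu u v ->
  (deg nu + ht u = p * ht v)%N.
Proof.
move=> /andP[du _] /andP[dv _] /forallP st; rewrite /ht.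
apply/eqP; rewrite -(eqn_pmul2l d0) mulnDr -sum_wt mulnCA.
rewrite [(d * (_ %/ _))%N]mulnC divnK // [(d * (_ %/ _))%N]mulnC divnK //.
rewrite big_distrr -big_split /=; apply/eqP; apply: eq_bigr => l _.
exact/eqP.
Qed.

Definition weightsum (k : nat) (f : {ffun 'I_k -> letter}) l : nat :=
  (\sum_(i < k) p ^ i * wt (f i) l)%N.
Definition degsum (k : nat) (f : {ffun 'I_k -> letter}) : nat :=
  (\sum_(i < k) p ^ i * deg (f i))%N.

Lemma sum_weightsum k (f : {ffun 'I_k -> letter}) :
  (\sum_l weightsum f l = d * degsum f)%N.
Proof.
rewrite /weightsum exchange_big /= big_distrr /=; apply: eq_bigr => i _.
by rewrite -big_distrr /= sum_wt mulnCA.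
Qed.

Lemma weightsum_bound k (f : {ffun 'I_k -> letter}) l :
  (weightsum f l + T <= p ^ k * T)%N.
Proof.
have : (\sum_(i < k) p ^ i * wt (f i) l <= (\sum_(i < k) p ^ i) * T)%N.
  by rewrite big_distrl; apply: leq_sum => i _; rewrite leq_mul2l wt_bound orbT.
have := predn_exp p k; have : (0 < p ^ k)%N by rewrite expn_gt0 ltnW.
rewrite /weightsum; move: (p ^ k)%N (\sum_(i < k) p ^ i)%N (\sum_(i < k) _)%N => q S W.
by move=> q0 E W1; nia.
Qed.

Definition coefseq (Ls : nat -> 'I_N -> algC) k (f : {ffun 'I_k -> letter}) : algC :=
  \prod_(i < k) (pi ^+ deg (f i) * coefAH (f i) (Ls i)).

Lemma Bprod_masked I Ls k i j : inU I (enum_val j) -> ~~ inU I (enum_val i) ->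
  Bprod I Ls k i j = 0.
Proof.
move=> Uj Ui; case: k => [|k] /=.
  by rewrite mxE; case: eqP => // ij; rewrite ij Uj in Ui.
by rewrite mxE big1 // => l _; rewrite mxE (negPf Ui) mul0r.
Qed.

Lemma weightsum_rcons k (f : {ffun 'I_k -> letter}) nu l :
  weightsum (ffun_rcons f nu) l = (weightsum f l + p ^ k * wt nu l)%N.
Proof.
rewrite /weightsum big_ord_recr /= ffun_rcons_max; congr (_ + _)%N.
by apply: eq_bigr => i _; rewrite ffun_rcons_widen.
Qed.

Lemma coefseq_rcons Ls k (f : {ffun 'I_k -> letter}) nu :
  coefseq Ls (ffun_rcons f nu) = coefseq Ls f * (pi ^+ deg nu * coefAH nu (Ls k)).
Proof.
rewrite /coefseq big_ord_recr /= ffun_rcons_max; congr (_ * _).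
by apply: eq_bigr => i _; rewrite ffun_rcons_widen.
Qed.

Definition walk k (f : {ffun 'I_k -> letter}) u v : bool :=
  [forall l, p ^ k * v l == u l + weightsum f l]%N.

(** The vertex before the last step is forced to be w = p v - wt nu, so the sum has at most one
    term. The coordinate sum of w is divisible by d because those of p v and wt nu are, and its
    positivity on I is inherited from u. *)
Lemma walk_rcons I k (f : {ffun 'I_k -> letter}) nu u v : inU I u -> inU I v ->
  (\sum_(w | inU I w) (step nu w v && walk f u w) = walk (ffun_rcons f nu) u v)%N.
Proof.
move=> Uu Uv; have pk0 : (0 < p ^ k)%N by rewrite expn_gt0 ltnW.
case: (boolP (walk _ u v)) => [/forallP fP|nP]; last first.
  rewrite big1 // => w Uw; case: andP => // -[/forallP s1 /forallP s2].
  case/negP: nP; apply/forallP => l; rewrite weightsum_rcons expnSr -mulnA.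
  by rewrite -(eqP (s1 l)) mulnDr (eqP (s2 l)) addnC -addnA.
have vl l : (p ^ k * (p * v l) = u l + weightsum f l + p ^ k * wt nu l)%N.
  by rewrite mulnA -expnSr (eqP (fP l)) weightsum_rcons addnA.
have wl l : (wt nu l <= p * v l)%N.
  by rewrite -(leq_pmul2l pk0) vl leq_addl.
have kw l : (p ^ k * (p * v l - wt nu l) = u l + weightsum f l)%N.
  by rewrite mulnBr vl addnK.
have wT l : (p * v l - wt nu l < T.+1)%N.
  rewrite ltnS -(leq_pmul2l pk0) kw; apply: leq_trans (weightsum_bound f l).
  by rewrite addnC leq_add2l -ltnS.
pose w : state := [ffun l => Ordinal (wT l)].
have wE l : (w l = p * v l - wt nu l :> nat)%N by rewrite ffunE.
have sw : step nu w v by apply/forallP=> l; rewrite wE subnKC.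
have pw : walk f u w by apply/forallP=> l; rewrite wE kw.
have Uw : inU I w.
  apply/andP; split.
    have E : (\sum_l w l + d * deg nu = p * \sum_l v l)%N.
      rewrite -sum_wt -big_split big_distrr /=; apply: eq_bigr => l _.
      by rewrite wE subnK.
    have dv : (d %| p * \sum_l v l)%N by rewrite dvdn_mull //; case/andP: Uv.
    by move: dv; rewrite -E dvdn_addl // dvdn_mulr.
  apply/forallP => l; apply/implyP => lI; have := kw l.
  rewrite -wE; case: (posnP (w l)) => // ->; rewrite muln0 => /esym/eqP.
  rewrite addn_eq0 => /andP[/eqP ul _]; case/andP: Uu => _ /forallP/(_ l).
  by rewrite lI /= ul.
rewrite (bigD1 w) //= sw pw big1 // => w' /andP[_ ww'].
case: andP => // -[/forallP s1 _]; case/eqP: ww'; apply/ffunP => l; apply: val_inj.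
by rewrite /= wE -(eqP (s1 l)) addKn.
Qed.

(** The powers of pi telescope: pi^((p-1) ht v) pi^(ht v) = pi^(deg nu) pi^(ht u) for each step. On
    the diagonal the two outer powers cancel. *)
Lemma Bprod_entry I Ls k i j : inU I (enum_val i) -> inU I (enum_val j) ->
  Bprod I Ls k i j * pi ^+ ht (enum_val i) =
  pi ^+ ht (enum_val j) *
   \sum_(f : {ffun 'I_k -> letter} | walk f (enum_val j) (enum_val i)) coefseq Ls f.
Proof.
move=> Ui Uj; elim: k i Ui => [|k IH] i Ui.
  rewrite mxE; have E (f : {ffun 'I_0 -> letter}) : walk f (enum_val j) (enum_val i) = (i == j).
    apply/forallP/eqP => [H|-> l]; last by rewrite /weightsum big_ord0 addn0 mul1n.
    apply: enum_val_inj; apply/ffunP => l; apply: val_inj; have := H l.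
    by rewrite /weightsum big_ord0 addn0 mul1n => /eqP.
  case: eqVneq => [->|ij]; last first.
    by rewrite mul0r big_pred0 ?mulr0 // => f; rewrite E (negPf ij).
  rewrite mul1r (eq_bigl xpredT) => [|f]; last first.
    by apply/forallP => l; rewrite /weightsum big_ord0 addn0 mul1n.
  rewrite (eq_bigr (fun=> 1)) => [|f _]; last by rewrite /coefseq big_ord0.
  by rewrite sumr_const card_ffun card_ord expn0 mulr1.
rewrite /= mxE mulr_suml.
transitivity (\sum_(l < #|{: state}| | inU I (enum_val l)) (\sum_(nu | step nu (enum_val l) (enum_val i))
   (pi ^+ deg nu * coefAH nu (Ls k))) * (Bprod I Ls k l j * pi ^+ ht (enum_val l))).
  rewrite [RHS]big_mkcond /=; apply: eq_bigr => l _; case: ifP => Ul; last first.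
    by rewrite (Bprod_masked _ _ Uj) ?Ul // mulr0 mul0r.
  rewrite mxE Ui /entry mulr_sumr !mulr_suml; apply: eq_bigr => nu st.
  set h := ht _; set h' := ht _; set B := Bprod _ _ _ _ _; set c := coefAH _ _.
  have E : pi ^+ (p.-1 * h) * pi ^+ h = pi ^+ deg nu * pi ^+ h'.
    rewrite -!exprD (step_deg Ul Ui st); congr (_ ^+ _).
    by rewrite -{2}[h]mul1n -mulnDl addn1 prednK // ltnW.
  exact: mulr_exchange E.
rewrite (eq_bigr (fun l => \sum_(nu | step nu (enum_val l) (enum_val i))
   \sum_(f : {ffun 'I_k -> letter} | walk f (enum_val j) (enum_val l))
     pi ^+ ht (enum_val j) * coefseq Ls (ffun_rcons f nu))); last first.
  move=> l Ul; rewrite IH // mulr_suml; apply: eq_bigr => nu _.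
  rewrite !mulr_sumr; apply: eq_bigr => f _; rewrite coefseq_rcons.
  by move: (pi ^+ _) (pi ^+ _) (coefseq _ _) (coefAH _ _) => x x' x2 x3; ring.
transitivity (\sum_(f : {ffun 'I_k -> letter}) \sum_nu \sum_(l < #|{: state}| | inU I (enum_val l))
   if step nu (enum_val l) (enum_val i) && walk f (enum_val j) (enum_val l) then
     pi ^+ ht (enum_val j) * coefseq Ls (ffun_rcons f nu) else 0).
  under [RHS]eq_bigr => f _ do rewrite exchange_big /=.
  rewrite [RHS]exchange_big /=; apply: eq_bigr => l _.
  rewrite [RHS]exchange_big /= big_mkcond; apply: eq_bigr => nu _.
  by case: ifP => _ /=; [rewrite big_mkcond|rewrite big1].
rewrite mulr_sumr [RHS]big_mkcond /= sum_ffun_rcons.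
apply: eq_bigr => f _; apply: eq_bigr => nu _.
transitivity ((pi ^+ ht (enum_val j) * coefseq Ls (ffun_rcons f nu)) *+
   walk (ffun_rcons f nu) (enum_val j) (enum_val i)).
  rewrite -(walk_rcons f nu Uj Ui) -sumrMnr [RHS]big_mkcond -sum_enum_val [LHS]big_mkcond /=.
  by apply: eq_bigr => l _; rewrite mulrb.
by rewrite mulrb; case: ifP; rewrite ?mulr0.
Qed.

Definition closed_walk I k (f : {ffun 'I_k -> letter}) : bool :=
  [&& (p ^ k).-1 %| degsum f, [forall l, (p ^ k).-1 %| weightsum f l] &
      [forall l in I, 0 < weightsum f l]]%N.

(** A closed walk at u satisfies (p^k - 1) u = weightsum f, so f determines u. As the weight sums
    add up to d times degsum f, divisibility of the coordinate sum of u by d is divisibility of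
    degsum f by p^k - 1. *)
Lemma sum_closed_walk I k (f : {ffun 'I_k -> letter}) : (0 < k)%N ->
  (\sum_(u | inU I u) walk f u u = closed_walk I f)%N.
Proof.
move=> k0; have q1 : (1 < p ^ k)%N by rewrite -(expn0 p) ltn_exp2l.
have q0 : (0 < (p ^ k).-1)%N by rewrite -subn1 subn_gt0.
have walkE u : walk f u u = [forall l, weightsum f l == (p ^ k).-1 * u l]%N.
  by apply: eq_forallb => l; rewrite -{1}(prednK (ltnW q1)) mulSn eqn_add2l eq_sym.
have UP u : walk f u u -> inU I u = ((p ^ k).-1 %| degsum f)%N && [forall l in I, 0 < weightsum f l]%N.
  rewrite walkE => /forallP W; congr (_ && _).
    have := sum_weightsum f; rewrite (eq_bigr _ (fun l _ => eqP (W l))) -big_distrr /= => E.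
    apply/dvdnP/dvdnP => [[e Ee]|[e Ee]]; exists e.
      apply/eqP; rewrite -(eqn_pmul2l d0) -E Ee; apply/eqP; ring.
    apply/eqP; rewrite -(eqn_pmul2l q0) E Ee; apply/eqP; ring.
  apply: eq_forallb => l; case: (l \in I) => //=.
  by rewrite (eqP (W l)) muln_gt0 q0.
have [/existsP[u Wu]|] := boolP [exists u : state, walk f u u].
  rewrite (bigID (pred1 u)) /= [X in (_ + X)%N]big1 => [|v /andP[_ vu]]; last first.
    case: (boolP (walk f v v)) => // Wv; case/eqP: vu; apply/ffunP => l; apply: val_inj => /=.
    apply/eqP; rewrite -(eqn_pmul2l q0); move: Wu Wv; rewrite !walkE.
    by move=> /forallP/(_ l)/eqP <- /forallP/(_ l)/eqP <-.
  have -> : closed_walk I f = inU I u.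
    rewrite (UP u Wu) /closed_walk; congr (_ && _).
    suff -> : [forall l, (p ^ k).-1 %| weightsum f l]%N by [].
    apply/forallP => l; move: Wu; rewrite walkE => /forallP/(_ l)/eqP ->.
    exact: dvdn_mulr.
  rewrite addn0; case Uu : (inU I u).
    rewrite (bigD1 u) /= ?Uu ?eqxx // Wu big1 // => v /andP[/andP[_ /eqP ->]].
    by rewrite eqxx.
  rewrite big_pred0 // => v; case: eqP => [->|_]; by rewrite ?Uu ?andbF.
move=> /existsPn nW; rewrite big1 => [|u _]; last by rewrite (negPf (nW u)).
case: (boolP (closed_walk I f)) => // /and3P[_ /forallP dW _].
have wT l : (weightsum f l %/ (p ^ k).-1 < T.+1)%N.
  rewrite ltnS leq_divLR // -subn1 mulnBr muln1 mulnC.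
  by have := weightsum_bound f l; lia.
have := nW [ffun l => Ordinal (wT l)]; rewrite walkE.
case/negP; apply/forallP => l; rewrite ffunE /= mulnC divnK //.
Qed.

Lemma trace_Bprod I Ls k : (0 < k)%N ->
  \tr (Bprod I Ls k) = \sum_(f : {ffun 'I_k -> letter}) coefseq Ls f *+ closed_walk I f.
Proof.
move=> k0; transitivity (\sum_(i < #|{: state}| | inU I (enum_val i)) Bprod I Ls k i i).
  rewrite [RHS]big_mkcond; apply: eq_bigr => i _; case: ifP => // Ui.
  by case: k k0 => // k _; rewrite /= mxE big1 // => l _; rewrite mxE Ui mul0r.
transitivity (\sum_(i < #|{: state}| | inU I (enum_val i)) \sum_(f : {ffun 'I_k -> letter})
    coefseq Ls f *+ walk f (enum_val i) (enum_val i)).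
  apply: eq_bigr => i Ui; have h0 : pi ^+ ht (enum_val i) != 0 by rewrite expf_neq0.
  apply: (mulIf h0); rewrite Bprod_entry // mulrC; congr (_ * _).
  by rewrite big_mkcond; apply: eq_bigr => f _; rewrite mulrb.
rewrite exchange_big; apply: eq_bigr => f _.
rewrite -(sum_closed_walk I f k0) -sumrMnr [RHS]big_mkcond -sum_enum_val [LHS]big_mkcond /=.
by [].
Qed.

End Transfer.

(** * Counting points with character sums *)

Section AdditiveCharacter.

Variables (E : finFieldType) (p s : nat) (y : algC).
Hypotheses (pp : prime p) (cE : #|E| = (p ^ s)%N) (yp : p.-primitive_root y).
Let pE := pcharF_card pp cE.

Definition ftrace (c : E) : E := \sum_(i < s) c ^+ (p ^ i).

Lemma exprD_p i (x x' : E) : (x + x') ^+ (p ^ i) = x ^+ (p ^ i) + x' ^+ (p ^ i).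
Proof. by apply: exprDn_pchar; rewrite (eq_pnat _ (pcharf_eq pE)) pnatX pnat_id. Qed.

Lemma ftraceD c c' : ftrace (c + c') = ftrace c + ftrace c'.
Proof. by rewrite -big_split; apply: eq_bigr => i _; rewrite exprD_p. Qed.

Lemma ftrace0 : ftrace 0 = 0.
Proof. by apply: (addrI (ftrace 0)); rewrite -ftraceD !addr0. Qed.

Lemma ftrace_sum (J : finType) (mm : J -> E) :
  ftrace (\sum_j mm j) = \sum_j \sum_(i < s) mm j ^+ (p ^ i).
Proof. exact: (big_morph ftrace ftraceD ftrace0). Qed.

Lemma ftrace_nat c : exists k : nat, ftrace c == k%:R.
Proof.
have H : ftrace c ^+ p = ftrace c.
  rewrite -(pFrobenius_autE pE) rmorph_sum /ftrace /=.
  case: s cE => [|s'] cE'; first by rewrite !big_ord0.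
  rewrite big_ord_recr [RHS]big_ord_recl /= addrC; congr (_ + _).
    by rewrite pFrobenius_autE -exprM -expnSr -cE' expf_card.
  by apply: eq_bigr => i _; rewrite pFrobenius_autE -exprM -expnSr.
by have [k _ ->] := prime_field_root pE H; exists k.
Qed.

Definition addchar (c : E) : algC := y ^+ (xchoose (ftrace_nat c)).

Lemma addcharE c k : ftrace c = k%:R -> addchar c = y ^+ k.
Proof.
move=> ck; have /eqP := xchooseP (ftrace_nat c); rewrite /addchar.
set l := xchoose _; rewrite ck => kl; apply/eqP; rewrite (eq_prim_root_expr yp).
wlog lk : k l kl {ck} / (l <= k)%N => [H|].
  by case: (leqP l k) => [|/ltnW] h; [apply: H|rewrite eq_sym; apply: H].
rewrite eq_sym eqn_mod_dvd // (dvdn_pcharf pE) natrB // subr_eq0; exact/eqP.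
Qed.

Lemma addcharD c c' : addchar (c + c') = addchar c * addchar c'.
Proof.
rewrite -exprD; apply: addcharE; rewrite natrD ftraceD.
by congr (_ + _); apply/eqP/(xchooseP (ftrace_nat _)).
Qed.

Lemma addchar0 : addchar 0 = 1.
Proof. by rewrite -(expr0 y); apply: addcharE; rewrite ftrace0. Qed.

(** The trace is given by a polynomial of degree p^(s-1) < #|E|, so it cannot vanish everywhere. *)
Lemma addchar_nontrivial : exists c, addchar c != 1.
Proof.
have s0 : (0 < s)%N by case: s cE (finNzRing_gt1 E) => [->|].
pose P : {poly E} := \sum_(i < s) 'X^(p ^ i).
have sP : size P = (p ^ s.-1).+1.
  rewrite /P; case: s s0 => // s' _ /=; rewrite big_ord_recr /=.
  rewrite addrC size_polyDl ?size_polyXn //; apply: leq_ltn_trans (size_sum _ _ _) _.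
  rewrite ltnS; apply/bigmax_leqP => i _; rewrite size_polyXn.
  by rewrite ltn_exp2l ?prime_gt1.
have P0 : P != 0 by rewrite -size_poly_eq0 sP.
have [c cP] : exists c, ftrace c != 0.
  apply/existsP; apply: contraT => /existsPn H.
  have : all (root P) (enum E).
    apply/allP => c _; apply/rootP; rewrite horner_sum.
    rewrite (eq_bigr (fun i : 'I_s => c ^+ (p ^ i))) => [|i _]; last by rewrite hornerXn.
    by have := H c; rewrite negbK => /eqP.
  move/(max_poly_roots P0)/(_ (enum_uniq _)); rewrite sP -cardE cE ltnS leqNgt.
  by rewrite ltn_exp2l ?prime_gt1 // prednK ?leqnn.
exists c; apply: contra cP; rewrite /addchar -(prim_order_dvd yp).
have /eqP E1 := xchooseP (ftrace_nat c); rewrite (dvdn_pcharf pE) => /eqP E2.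
by rewrite E1 E2.
Qed.

Lemma sum_addchar c : \sum_(t | t != 0) addchar (t * c) =
  #|E|%:R * (c == 0)%:R - 1.
Proof.
have -> : \sum_(t | t != 0) addchar (t * c) = \sum_t addchar (t * c) - 1.
  by rewrite [in RHS](bigD1 0) //= mul0r addchar0 addrC addrK.
congr (_ - _); case: eqP => [->|/eqP c0]; last first.
  rewrite mulr0 (reindex_onto ( *%R^~ c^-1) ( *%R^~ c)) => [|t _]; last by rewrite mulfK.
  rewrite (eq_big xpredT addchar) => [|t|t _]; rewrite ?divfK ?eqxx //.
  have [c1 cc1] := addchar_nontrivial.
  have : \sum_t addchar t = addchar c1 * \sum_t addchar t.
    rewrite mulr_sumr {1}(reindex_onto (+%R c1) (fun t => t - c1)) => [|t _]; last first.
      by rewrite addrC subrK.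
    apply: eq_big => t; first by rewrite addrC addKr eqxx.
    by move=> _; rewrite addcharD.
  move/eqP; rewrite -subr_eq0 -{1}[\sum_t _]mul1r -mulrBl mulf_eq0 subr_eq0 eq_sym.
  by rewrite (negPf cc1) => /eqP.
rewrite mulr1 (eq_bigr (fun=> 1)) ?sumr_const // => t _.
by rewrite mulr0 addchar0.
Qed.

End AdditiveCharacter.

(** The term of index I when the product of the factors q - [P l] is multiplied out. *)
Lemma prod_sign_if (K : comNzRingType) k (I : {set 'I_k}) (P : pred 'I_k) (q : K) :
  \prod_l (if l \in I then - (P l)%:R else q) =
  (-1) ^+ #|I| * q ^+ (k - #|I|) * [forall l in I, P l]%:R.
Proof.
rewrite (bigID (mem I)) /= mulrAC; congr (_ * _); last first.
  rewrite (eq_bigr (fun=> q)) => [|l /negPf -> //].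
  rewrite prodr_const; congr (_ ^+ _).
  have Ck := cardsC I; rewrite card_ord in Ck; rewrite -[X in (X - _)%N]Ck addKn.
  by apply: eq_card => l; rewrite !inE.
rewrite (eq_bigr (fun l => -1 * (P l)%:R)) => [|l ->]; last by rewrite mulN1r.
rewrite big_split /= prodr_const; congr (_ * _).
case: (boolP [forall l in I, P l]) => [/forall_inP IP|/forall_inPn[l lI /negPf Pl]].
  by rewrite big1 // => l /IP ->.
by rewrite (bigD1 l) //= Pl mul0r.
Qed.

Section Counting.

Variables (E : finFieldType) (g : E) (z y pi : algC) (p s n d N D M : nat).
Variable expo : 'I_N -> 'I_n.+1 -> nat.
Variable lamE : 'I_N -> E.
Hypotheses (pp : prime p) (cE : #|E| = (p ^ s)%N) (yp : p.-primitive_root y).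
Hypotheses (zq : (#|E|.-1).-primitive_root z) (gq : (#|E|.-1).-primitive_root g).
Local Notation tau := (teich g z).
Local Notation O := (Oz g (z * y)).
Hypotheses (piO : pi \in O) (pi0 : pi != 0) (M0 : (0 < M)%N).
Hypotheses (piy : eqm O (p%:R ^+ M) (AHpoly p D).[pi] y).
Hypotheses (pismall : eqm O (p%:R ^+ M) (pi ^+ D.+1) 0).

Let p0 := prime_gt0 pp.
Let pE := pcharF_card pp cE.
Let s0 : (0 < s)%N. Proof. by case: s cE (finNzRing_gt1 E) => [->|]. Qed.

Lemma polyO_comp_cX (S : subringClosed algC) f c : f \in polyO S -> c \in S ->
  f \Po (c *: 'X) \in polyO S.
Proof.
move=> Sf Sc; apply/polyOP => i; rewrite coef_comp_cX rpredM ?rpredX //.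
exact/polyOP.
Qed.

(** The identity of [AHpoly_prod] modulo X^(D+1) is evaluated at pi. Its tail is pi^(D+1) h(pi), and
    h is integral because its coefficients are those of an integral polynomial above degree D. *)
Lemma AHpoly_char (J : finType) (mm : J -> E) :
  eqm O (p%:R ^+ M) (\prod_j \prod_(i < s) (AHpoly p D).[tau (mm j) ^+ (p ^ i) * pi])
     (addchar y pp cE (\sum_j mm j)).
Proof.
have [B [f Of [/eqXP[h Eh] EB]]] := AHpoly_prod pp cE zq gq mm D M0.
rewrite (@addcharE _ _ _ _ pp cE yp _ B); last by rewrite ftrace_sum; exact/esym.
set G := \prod_j \prod_(i < s) _ in Eh.
have OA : AHpoly p D \in polyO (Oz g z) by exact: AHpoly_Oz pp cE D.
have sub := Oz_zy cE zq yp.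
have OG : G \in polyO (Oz g z).
  apply: rpred_prod => j _; apply: rpred_prod => i _; apply: polyO_comp_cX => //.
  by rewrite rpredX // teich_Oz.
have hor (F : {poly algC}) : F \in polyO (Oz g z) -> F.[pi] \in O.
  move=> OF; apply: rpred_horner => //; apply/polyOverP => i; apply: sub.
  exact/polyOP.
have Oh : h \in polyO (Oz g z).
  apply/polyOP => k; have -> : h`_k = (G - (AHpoly p D ^+ B + p%:R ^+ M *: f))`_(k + D.+1).
    by rewrite Eh addrC addKr coefXnM ltnNge leq_addl addnK.
  apply/(polyOP (Oz g z)); rewrite rpredB // rpredD ?rpredX //.
  by apply/polyOP => l; rewrite coefZ rpredM ?rpredX ?rpred_nat //; apply/polyOP.
have -> : \prod_j \prod_(i < s) (AHpoly p D).[tau (mm j) ^+ (p ^ i) * pi] = G.[pi].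
  rewrite horner_prod; apply: eq_bigr => j _; rewrite horner_prod.
  by apply: eq_bigr => i _; rewrite horner_comp hornerZ hornerX.
rewrite Eh !hornerD hornerZ hornerM hornerXn horner_exp.
rewrite -[X in eqm _ _ _ X]addr0 -[X in eqm _ _ _ (X + _)]addr0.
apply: eqmD; last by apply: eqm0M => //; exact: hor.
apply: eqmD.
  by apply: eqmX => //; [rewrite rpredX ?rpred_nat|exact: hor].
by exists f.[pi]; rewrite ?add0r //; exact: hor.
Qed.

Local Notation Q := #|E|.

Hypothesis d0 : (0 < d)%N.
Hypothesis expoE : forall j, (\sum_l expo j l = d)%N.
Variable T : nat.
Hypothesis TP : (N * D * d <= T)%N.

Local Notation letter := {ffun 'I_N -> 'I_D.+1}.
Definition teichs i j := tau (lamE j) ^+ (p ^ i).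

(** Multiplying out picks one exponent vector [f i] for each Frobenius level i; t and the x_l then
    appear only through the degree and weight sums of f. *)
Lemma char_expand (x : {ffun 'I_n.+1 -> E}) t :
  \prod_j \prod_(i < s) (AHpoly p D).[tau (t * (lamE j * \prod_l x l ^+ expo j l)) ^+ (p ^ i) * pi]
  = \sum_(f : {ffun 'I_s -> letter}) coefseq p pi teichs f *
       (tau t ^+ degsum p f * \prod_l tau (x l) ^+ weightsum p expo f l).
Proof.
rewrite exchange_big /=.
transitivity (\prod_(i < s) \sum_(nu : letter) (pi ^+ deg nu * coefAH p nu (teichs i)) *
    (tau t ^+ (p ^ i * deg nu) * \prod_l tau (x l) ^+ (p ^ i * wt expo nu l))).
  apply: eq_bigr => i _.
  transitivity (\prod_(j < N) \sum_(k < D.+1) ah p k * (tau (t * (lamE j * \prod_l x l ^+ expo j l)) ^+ (p ^ i) * pi) ^+ k).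
    apply: eq_bigr => j _; rewrite horner_poly; apply: eq_bigr => k _; by [].
  rewrite bigA_distr_bigA /=; apply: eq_bigr => nu _.
  rewrite /deg /coefAH big_distrr /= !expr_sum -!big_split /=.
  have -> : \prod_l tau (x l) ^+ (p ^ i * wt expo nu l) =
     \prod_j \prod_l (tau (x l) ^+ (p ^ i)) ^+ (nu j * expo j l).
    rewrite exchange_big; apply: eq_bigr => l _; rewrite exprM /wt expr_sum //.
  rewrite -!big_split /=; apply: eq_bigr => j _.
  rewrite !(teichM zq gq) (teich_prod zq gq) /teichs !exprMn.
  have -> : \prod_l (tau (x l) ^+ (p ^ i)) ^+ (nu j * expo j l) =
    (\prod_l tau (x l ^+ expo j l)) ^+ (p ^ i) ^+ nu j.
    rewrite -!prodrXl; apply: eq_bigr => l _.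
    by rewrite (teichX zq gq) -!exprM; congr (_ ^+ _);
    move: (p ^ i)%N (nat_of_ord _) (expo _ _) => A B C; ring.
  rewrite exprM.
  by move: (_ ^+ nu j) (_ ^+ nu j) (_ ^+ nu j) (_ ^+ nu j) (ah p _) => a1 a2 a3 a4 a5; ring.
rewrite bigA_distr_bigA; apply: eq_bigr => f _.
rewrite !big_split /= -/(coefseq _ _ _ _); congr (_ * (_ * _)).
  by rewrite -big_split.
  by rewrite /degsum expr_sum.
by rewrite exchange_big; apply: eq_bigr => l _; rewrite /weightsum expr_sum.
Qed.

Let q1 : (0 < Q.-1)%N. Proof. by rewrite -subn1 subn_gt0 finNzRing_gt1. Qed.

(** Summing over t gives Q - 1 or 0 according to divisibility of the degree sum. Summing over x_l
    gives Q - [w > 0] if Q - 1 divides the weight sum w, and 0 otherwise. Choosing -[w > 0] for l in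
    I leaves exactly the condition [closed_walk]. *)
Lemma sum_char_expand :
  \sum_(x : {ffun 'I_n.+1 -> E}) \sum_(t | t != 0) \prod_j \prod_(i < s)
     (AHpoly p D).[tau (t * (lamE j * \prod_l x l ^+ expo j l)) ^+ (p ^ i) * pi]
  = Q.-1%:R * \sum_(I : {set 'I_n.+1}) (-1) ^+ #|I| * Q%:R ^+ (n.+1 - #|I|) *
      \tr (Bprod p d D T expo pi I teichs s).
Proof.
transitivity (\sum_(f : {ffun 'I_s -> letter}) coefseq p pi teichs f *
  ((\sum_(t | t != 0) tau t ^+ degsum p f) *
   \prod_l \sum_x tau x ^+ weightsum p expo f l)).
  under eq_bigr => x _ do under eq_bigr => t _ do rewrite char_expand.
  under eq_bigr => x _ do rewrite exchange_big /=.
  rewrite exchange_big; apply: eq_bigr => f _ /=.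
  under eq_bigr => x _ do rewrite -mulr_sumr -mulr_suml.
  by rewrite -!mulr_sumr bigA_distr_bigA.
transitivity (\sum_(f : {ffun 'I_s -> letter}) \sum_(I : {set 'I_n.+1})
    Q.-1%:R * ((-1) ^+ #|I| * Q%:R ^+ (n.+1 - #|I|) *
       (coefseq p pi teichs f *+ closed_walk p expo I f))); last first.
  rewrite exchange_big mulr_sumr; apply: eq_bigr => I _ /=.
  by rewrite (trace_Bprod (prime_gt1 pp) d0 pi0 expoE TP) // !mulr_sumr.
apply: eq_bigr => f _; rewrite (sum_teich_unit zq gq).
under eq_bigr => l _ do rewrite (sum_teich zq gq).
rewrite /closed_walk -cE; case: ifP => dQ; last first.
  by rewrite mul0r mulr0 big1 // => I _; rewrite mulr0n !mulr0.
case: (boolP [forall l, Q.-1 %| weightsum p expo f l]%N) => [/forallP wQ|]; last first.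
  case/forallPn=> l /negPf wl; rewrite (bigD1 l) //= wl mul0r !mulr0 big1 // => I _.
  by rewrite mulr0n !mulr0.
under eq_bigr => l _ do rewrite wQ addrC.
rewrite bigA_distr mulrCA mulr_sumr mulr_sumr; apply: eq_bigr => I _; congr (_ * _).
rewrite /= (prod_sign_if _ (fun l => 0 < weightsum p expo f l)%N).
rewrite mulrb; case: ifP => _; last by rewrite !mulr0.
by rewrite mulr1 mulrC.
Qed.

Lemma coprime_p_pred : ~~ (p %| Q.-1)%N.
Proof. by rewrite -prime_coprime // (coprime_p_card pp cE). Qed.

(** The sum of the character over t, with t nonzero, is Q[f(x) = 0] - 1, so the sum over x is Q(A +
    1) - Q^(n+1), where A counts the affine zeros other than the origin. Division by Q - 1, which is
    prime to p, passes to projective points. *)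
Lemma proj_count_trace :
  eqm O (p%:R ^+ M) (Q%:R * proj_count expo lamE)
   (\sum_(I : {set 'I_n.+1}) (-1) ^+ #|I| * Q%:R ^+ (n.+1 - #|I|) *
      \tr (Bprod p d D T expo pi I teichs s) + Q%:R * \sum_(i < n) Q%:R ^+ i).
Proof.
set S := \sum_(I : {set _}) _.
pose f (x : {ffun 'I_n.+1 -> E}) := hyp_eval expo lamE x.
have H : eqm O (p%:R ^+ M) (Q.-1%:R * S)
   (\sum_(x : {ffun 'I_n.+1 -> E}) (Q%:R * (f x == 0)%:R - 1)).
  rewrite -sum_char_expand; apply: eqm_sum => x _.
  rewrite -(sum_addchar pp cE yp); apply: eqm_sum => t _.
  rewrite /f /hyp_eval mulr_sumr; exact: AHpoly_char.
have f0 : f [ffun=> 0] = 0.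
  rewrite /f /hyp_eval big1 // => j _; suff -> : \prod_i [ffun=> 0 : E] i ^+ expo j i = 0 by rewrite mulr0.
  have [l jl] : exists l, (0 < expo j l)%N.
    apply/existsP; apply: contraTT d0 => /existsPn H0; rewrite -(expoE j) big1 // => l _.
    by apply/eqP; rewrite -leqn0 leqNgt H0.
  by rewrite (bigD1 l) //= ffunE expr0n gtn_eqF // mul0r.
have EN : \sum_(x : {ffun 'I_n.+1 -> E}) (Q%:R * (f x == 0)%:R - 1) =
    Q%:R * ((affine_count expo lamE)%:R + 1) - Q%:R ^+ n.+1 :> algC.
  rewrite sumrB -mulr_sumr sumr_const card_ffun card_ord natrX; congr (_ * _ - _).
  rewrite (bigD1 [ffun=> 0]) //= f0 eqxx addrC; congr (_ + _).
  rewrite /affine_count -sum1_card natr_sum [RHS]big_mkcond [LHS]big_mkcond /=.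
  apply: eq_bigr => x _; rewrite inE -/(f x).
  have -> : [exists i, x i != 0] = (x != [ffun=> 0]).
    apply/idP/idP => [/existsP[i]|x0]; first by apply: contraNneq => ->; rewrite ffunE.
    apply: contraT => /existsPn H0; case/eqP: x0; apply/ffunP => i.
    by have := H0 i; rewrite negbK ffunE => /eqP.
  by case: (x != _); case: (f x == 0).
have Q1 : (Q.-1%:R : algC) != 0 by rewrite natC_neq0.
have [v Ov Ev] := H; rewrite EN in Ev.
have OV : Q.-1%:R^-1 \in O.
  by apply: (Zloc_Oz pp _ _ pE); apply: ZlocV => //; exact: coprime_p_pred.
exists (- (v / Q.-1%:R)); first by rewrite rpredN rpredM.
rewrite /proj_count; apply: (mulIf Q1); rewrite mulrA divfK //.
have EQ : Q%:R = Q.-1%:R + 1 :> algC by rewrite natr1 prednK // ltnW ?finNzRing_gt1.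
have EG : Q%:R ^+ n - 1 = Q.-1%:R * \sum_(i < n) Q%:R ^+ i :> algC.
  by rewrite subrX1; congr (_ * _); rewrite EQ addrK.
have key (K : comNzRingType) (A S' G P w Y Qq Qm : K) : Qm * S' = Qq * (A + 1) - Qq * Y + P * (w * Qm) ->
    Y - 1 = Qm * G -> Qq * A = (S' + Qq * G + P * - w) * Qm.
  move=> E1 E2; have -> : (S' + Qq * G + P * - w) * Qm = Qm * S' + Qq * (Qm * G) - P * (w * Qm) by ring.
  by rewrite E1 -E2; ring.
by apply: key EG; rewrite divfK // -exprS.
Qed.

End Counting.

(** * Fredholm determinants *)

Lemma deriv_prod (R : comNzRingType) (I : eqType) (r : seq I) (f : I -> {poly R}) :
  uniq r -> (\prod_(i <- r) f i)^`() =
  \sum_(i <- r) \prod_(j <- r) (if j == i then (f j)^`() else f j).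
Proof.
elim: r => [|i r IH] /=; first by rewrite !big_nil derivC.
case/andP=> ir ur; rewrite !big_cons derivM IH // eqxx; congr (_ * _ + _).
  rewrite [LHS]big_seq [RHS]big_seq; apply: eq_bigr => j jr.
  by case: eqP => // E; rewrite -E jr in ir.
rewrite mulr_sumr [LHS]big_seq [RHS]big_seq; apply: eq_bigr => j jr; rewrite big_cons.
by case: eqP => // E; rewrite E jr in ir.
Qed.

(** Jacobi's formula: differentiate one row at a time and expand along it. *)
Lemma deriv_det (R : comNzRingType) m (M : 'M[{poly R}]_m) :
  (\det M)^`() = \tr (map_mx deriv M *m \adj M).
Proof.
pose Ni i : 'M[{poly R}]_m := \matrix_(k, l) if k == i then (M k l)^`() else M k l.
transitivity (\sum_i \det (Ni i)).
  rewrite /determinant [RHS]exchange_big linear_sum /=; apply: eq_bigr => s _.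
  rewrite derivM.
  have -> : ((-1) ^+ s : {poly R})^`() = 0.
    by case: (s : bool); rewrite ?expr1 ?expr0 ?derivN derivC ?oppr0.
  rewrite mul0r add0r deriv_prod ?index_enum_uniq // mulr_sumr.
  apply: eq_bigr => i _; congr (_ * _); apply: eq_bigr => k _.
  by rewrite mxE.
rewrite /mxtrace; apply: eq_bigr => i _.
rewrite (expand_det_row _ i) mxE; apply: eq_bigr => j _.
rewrite !mxE eqxx; congr (_ * _); rewrite /cofactor; congr (_ * \det _).
by apply/matrixP => k l; rewrite !mxE eq_sym (negPf (neq_lift _ _)).
Qed.

Definition mxpow (R : pzRingType) m (A : 'M[R]_m) r : 'M[R]_m := iter r (mulmx A) 1%:M.

Lemma mxpowSr (R : pzRingType) m (A : 'M[R]_m) r : mxpow A r.+1 = mxpow A r *m A.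
Proof. by elim: r => [|r IH]; rewrite /mxpow /= ?mulmx1 ?mul1mx // -mulmxA -[_ *m A]IH. Qed.

Lemma mxpowZ (R : comPzRingType) m c (A : 'M[R]_m) r :
  mxpow (c *: A) r = c ^+ r *: mxpow A r.
Proof.
elim: r => [|r IH]; first by rewrite scale1r.
by rewrite /mxpow /= -/(mxpow _ _) IH -scalemxAl -scalemxAr scalerA exprS.
Qed.

Definition fredholm m (A : 'M[algC]_m) : {poly algC} :=
  \det (1%:M - 'X *: map_mx polyC A).

Lemma fredholm0 m (A : 'M[algC]_m) : (fredholm A)`_0 = 1.
Proof.
rewrite -horner_coef0 /fredholm -horner_evalE -det_map_mx.
suff -> : map_mx (horner_eval 0) (1%:M - 'X *: map_mx polyC A) = 1%:M by rewrite det1.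
apply/matrixP => i j; rewrite !mxE horner_evalE hornerD hornerN hornerM hornerX.
by rewrite mul0r subr0 hornerMn hornerC.
Qed.

(** In Jacobi's formula the adjugate of 1 - X B is the determinant times the geometric series of X
    B, up to a multiple of X^n. *)
Lemma fredholm_logder m (A : 'M[algC]_m) n :
  eqX n ('X * (fredholm A)^`()) (- logder n (fun r => \tr (mxpow A r)) * fredholm A).
Proof.
set D := fredholm A; pose B : 'M[{poly algC}]_m := map_mx polyC A.
pose M : 'M[{poly algC}]_m := 1%:M - 'X *: B.
have dM : map_mx deriv M = - B.
  apply/matrixP => i j; rewrite !mxE derivB derivM derivX derivC mulr0 addr0 mul1r.
  by rewrite derivMn derivC mul0rn add0r.
pose S : 'M[{poly algC}]_m := \sum_(k < n) 'X^k *: mxpow B k.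
have SM : S *m M = 1%:M - 'X^n *: mxpow B n.
  rewrite /S; elim: (n) => [|k IH].
    by rewrite big_ord0 mul0mx scale1r subrr.
  rewrite big_ord_recr /= mulmxDl IH mulmxBr mulmx1 -scalemxAr -scalemxAl scalerA.
  by rewrite -mxpowSr -exprS addrA subrK.
have adjE : \adj M = D *: S + 'X^n *: (mxpow B n *m \adj M).
  have : S *m (M *m \adj M) = D *: S by rewrite mul_mx_adj -scalemx1 -scalemxAr mulmx1.
  by rewrite mulmxA SM mulmxBl mul1mx -scalemxAl => <-; rewrite subrK.
have trB k : \tr (mxpow B k) = (\tr (mxpow A k))%:P.
  have -> : mxpow B k = map_mx polyC (mxpow A k).
    elim: k => [|k IH]; first by rewrite map_mx1.
    by rewrite /mxpow /= -/(mxpow _ _) IH map_mxM.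
  by rewrite trace_map_mx.
have trS : \tr (B *m S) = \poly_(k < n) \tr (mxpow A k.+1).
  rewrite /S mulmx_sumr raddf_sum poly_def /=; apply: eq_bigr => k _.
  by rewrite -scalemxAr mxtraceZ -[B *m _]/(mxpow B k.+1) trB mulrC mul_polyC.
have /eqXP[h Eh] : eqX n ('X * \tr (B *m S)) (logder n (fun r => \tr (mxpow A r))).
  move=> k kn; rewrite coefXM coef_truncs // trS; case: k kn => //= k kn.
  by rewrite coef_poly ltnW.
set t := \tr (B *m (mxpow B n *m \adj M)).
have E : D^`() = - (D * \tr (B *m S) + 'X^n * t).
  rewrite /D /fredholm deriv_det -/M dM mulNmx raddfN /= adjE mulmxDr raddfD /=.
  by rewrite -!scalemxAr !mxtraceZ.
apply/eqXP; exists (- 'X * t - h * D); rewrite E.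
have -> : 'X * - (D * \tr (B *m S) + 'X^n * t) = - ('X * \tr (B *m S)) * D - 'X^n * ('X * t).
  by move: ('X^n) => x; ring.
by rewrite Eh; move: ('X^n) => x; ring.
Qed.

Section Periodic.

Variables (p n d N D T : nat) (expo : 'I_N -> 'I_n.+1 -> nat) (pi : algC).
Variables (I : {set 'I_n.+1}).
Local Notation Bp := (Bprod p d D T expo pi I).

Lemma eq_Bprod (L L' : nat -> 'I_N -> algC) k : (forall i j, L i j = L' i j) ->
  Bp L k = Bp L' k.
Proof.
move=> LL; elim: k => //= k ->; congr (_ *m _).
apply/matrixP => i j; rewrite !mxE; case: ifP => // _; rewrite /entry; congr (_ * _).
by apply: eq_bigr => nu _; apply: eq_bigr => l _; rewrite LL.
Qed.

Lemma Bprod_add (L : nat -> 'I_N -> algC) k a :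
  Bp L (k + a) = Bp (fun i => L (i + a)%N) k *m Bp L a.
Proof. by elim: k => [|k IH]; rewrite ?mul1mx // addSn /= IH mulmxA. Qed.

Lemma Bprod_periodic (L : nat -> 'I_N -> algC) a r :
  (forall i j, L (i + a)%N j = L i j) -> Bp L (a * r) = mxpow (Bp L a) r.
Proof.
move=> La; elim: r => [|r IH]; first by rewrite muln0.
by rewrite mulnSr Bprod_add (eq_Bprod _ La) IH mxpowSr.
Qed.

End Periodic.

(** Eliminate in the block matrix with rows (1, J) and (X, 1) in the two possible ways. *)
Lemma det_sylvester (R : comNzRingType) m k (J : 'M[R]_(m, k)) (X : 'M[R]_(k, m)) :
  \det (1%:M - J *m X) = \det (1%:M - X *m J).
Proof.
have E1 : block_mx 1%:M J X 1%:M =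
    block_mx 1%:M 0 X 1%:M *m block_mx 1%:M J 0 (1%:M - X *m J).
  rewrite mulmx_block !mul1mx !mul0mx !mulmx1 !addr0.
  by rewrite addrC subrK.
have E2 : block_mx 1%:M J X 1%:M =
    block_mx 1%:M J 0 1%:M *m block_mx (1%:M - J *m X) 0 X 1%:M.
  by rewrite mulmx_block !mul1mx !mul0mx !mulmx1 !add0r subrK.
have := congr1 determinant E1; rewrite E2 !det_mulmx !det_ublock !det_lblock.
by rewrite !det1 !mul1r !mulr1.
Qed.

Lemma fredholm_mulC m k (J : 'M[algC]_(m, k)) (X : 'M[algC]_(k, m)) :
  fredholm (J *m X) = fredholm (X *m J).
Proof.
by rewrite /fredholm !map_mxM /= scalemxAr det_sylvester scalemxAl.
Qed.

Section EqmMatrix.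

Variables (O : subringClosed algC) (c : algC).
Hypothesis Oc : c \in O.

Definition eqm_mx m k (A B : 'M[algC]_(m, k)) :=
  forall i j, A i j \in O /\ eqm O c (A i j) (B i j).

Lemma eqm_mx_mul m k l (A A' : 'M[algC]_(m, k)) (B B' : 'M[algC]_(k, l)) :
  eqm_mx A A' -> eqm_mx B B' -> eqm_mx (A *m B) (A' *m B').
Proof.
move=> AA BB i j; rewrite !mxE; split.
  by apply: rpred_sum => r _; rewrite rpredM ?(AA _ _).1 ?(BB _ _).1.
apply: eqm_sum => r _; have [Sa Ea] := AA i r; have [Sb Eb] := BB r j.
by apply: eqmM => //; apply: eqm_mem Eb Sb.
Qed.

Lemma eqm_mx1 m : eqm_mx (1%:M : 'M_m) 1%:M.
Proof. by move=> i j; rewrite !mxE rpredMn ?rpred1 //; split=> //; apply: eqm_refl. Qed.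

Lemma fredholm_entry_mem m (A : 'M[algC]_m) i j : A i j \in O ->
  (1%:M - 'X *: map_mx polyC A) i j \in polyO O.
Proof.
move=> OA; rewrite !mxE rpredB ?rpredMn ?rpred1 // rpredM //.
  by apply/polyOP => k; rewrite coefX; case: eqP; rewrite ?rpred1 ?rpred0.
by apply/polyOP => k; rewrite coefC; case: eqP; rewrite ?rpred0.
Qed.

Lemma fredholm_mem m (A : 'M[algC]_m) : (forall i j, A i j \in O) ->
  fredholm A \in polyO O.
Proof.
move=> OA; apply: rpred_sum => s _; rewrite rpredM ?rpredX ?rpredN ?rpred1 //.
by apply: rpred_prod => i _; apply: fredholm_entry_mem.
Qed.

Lemma eqm_coef (f g : {poly algC}) k : eqm (polyO O) c%:P f g -> eqm O c f`_k g`_k.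
Proof.
by case=> w Ow ->; exists w`_k; rewrite ?coefD ?coefCM //; apply/polyOP.
Qed.

Lemma eqm_fredholm m (A B : 'M[algC]_m) : eqm_mx A B ->
  eqm (polyO O) c%:P (fredholm A) (fredholm B).
Proof.
move=> AB; apply: eqm_det => [|i j|i j].
- by apply/polyOP => k; rewrite coefC; case: eqP; rewrite ?rpred0.
- by apply: fredholm_entry_mem; have [] := AB i j.
have [_ [w Ow E]] := AB i j; exists (- ('X * w%:P)).
  rewrite rpredN rpredM //; apply/polyOP => k.
    by rewrite coefX; case: eqP; rewrite ?rpred1 ?rpred0.
  by rewrite coefC; case: eqP; rewrite ?rpred0.
by rewrite !mxE E polyCD polyCM; ring.
Qed.

Lemma fredholm_small m (A : 'M[algC]_m) : eqm_mx A 0 ->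
  eqm (polyO O) c%:P (fredholm A) 1.
Proof.
move/eqm_fredholm; suff -> : fredholm (0 : 'M_m) = 1 by [].
by rewrite /fredholm map_mx0 scaler0 subr0 det1.
Qed.

End EqmMatrix.

(** Passes between the exponent range up to D of the truncated series and the range used in
    [Aentry]. *)
Lemma sum_ffun_bound (R : nmodType) (N B B' : nat) (P : ('I_N -> nat) -> bool)
    (F : ('I_N -> nat) -> R) :
  (forall f f', f =1 f' -> P f = P f') -> (forall f f', f =1 f' -> F f = F f') ->
  (forall f, P f -> forall j, (f j <= B)%N && (f j <= B')%N) ->
  \sum_(nu : {ffun 'I_N -> 'I_B.+1} | P (fun j => nu j)) F (fun j => nu j) =
  \sum_(nu : {ffun 'I_N -> 'I_B'.+1} | P (fun j => nu j)) F (fun j => nu j).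
Proof.
move=> eP eF PB.
pose h (nu : {ffun 'I_N -> 'I_B'.+1}) : {ffun 'I_N -> 'I_B.+1} := [ffun j => inord (nu j)].
pose h' (nu : {ffun 'I_N -> 'I_B.+1}) : {ffun 'I_N -> 'I_B'.+1} := [ffun j => inord (nu j)].
rewrite (reindex_onto h h') => [|nu Pn] /=; last first.
  apply/ffunP => j; rewrite !ffunE; apply: val_inj => /=.
  by have /andP[b b'] := PB _ Pn j; rewrite !inordK // ?inordK.
apply: eq_big => [nu|nu /andP[Pn /eqP hn]].
  apply/andP/idP => [[Pn /eqP hn]|Pn].
    suff hE : (fun j => nu j : nat) =1 (fun j => h nu j : nat) by rewrite (eP _ _ hE).
    move=> j; rewrite -{1}hn ffunE inordK //.
    by have /andP[_] := PB _ Pn j; rewrite ltnS.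
  have hE : (fun j => h nu j : nat) =1 (fun j => nu j : nat).
    by move=> j; rewrite ffunE inordK // ltnS; have /andP[] := PB _ Pn j.
  split; first by rewrite (eP _ _ hE).
  apply/eqP/ffunP => j; apply: val_inj; rewrite ffunE /= inordK hE //.
apply: eF => j; rewrite -[in RHS]hn [in RHS]ffunE inordK //.
by have /andP[_] := PB _ Pn j; rewrite ltnS.
Qed.

(** * Reduction to the Hasse-Witt matrices *)

Section HasseWittReduction.

Variables (p n d N D T : nat) (expo : 'I_N -> 'I_n.+1 -> nat) (pi lam : algC).
Variable O : subringClosed algC.
Variable L : nat -> 'I_N -> algC.
Variable I : {set 'I_n.+1}.
Hypotheses (pp : prime p) (d0 : (0 < d)%N).
Hypothesis expoE : forall j, (\sum_l expo j l = d)%N.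
Hypotheses (pD : (p <= D.+1)%N) (TU : (Ubound d I <= T)%N).
Hypotheses (lamO : lam \in O) (Zsub : {subset Zloc p <= O}) (piO : pi \in O).
Hypotheses (piu : eqm O lam (pi ^+ p.-1 / p%:R) (-1)) (pil : eqm O lam pi 0).
Hypothesis LO : forall i j, L i j \in O.

Let p0 := prime_gt0 pp.
Let p1 := prime_gt1 pp.
Let pn0 : (p%:R : algC) != 0 := natC_neq0 p0.

Local Notation letter := {ffun 'I_N -> 'I_D.+1}.
Local Notation state := {ffun 'I_n.+1 -> 'I_T.+1}.
Local Notation hI := ((#|I| + d.-1) %/ d)%N.
Local Notation hgt := (ht d).
Local Notation inUI := (inU d I).

Lemma ht_mul (u : state) : inUI u -> (d * hgt u = \sum_l u l)%N.
Proof. by case/andP=> du _; rewrite mulnC divnK. Qed.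

Lemma ht_ge (u : state) : inUI u -> (hI <= hgt u)%N.
Proof.
move=> Uu; have : (#|I| <= d * hgt u)%N.
  rewrite ht_mul // -sum1_card [X in (X <= _)%N]big_mkcond /=; apply: leq_sum => l _.
  case: ifP => // lI; case/andP: Uu => _ /forallP/(_ l); by rewrite lI.
move=> H; rewrite -ltnS ltn_divLR //; move: H; move: (hgt u) (#|I|) => a b; nia.
Qed.

Lemma coefAH_O (nu : letter) i : coefAH p nu (L i) \in O.
Proof.
by apply: rpred_prod => j _; rewrite rpredM ?rpredX // Zsub // ah_Zloc.
Qed.

Definition minU (u : state) := inUI u && (hgt u == hI).

Definition rowred i : 'M[algC]_#|{: state}| := \matrix_(k, l)
  if minU (enum_val k) then
    (-1) ^+ hI * \sum_(nu : letter | step p expo nu (enum_val l) (enum_val k)) coefAH p nu (L i)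
  else 0.

Lemma piu_O : pi ^+ p.-1 / p%:R \in O.
Proof. by apply: (eqm_mem lamO (eqm_sym piu)); rewrite rpredN rpred1. Qed.

(** A row of height hI + r carries pi^((p-1)(hI + r)). Dividing by p^hI leaves (-1)^hI modulo lam
    times pi^((p-1) r), which vanishes modulo lam unless r = 0. *)
Lemma Bmx_red i :
  eqm_mx O lam (p%:R ^- hI *: Bmx p d D T expo pi I (L i)) (rowred i).
Proof.
move=> k l; rewrite !mxE /minU; case: ifP => Uk; last first.
  by rewrite mulr0 rpred0; split=> //; apply: eqm_refl.
rewrite /entry; set S := \sum_(nu | _) _.
have OS : S \in O by apply: rpred_sum => nu _; apply: coefAH_O.
have [r Er] : exists r, hgt (enum_val k) = (hI + r)%N.
  by exists (hgt (enum_val k) - hI)%N; rewrite subnKC // ht_ge.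
have -> : p%:R ^- hI * (pi ^+ (p.-1 * hgt (enum_val k)) * S) =
   (pi ^+ p.-1 / p%:R) ^+ hI * (pi ^+ p.-1) ^+ r * S.
  rewrite Er exprM exprD exprMn exprVn.
  by rewrite mulrA; congr (_ * _); rewrite mulrCA mulrA mulrAC.
have Ou := piu_O; split; first by rewrite !rpredM ?rpredX.
rewrite Er -[X in (_ == X)]addn0 eqn_add2l; case: r {Er} => [|r] /=.
  rewrite expr0 mulr1; apply: eqmM => //; first by rewrite rpredX.
    exact: eqmX.
  exact: eqm_refl.
have : eqm O lam ((pi ^+ p.-1) ^+ r.+1) 0.
  rewrite -exprM; case E : (p.-1 * r.+1)%N => [|e].
    by move/eqP: E; rewrite muln_eq0 orbF -subn1 subn_eq0 leqNgt p1.
  by rewrite exprS; apply: eqm0M; rewrite ?rpredX.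
move=> H; rewrite mulrAC mulrC; apply: eqm0M => //.
by rewrite rpredM ?rpredX.
Qed.

Fixpoint redprod k : 'M[algC]_#|{: state}| :=
  if k is k'.+1 then rowred k' *m redprod k' else 1%:M.

Lemma Bprod_red k :
  eqm_mx O lam (p%:R ^- (hI * k) *: Bprod p d D T expo pi I L k) (redprod k).
Proof.
elim: k => [|k IH].
  by rewrite muln0 expr0 invr1 scale1r; exact: eqm_mx1.
have -> : p%:R ^- (hI * k.+1) *: Bprod p d D T expo pi I L k.+1 =
   (p%:R ^- hI *: Bmx p d D T expo pi I (L k)) *m
   (p%:R ^- (hI * k) *: Bprod p d D T expo pi I L k).
  by rewrite /= -scalemxAl -scalemxAr scalerA mulnS exprD invfM.
exact: eqm_mx_mul (Bmx_red k) IH.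
Qed.

Hypothesis I0 : (0 < #|I|)%N.

(** The predecessor in [muI] is truncated, so this fails for empty I. *)
Lemma muIE : (muI d I).+1 = hI.
Proof using d0 I0.
rewrite /muI prednK // divn_gt0 //.
by rewrite -{1}(prednK d0) -add1n leq_add2r.
Qed.

Lemma UmE : Ubound d I = (d * hI)%N.
Proof. by rewrite /Ubound muIE. Qed.

Definition toV (u : Umin d I) : state := [ffun l => inord (val u l)].

Lemma toVE u l : toV u l = val u l :> nat.
Proof. by rewrite ffunE inordK // ltnS (leq_trans _ TU) // -ltnS. Qed.

Lemma Umin_sum (u : Umin d I) : (\sum_l val u l = d * hI)%N.
Proof. by have /andP[/eqP -> _] := valP u; rewrite UmE. Qed.

Lemma Umin_pos (u : Umin d I) l : l \in I -> (0 < val u l)%N.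
Proof. by have /andP[_ /forallP/(_ l)] := valP u => /implyP. Qed.

Lemma toV_minU u : minU (toV u).
Proof.
have E : (\sum_l toV u l = d * hI)%N.
  by rewrite -(Umin_sum u); apply: eq_bigr => l _; rewrite toVE.
rewrite /minU /inU /ht E dvdn_mulr //= mulKn // eqxx andbT.
by apply/forallP => l; apply/implyP => lI; rewrite toVE Umin_pos.
Qed.

Lemma minU_toV (v : state) : minU v -> exists u, toV u = v.
Proof.
case/andP=> Uv /eqP hv; have Ev := ht_mul Uv; rewrite hv -UmE in Ev.
have vB l : (v l < (Ubound d I).+1)%N by rewrite ltnS Ev (bigD1 l) //= leq_addr.
pose w : {ffun 'I_n.+1 -> 'I_(Ubound d I).+1} := [ffun l => Ordinal (vB l)].
have wP : Upred w.
  apply/andP; split.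
    by apply/eqP; rewrite [RHS]Ev; apply: eq_bigr => l _; rewrite ffunE.
  by apply/forallP => l; apply/implyP => lI; rewrite ffunE /=; case/andP: Uv => _ /forallP/(_ l); rewrite lI.
exists (Sub w wP : Umin d I); apply/ffunP => l; apply: val_inj.
by rewrite /= toVE SubK ffunE.
Qed.

Lemma toV_inj : injective toV.
Proof.
move=> u v uv; apply: val_inj; apply/ffunP => l; apply: val_inj => /=.
by rewrite -!toVE uv.
Qed.

Local Notation m := #|{: Umin d I}|.

(** Factoring through the minimal states: [rowred] is [incl *m rowsel], while the product in the
    other order is A^I. *)
Definition incl : 'M[algC]_(#|{: state}|, m) :=
  \matrix_(k, l) (enum_val k == toV (enum_val l))%:R.
Definition rowsel i : 'M[algC]_(m, #|{: state}|) := \matrix_(k, l)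
  ((-1) ^+ hI * \sum_(nu : letter | step p expo nu (enum_val l) (toV (enum_val k))) coefAH p nu (L i)).

Lemma rowredE i : rowred i = incl *m rowsel i.
Proof.
apply/matrixP => k l; rewrite !mxE; case: ifP => Mk.
  have [u Eu] := minU_toV Mk.
  rewrite (bigD1 (enum_rank u)) //= !mxE enum_rankK Eu eqxx mul1r [X in _ + X]big1 ?addr0 // => r ru.
  rewrite !mxE -Eu; case: eqP => [/toV_inj ur|_]; last by rewrite mul0r.
  by case/eqP: ru; rewrite ur enum_valK.
rewrite big1 // => r _; rewrite !mxE; case: eqP => [E|_]; last by rewrite mul0r.
by rewrite E toV_minU in Mk.
Qed.

(* If some [nu j >= p], then [u - a_j] would lie in U^I below the minimal height. *)
Lemma step_small (f : 'I_N -> nat) (u v : Umin d I) :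
  (forall l, \sum_j f j * expo j l + val v l = p * val u l)%N ->
  (forall j, f j < p)%N /\ (\sum_j f j = p.-1 * hI)%N.
Proof using pp d0 expoE I0.
move=> st; split=> [j|].
  rewrite ltnNge; apply/negP => fj.
  have ul l : (p * expo j l + val v l <= p * val u l)%N.
    rewrite -st leq_add2r (bigD1 j) //=; apply: leq_trans (leq_addr _ _).
    by rewrite leq_mul2r fj orbT.
  have ej l : (expo j l <= val u l)%N.
    by rewrite -(leq_pmul2l p0); apply: leq_trans (ul l); apply: leq_addr.
  have pos l : l \in I -> (expo j l < val u l)%N.
    move=> lI; rewrite -(ltn_pmul2l p0); apply: leq_trans (ul l).
    by rewrite -addn1 leq_add2l Umin_pos.
  have S1 : (#|I| + d <= d * hI)%N.
    rewrite -[X in (_ + X <= _)%N](expoE j) -(Umin_sum u) -sum1_card [X in (X + _)%N]big_mkcond -big_split /=.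
    by apply: leq_sum => l _; case: ifP => [/pos|_] //; rewrite add0n.
  have := leq_divM (#|I| + d.-1) d; rewrite mulnC => /(leq_trans S1).
  by rewrite leq_add2l -{1}(prednK d0) ltnn.
apply/eqP; rewrite -(eqn_pmul2l d0); apply/eqP.
have E : (d * (\sum_j f j) + d * hI = p * (d * hI))%N.
  rewrite -{1}(Umin_sum v) -(Umin_sum u) !big_distrr /=.
  transitivity (\sum_l (\sum_j f j * expo j l + val v l))%N.
    rewrite big_split /= exchange_big /=; congr (_ + _)%N.
    by apply: eq_bigr => j _; rewrite -big_distrr /= expoE mulnC.
  by apply: eq_bigr => l _; rewrite st.
by move: E; rewrite -{1}(prednK p0) mulSn addnC => /addnI ->; rewrite mulnCA.
Qed.

(** By [step_small] all exponents are below p, where the Artin-Hasse coefficients are the 1/nu_j! of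
    A^I, and both summation ranges contain them. *)
Lemma rowsel_incl i : rowsel i *m incl = Amx d p expo I (L i).
Proof.
apply/matrixP => k l; rewrite !mxE.
rewrite (bigD1 (enum_rank (toV (enum_val l)))) //= !mxE enum_rankK eqxx mulr1.
rewrite [X in _ + X]big1 ?addr0 => [|r rl]; last first.
  rewrite !mxE; case: eqP => [E|_]; last by rewrite mulr0.
  by case/eqP: rl; rewrite -E enum_valK.
rewrite /Aentry muIE; congr (_ * _).
set u := enum_val k; set v := enum_val l.
pose P (f : 'I_N -> nat) := [forall l, \sum_j f j * expo j l + val v l == p * val u l]%N.
pose G (f : 'I_N -> nat) : algC := \prod_j (ah p (f j) * L i j ^+ f j).
have extP f f' : f =1 f' -> P f = P f'.
  by move=> ff; apply: eq_forallb => r; under eq_bigr => j _ do rewrite ff.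
have extG f f' : f =1 f' -> G f = G f'.
  by move=> ff; apply: eq_bigr => j _; rewrite ff.
have PS f : P f -> (forall j, f j < p)%N /\ (\sum_j f j = p.-1 * hI)%N.
  by move=> /forallP Pf; apply: step_small => r; apply/eqP; apply: Pf.
have hI0 : (0 < hI)%N by rewrite -muIE.
transitivity (\sum_(nu : letter | P (fun j => nu j)) G (fun j => nu j)).
  apply: eq_bigl => nu; apply: eq_forallb => r; by rewrite !toVE.
rewrite (@sum_ffun_bound _ _ D (p.-1 * hI)) //; last first.
  move=> f /PS[fp _] j; have := fp j => fj; apply/andP; split; first by lia.
  apply: leq_trans (_ : p.-1 <= _)%N; first by lia.
  by rewrite leq_pmulr.
apply: eq_big => [nu|nu Pn].
  apply/idP/andP => [Pn|[_ //]]; split=> //; by rewrite (PS _ Pn).2.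
apply: eq_bigr => j _; rewrite ah_small //; last exact: (PS _ Pn).1.
by rewrite mulrC.
Qed.

(** The fold puts index 0 rightmost, so a new index enters as the left factor. *)
Lemma AprodS k (LL : 'I_N -> algC) :
  Aprod d p expo I LL k.+1 =
  Amx d p expo I (fun j => LL j ^+ (p ^ k)) *m Aprod d p expo I LL k.
Proof.
have Ek : iota 0 k.+1 = iota 0 k ++ [:: k] by rewrite -[k.+1]addn1 iotaD.
rewrite /Aprod Ek foldr_cat /= mul1mx.
move: (Amx _ _ _ _ _) => Z; elim: (iota 0 k) => [|i s IH] /=; first by rewrite mulmx1.
by rewrite IH mulmxA.
Qed.

(** One matrix X satisfies both redprod = incl X and Aprod = X incl, and Sylvester's identity
    exchanges the factors. The empty product has no such factorization, hence 0 < a. *)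
Lemma fredholm_redprod (LL : 'I_N -> algC) a : (forall i j, L i j = LL j ^+ (p ^ i)) ->
  (0 < a)%N -> fredholm (redprod a) = Adet d p expo I LL a.
Proof.
move=> LE; case: a => // a _.
have E k : exists X, redprod k.+1 = incl *m X /\ X *m incl = Aprod d p expo I LL k.+1.
  have AE i : rowsel i *m incl = Amx d p expo I (fun j => LL j ^+ (p ^ i)).
    rewrite rowsel_incl; apply/matrixP => r c; rewrite !mxE /Aentry; congr (_ * _).
    by apply: eq_bigr => nu _; apply: eq_bigr => j _; rewrite LE.
  elim: k => [|k [X [E1 E2]]].
    exists (rowsel 0); rewrite /= mulmx1 rowredE; split=> //.
    by rewrite AprodS AE /Aprod /= mulmx1.
  exists (rowsel k.+1 *m (incl *m X)); split.
    by rewrite -[LHS]/(rowred k.+1 *m redprod k.+1) E1 rowredE -mulmxA.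
  by rewrite AprodS -AE -E2 !mulmxA.
have [X [-> EX]] := E a; rewrite fredholm_mulC EX.
by [].
Qed.

Lemma Aprod_mem (LL : 'I_N -> algC) a : (forall j, LL j \in O) ->
  forall i j, Aprod d p expo I LL a i j \in O.
Proof using pp d0 expoE I0 Zsub.
move=> LLO; elim: a => [|a IH] i j; first by rewrite mxE rpredMn ?rpred1.
rewrite AprodS mxE rpred_sum // => l _; rewrite rpredM //.
rewrite mxE /Aentry rpredM ?rpredX ?rpredN ?rpred1 //.
apply: rpred_sum => nu /andP[_ /forallP st]; apply: rpred_prod => r _.
rewrite rpredM ?rpredX //; apply: Zsub; apply: ZlocV => //.
have [|nup _] := @step_small (fun r => nu r) (enum_val i) (enum_val l).
  by move=> s; apply/eqP.
elim: (nat_of_ord (nu r)) (nup r) => [|e IHe] ep; first by rewrite dvdn1 gtn_eqF.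
by rewrite factS Euclid_dvdM // negb_or IHe 1?ltnW // gtnNdvd.
Qed.

Lemma Adet_mem (LL : 'I_N -> algC) a : (forall j, LL j \in O) ->
  Adet d p expo I LL a \in polyO O.
Proof. by move=> LLO; apply: fredholm_mem; apply: Aprod_mem. Qed.

End HasseWittReduction.

(** * Zeta series as quotients of determinants *)

Section QuotientCongruence.

Variables (O : subringClosed algC) (c : algC) (K : nat).

Lemma quotient_coef (f G H : {poly algC}) j : f`_0 = 1 -> eqX K (f * G) H ->
  (j < K)%N -> G`_j = H`_j - \sum_(i < j) f`_(j - i) * G`_i.
Proof.
move=> f0 E jK; rewrite -(E j jK) mulrC coefM big_ord_recr /= subnn f0 mulr1.
rewrite addrC -addrA; under eq_bigr => i _ do rewrite mulrC.
by rewrite subrr addr0.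
Qed.

Lemma quotient_mem (f G H : {poly algC}) : f \in polyO O -> H \in polyO O ->
  f`_0 = 1 -> eqX K (f * G) H -> forall j, (j < K)%N -> G`_j \in O.
Proof.
move=> Of OH f0 E; elim/ltn_ind=> j IH jK; rewrite (quotient_coef f0 E jK).
rewrite rpredB //; first exact/polyOP.
apply: rpred_sum => i _; rewrite rpredM //; first exact/polyOP.
by apply: IH => //; apply: ltn_trans jK.
Qed.

Lemma quotient_eqm (f f' G G' H H' : {poly algC}) : c \in O ->
  f \in polyO O -> H \in polyO O -> f' \in polyO O -> H' \in polyO O ->
  f`_0 = 1 -> f'`_0 = 1 ->
  eqm (polyO O) c%:P f f' -> eqm (polyO O) c%:P H H' ->
  eqX K (f * G) H -> eqX K (f' * G') H' ->
  forall j, (j < K)%N -> eqm O c G`_j G'`_j.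
Proof.
move=> Oc Of OH Of' OH' f0 f0' ff HH E E'; elim/ltn_ind=> j IH jK.
rewrite (quotient_coef f0 E jK) (quotient_coef f0' E' jK).
apply: eqmB; first exact: eqm_coef.
apply: eqm_sum => i _; have iK : (i < K)%N by apply: ltn_trans jK.
apply: eqmM; [exact/polyOP|exact: quotient_mem E' _ iK|exact: eqm_coef|exact: IH].
Qed.

End QuotientCongruence.

Section SeriesSide.

Lemma eqX_inv_unique K (f g h : {poly algC}) :
  eqX K (f * g) 1 -> eqX K (f * h) 1 -> eqX K g h.
Proof.
move=> fg fh; have := eqXM (@eqX_refl _ K g) fh; rewrite mulr1 => /eqX_sym.
move=> H; apply: eqX_trans H _; have -> : g * (f * h) = f * g * h by ring.
by have := eqXM fg (@eqX_refl _ K h); rewrite mul1r.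
Qed.

Lemma truncs_zeta_opp K (A : series) :
  eqX K (truncs K (zeta_series A) * truncs K (zeta_series (fun r => - A r))) 1.
Proof.
apply: eqX_trans (eqX_sym (@truncs_zeta_seriesD K A _)) _.
case: K => // K; apply: zeta_series_unique; first by rewrite coef1.
move=> k kK; rewrite mulr1 coefXM coef_deriv coef1 coef_truncs //.
by case: eqP => // _; rewrite mul0rn subrr.
Qed.

Lemma zeta_geometric K c :
  eqX K (truncs K (zeta_series (fun r => - c ^+ r))) (1 - c%:P * 'X).
Proof.
case: K => // K; apply: zeta_series_unique.
  by rewrite coefB coef1 coefCM coefX mulr0 subr0.
have D1 : (1 - c%:P * 'X)^`() = - c%:P :> {poly algC}.
  have -> : 1 - c%:P * 'X = 1%:P - c *: 'X by rewrite mul_polyC.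
  by rewrite derivB derivZ derivX derivC sub0r alg_polyC.
move=> k kK; rewrite D1 mulrN mulrBr mulr1 mulrA coefN coefB coefMX.
rewrite ['X * _]mulrC coefCM [_ * c%:P]mulrC coefCM.
case: k kK => [|k] kK; first by rewrite /= coefX mulr0 logder0 subr0 oppr0.
rewrite coef_truncs //= coefX coef_truncs 1?ltnW //.
by case: k {kK} => [|k] /=; rewrite ?mulr1 ?mulr0 ?expr1 ?subr0 // [c ^+ k.+2]exprS; ring.
Qed.

(** Inverting a zeta series negates its exponent, so the parity test becomes the sign (-1)^n; the
    factors 1 - q^i t subtract the points of a projective space of dimension n - 1. *)
Lemma truncs_P_series K n q (cnt : nat -> algC) :
  eqX K (truncs K (P_series n q cnt))
   (truncs K (zeta_series (fun r => (-1) ^+ n * (cnt r - \sum_(i < n) (q%:R ^+ r) ^+ i)))).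
Proof.
set A := fun r => cnt r - \sum_(i < n) (q%:R ^+ r) ^+ i.
set W := smul (zeta_series cnt) (polyser (\prod_(i < n) (1 - ((q ^ i)%N)%:R%:P * 'X))).
have EW : eqX K (truncs K W) (truncs K (zeta_series A)).
  apply: eqX_trans (@truncs_smul K _ _) _.
  have EP : eqX K (truncs K (polyser (\prod_(i < n) (1 - ((q ^ i)%N)%:R%:P * 'X))))
      (truncs K (zeta_series (fun r => \sum_(i < n) - ((q%:R ^+ i) ^+ r)))).
    refine (eqX_trans _ (@truncs_zeta_prod K 'I_n (fun i r => - ((q%:R ^+ i) ^+ r)))).
    apply: (@eqX_trans _ _ (\prod_(i < n) (1 - ((q ^ i)%N)%:R%:P * 'X))).
      exact: eqX_truncs.
    apply: eqX_prod => i _; rewrite natrX; apply: eqX_sym; exact: zeta_geometric.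
  apply: eqX_trans (eqXM (@eqX_refl _ _ _) EP) _.
  apply: eqX_trans (eqX_sym (@truncs_zeta_seriesD K _ _)) _.
  apply: eqX_truncs => k kK; rewrite coef_truncs //; apply: eq_zeta_series => j _.
  by rewrite /A sumrN; congr (_ - _); apply: eq_bigr => i _; rewrite -!exprM mulnC.
rewrite /P_series -/W; case: ifP => on.
  have -> : (fun r => (-1) ^+ n * A r) = (fun r => - A r).
    by apply: funext => r; rewrite -signr_odd on expr1 mulN1r.
  case: K EW => // K EW.
  have W0 : W 0%N = 1.
    have := EW 0%N (ltn0Sn _); rewrite !coef_truncs // => ->; exact: zeta_series0.
  apply: eqX_inv_unique (@truncs_sinv _ W (ltn0Sn K) W0) _.
  by apply: eqX_trans (eqXM EW (@eqX_refl _ _ _)) _; apply: truncs_zeta_opp.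
have -> : (fun r => (-1) ^+ n * A r) = A; last exact: EW.
by apply: funext => r; rewrite -signr_odd on expr0 mul1r.
Qed.

Lemma zeta_fredholm K m (X : 'M[algC]_m) :
  eqX K (truncs K (zeta_series (fun r => - \tr (mxpow X r)))) (fredholm X).
Proof.
apply: zeta_series_unique; first exact: fredholm0.
suff -> : logder K (fun r => - \tr (mxpow X r)) = - logder K (fun r => \tr (mxpow X r)).
  exact: fredholm_logder.
by apply/polyP => k; rewrite coefN !coef_poly; case: (k < K)%N; case: (k == 0)%N; rewrite ?oppr0.
Qed.

(** Since det(1 - tX) is the exponential of minus the sum of tr(X^r) t^r / r, negative signs go to
    the numerator. Cross-multiplication avoids inverse series. *)
Lemma zeta_fredholm_prod K (J : finType) (m : nat) (X : J -> 'M[algC]_m)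
    (sgn : J -> bool) (delta : series) :
  eqX K (\prod_(j | ~~ sgn j) fredholm (X j) *
     truncs K (zeta_series (fun r => \sum_j (-1) ^+ sgn j * \tr (mxpow (X j) r) + delta r)))
   (\prod_(j | sgn j) fredholm (X j) * truncs K (zeta_series delta)).
Proof.
pose A j r : algC := (-1) ^+ sgn j * \tr (mxpow (X j) r).
pose Z := fun j => truncs K (zeta_series (A j)).
have E1 : eqX K (truncs K (zeta_series (fun r => \sum_j A j r + delta r)))
    (\prod_j Z j * truncs K (zeta_series delta)).
  apply: eqX_trans (@truncs_zeta_seriesD K _ _) _; apply: eqXM => //.
  by apply: eqX_sym; apply: truncs_zeta_prod.
apply: eqX_trans (eqXM (@eqX_refl _ _ _) E1) _; rewrite mulrA; apply: eqXM => //.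
rewrite [X in _ * X](bigID (fun j => ~~ sgn j)) /= mulrA -big_split /=.
rewrite -[X in eqX _ _ X]mul1r; apply: eqXM.
  apply: (@eqX_trans _ _ (\prod_(j | ~~ sgn j) 1)); last by rewrite big1.
  apply: eqX_prod => j /negPf sj; rewrite mulrC.
  apply: eqX_trans (eqXM (@eqX_refl _ _ _) (eqX_sym (@zeta_fredholm K _ (X j)))) _.
  have -> : Z j = truncs K (zeta_series (fun r => \tr (mxpow (X j) r))).
    rewrite /Z; congr (truncs K (zeta_series _)); apply: funext => r.
    by rewrite /A sj expr0 mul1r.
  exact: truncs_zeta_opp.
rewrite (eq_bigl sgn) => [|j]; last by rewrite negbK.
apply: eqX_prod => j sj; rewrite /Z.
have -> : A j = (fun r => - \tr (mxpow (X j) r)); last exact: zeta_fredholm.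
by apply: funext => r; rewrite /A sj expr1 mulN1r.
Qed.

Lemma Crat_smul (f g : series) : (forall k, f k \in Crat) -> (forall k, g k \in Crat) ->
  forall k, smul f g k \in Crat.
Proof. by move=> Qf Qg k; apply: rpred_sum => i _; rewrite rpredM. Qed.

Lemma Crat_spow (f : series) m : (forall k, f k \in Crat) -> forall k, spow f m k \in Crat.
Proof.
move=> Qf; elim: m => [|m IH] k; last exact: Crat_smul.
by rewrite /= /sone rpred_nat.
Qed.

Lemma Crat_P_series n q (cnt : nat -> algC) : (forall r, cnt r \in Crat) ->
  forall k, P_series n q cnt k \in Crat.
Proof.
move=> Qc; set W := smul (zeta_series cnt) (polyser (\prod_(i < n) (1 - ((q ^ i)%N)%:R%:P * 'X))).
have QW k : W k \in Crat.
  apply: Crat_smul => {}k.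
    apply: rpred_sum => m _; rewrite rpredM ?rpredV ?rpred_nat // Crat_spow // => i.
    by case: eqP; rewrite ?rpred0 // => _; rewrite rpredM ?rpredV ?rpred_nat.
  suff /polyOverP H : \prod_(i < n) (1 - ((q ^ i)%N)%:R%:P * 'X) \is a polyOver Crat by exact: H.
  apply: rpred_prod => i _; apply: rpredB; first exact: rpred1.
  by apply: rpredM; [rewrite polyOverC rpred_nat|exact: polyOverX].
move=> k; rewrite /P_series -/W; case: ifP => // _.
by apply: rpred_sum => m _; apply: Crat_spow => i; rewrite rpredB // /sone rpred_nat.
Qed.

End SeriesSide.

(** With j = |I| the difference of the two sides is n - j - mu + ceil(j/d). For j = n - s with s >
    0, a nonpositive difference would give d ceil(j/d) + ds <= n = j + s, hence ds <= s, impossible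
    for d >= 2. *)
Lemma exponent_gap n d j : (2 <= d)%N -> (j <= n.+1)%N ->
  (j + n %/ d <= n + (j + d.-1) %/ d)%N /\
  ((j + n %/ d == n + (j + d.-1) %/ d)%N = (j == n.+1) || (j == n) && (d %| n)%N).
Proof.
move=> d2 jn; have d0 : (0 < d)%N by exact: ltnW.
have En := divn_eq n d; have Ln := ltn_pmod n d0.
have [->|jn1] := eqVneq j n.+1.
  have -> : (n.+1 + d.-1 = n + d)%N by lia.
  by rewrite divnDr // divnn d0 addn1 addSnnS leqnn eqxx.
have [->|jn0] := eqVneq j n; rewrite ?orFb ?andTb ?andFb.
  rewrite leq_add2l eqn_add2l /dvdn; move: En Ln; set x := (n %/ d)%N; set y := (n %% d)%N.
  move=> -> Ln; rewrite -addnA divnMDl //; case: y Ln => [|y] Ln.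
    by rewrite add0n divn_small ?addn0 ?leqnn ?eqxx // prednK.
  have -> : (y.+1 + d.-1 = y + d)%N by lia.
  rewrite divnDr // divnn d0 addn1; move: (y %/ d)%N => e; split; lia.
suff H : (j + n %/ d < n + (j + d.-1) %/ d)%N by split; [exact: ltnW|rewrite ltn_eqF].
rewrite ltnNge; apply/negP => H.
have E2 := divn_eq (j + d.-1) d; have L2 := ltn_pmod (j + d.-1) d0.
move: En Ln E2 L2 H; move: (n %/ d)%N (n %% d)%N ((j + d.-1) %/ d)%N ((j + d.-1) %% d)%N.
move=> x1 y1 x2 y2 En Ln E2 L2 H.
have [t Et] : exists t, (n = j + t.+1)%N by exists (n - j).-1; lia.
have H1 : (x2 + t.+1 <= x1)%N by lia.
have H2 : ((x2 + t.+1) * d <= x1 * d)%N by rewrite leq_mul2r H1 orbT.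
have H3 : (t.+1 * 2 <= t.+1 * d)%N by rewrite leq_mul2l d2 orbT.
by rewrite mulnDl in H2; lia.
Qed.

(** * The congruence *)

Lemma eqm_subr0 (R : comNzRingType) (S : subringClosed R) c x y :
  eqm S c x y <-> eqm S c (x - y) 0.
Proof.
split=> -[w Sw E]; exists w => //; first by rewrite E; ring.
by rewrite add0r in E; rewrite -E; ring.
Qed.

Section Main.

Variables (p a n d N : nat) (F : finFieldType).
Variables (E : nat -> finFieldType) (emb : forall r : nat, {rmorphism F -> E r}).
Variables (expo : 'I_N -> 'I_n.+1 -> nat) (lam : 'I_N -> F) (zeta : algC) (beta : F).
Hypotheses (pp : prime p) (a0 : (0 < a)%N) (cF : #|F| = (p ^ a)%N).
Hypotheses (n1 : (1 <= n)%N) (d2 : (2 <= d)%N).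
Hypothesis expoE : forall j : 'I_N, (\sum_(i < n.+1) expo j i = d)%N.
Hypothesis cE : forall r : nat, (0 < r)%N -> #|E r| = ((p ^ a) ^ r)%N.
Hypotheses (zq : (#|F|.-1).-primitive_root zeta) (bq : (#|F|.-1).-primitive_root beta).
Variable y : algC.
Hypothesis yp : p.-primitive_root y.

Local Notation q := (p ^ a)%N.
Local Notation O := (Oz beta (zeta * y)).
Let Lhat j := teich beta zeta (lam j).
Let Ls i j := Lhat j ^+ (p ^ i).
Let cnt r := proj_count expo (fun j : 'I_N => emb r (lam j)).
Let p0 := prime_gt0 pp.
Let p1 := prime_gt1 pp.
Let pF := pcharF_card pp cF.
Let d0 : (0 < d)%N := ltnW d2.
Let lamO := lam_O pp cF zq bq yp.

Lemma Lhat_O j : Lhat j \in O.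
Proof. by apply: (Oz_zy cF zq yp); apply: teich_Oz. Qed.

Lemma Ls_O i j : Ls i j \in O. Proof. by rewrite rpredX // Lhat_O. Qed.

Lemma Ls_periodic i j : Ls (i + a) j = Ls i j.
Proof. by rewrite /Ls expnD mulnC exprM -cF teich_card. Qed.

Lemma Zloc_O : {subset Zloc p <= O}. Proof. exact: Zloc_Oz. Qed.

Lemma cnt_Zloc r : (0 < r)%N -> cnt r \in Zloc p.
Proof.
move=> r0; rewrite rpredM ?rpred_nat //; apply: ZlocV => //.
apply: (coprime_p_pred (E := E r) pp (s := (a * r)%N)).
by rewrite cE // expnM.
Qed.

Local Notation lmb := (y - 1).
Local Notation Q := (q%:R : algC).
Let mu := muI d [set: 'I_n.+1].

Definition lhs : series := fun j => P_series n q cnt j * Q ^- (mu * j)%N.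
Definition osgn (I : {set 'I_n.+1}) : bool := odd (n + #|I|).
Definition extremal (I : {set 'I_n.+1}) : bool :=
  (#|I| == n.+1) || (#|I| == n) && (d %| n)%N.
Definition target (I : {set 'I_n.+1}) : {poly algC} :=
  if extremal I then Adet d p expo I Lhat a else 1.

(** * Reduction modulo y - 1 at a fixed precision *)

Section Precision.

Variables (M D T : nat) (pi : algC).
Hypothesis pi_lam : eqm O (y - 1) pi 0.
Hypotheses (M0 : (0 < M)%N) (piO : pi \in O) (pi0 : pi != 0).
Hypotheses (piy : eqm O (p%:R ^+ M) (AHpoly p D).[pi] y).
Hypotheses (piu : eqm O (y - 1) (pi ^+ p.-1 / p%:R) (-1)).
Hypotheses (pis : eqm O (p%:R ^+ M) (pi ^+ D.+1) 0).
Hypothesis (TP : (N * D * d <= T)%N).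

Let Theta I := Bprod p d D T expo pi I Ls a.

Lemma mxpow_mem (S : subringClosed algC) m (A : 'M[algC]_m) r :
  (forall i j, A i j \in S) -> forall i j, mxpow A r i j \in S.
Proof.
move=> SA; elim: r => [|r IH] i j; first by rewrite mxE rpredMn ?rpred1.
by rewrite mxE rpred_sum // => l _; rewrite rpredM.
Qed.

Lemma Theta_mem I i j : Theta I i j \in O.
Proof.
rewrite /Theta; elim: (a) i j => [|k IH] i j; first by rewrite mxE rpredMn ?rpred1.
rewrite mxE rpred_sum // => l _; rewrite rpredM //.
rewrite mxE; case: ifP => _; last exact: rpred0.
rewrite rpredM ?rpredX // rpred_sum // => nu _.
exact: (coefAH_O pp Zloc_O Ls_O nu k).
Qed.

Lemma tr_mem I r : \tr (mxpow (Theta I) r) \in O.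
Proof. by apply: rpred_sum => i _; apply: mxpow_mem; apply: Theta_mem. Qed.

(** Over E r the count holds in a ring depending on r. Agreement of the Teichmüller lifts and their
    period a turn the product of a r factors into Theta^r; both sides then lie in O, and
    [tower_descent] applies. *)
Lemma count_trace r : (0 < r)%N ->
  eqm O (p%:R ^+ M) (q%:R ^+ r * cnt r)
   (\sum_(I : {set 'I_n.+1}) (-1) ^+ #|I| * (q%:R ^+ r) ^+ (n.+1 - #|I|) *
       \tr (mxpow (Theta I) r) + q%:R ^+ r * \sum_(i < n) (q%:R ^+ r) ^+ i).
Proof.
move=> r0; have cEr : #|E r| = (p ^ (a * r))%N by rewrite cE // expnM.
have [g [z' [c [gq zq' gc zc]]]] := tower_exists (emb r) cF cEr zq bq.
have sub := tower_sub pp cEr gq zq' gc zc yp.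
have H := proj_count_trace (fun j => emb r (lam j)) pp cEr yp zq' gq (sub _ piO) pi0 M0 (eqm_sub sub piy)
  (eqm_sub sub pis) d0 expoE TP.
have QE : #|E r|%:R = q%:R ^+ r :> algC by rewrite cE // natrX.
rewrite QE -/(cnt r) in H.
have HT I : \tr (Bprod p d D T expo pi I (teichs g z' p (fun j => emb r (lam j))) (a * r)) =
   \tr (mxpow (Theta I) r).
  rewrite /Theta -Bprod_periodic; last exact: Ls_periodic.
  congr (\tr _).
  apply: eq_Bprod => i j; rewrite /teichs /Ls /Lhat.
  by rewrite (teich_emb zq bq gq zq' gc zc).
rewrite (eq_bigr _ (fun I _ => congr1 (fun t => _ * t) (HT I))) in H.
apply: (proj2 (eqm_subr0 _ _ _ _)).
apply: (tower_descent pp cF cEr zq bq gq zq' gc zc yp);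
  last exact: (proj1 (eqm_subr0 _ _ _ _) H).
have Oq : q%:R ^+ r \in O by rewrite rpredX // rpred_nat.
apply: rpredB; first exact: rpredM Oq (Zloc_O (cnt_Zloc r0)).
apply: rpredD; last first.
  by apply: rpredM => //; apply: rpred_sum => i _; apply: rpredX.
apply: rpred_sum => I _; apply: rpredM; last exact: tr_mem.
by rewrite rpredM // rpredX // rpredN rpred1.
Qed.

Variable k : nat.
Hypothesis (MK : (a * k * mu.+1 + k + 1 <= M)%N).
Hypothesis (pD : (p <= D.+1)%N) (TU : forall I : {set 'I_n.+1}, (Ubound d I <= T)%N).

Let qn0 : Q != 0. Proof. by rewrite natC_neq0 // expn_gt0 p0. Qed.
Let pn0 : (p%:R : algC) != 0. Proof. exact: natC_neq0. Qed.

Lemma muE : mu = (n %/ d)%N.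
Proof.
rewrite /mu /muI cardsT card_ord; rewrite addSnnS prednK //.
by rewrite divnDr // divnn d0 addn1.
Qed.

(* [Q ^ (n - #|I| - mu)], whose exponent may be negative. *)
Definition scaled (I : {set 'I_n.+1}) := (Q ^+ n / (Q ^+ #|I| * Q ^+ mu)) *: Theta I.
Definition mainterm r := \sum_(I : {set 'I_n.+1}) (-1) ^+ osgn I * \tr (mxpow (scaled I) r).
(** The error of finite precision: the exact exponent of P(q^-mu t) minus its expression by
    traces. *)
Definition delta : series := fun r =>
  (Q ^- mu) ^+ r * ((-1) ^+ n * (cnt r - \sum_(i < n) (Q ^+ r) ^+ i)) - mainterm r.

Lemma lhs_zeta :
  eqX k.+1 (truncs k.+1 lhs) (truncs k.+1 (zeta_series (fun r => mainterm r + delta r))).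
Proof.
move=> j jk; rewrite !coef_truncs //.
have := @truncs_P_series k.+1 n q cnt j jk; rewrite !coef_truncs // => EP.
rewrite /lhs EP exprM -exprVn -[LHS]mulrC -zeta_series_scale.
by apply: eq_zeta_series => i _; rewrite /delta [RHS]addrC subrK.
Qed.

Lemma p_eqm0 : eqm O lmb p%:R 0.
Proof.
have [u [Ou _] ->] := p_lam_unit pp cF zq bq yp.
exists (lmb ^+ p.-2 * u); first by rewrite rpredM ?rpredX.
by rewrite add0r mulrA -exprS prednK // -subn1 subn_gt0.
Qed.

Lemma delta_small j l : (0 < j <= k)%N -> (0 < l <= k)%N ->
  eqm O lmb (delta j / l%:R) 0.
Proof.
move=> /andP[j0 jk] /andP[l0 lk]; have [w Ow Ew] := count_trace j0.
have Qj0 : Q ^+ j != 0 by rewrite expf_neq0.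
set s := (Q ^- mu) ^+ j * (-1) ^+ n.
have Ec : cnt j - \sum_(i < n) (Q ^+ j) ^+ i = (Q ^+ j)^-1 *
    (\sum_(I : {set 'I_n.+1}) (-1) ^+ #|I| * (Q ^+ j) ^+ (n.+1 - #|I|) *
       \tr (mxpow (Theta I) j) + p%:R ^+ M * w).
  apply: (mulfI Qj0); rewrite mulrBr Ew mulrA mulfV // mul1r addrAC; congr (_ + _).
  by rewrite addrK.
have Em : mainterm j = s * ((Q ^+ j)^-1 *
    \sum_(I : {set 'I_n.+1}) (-1) ^+ #|I| * (Q ^+ j) ^+ (n.+1 - #|I|) *
       \tr (mxpow (Theta I) j)).
  rewrite !mulr_sumr; apply: eq_bigr => I _.
  rewrite /scaled mxpowZ mxtraceZ /osgn signr_odd exprD /s.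
  have cI : (#|I| <= n.+1)%N by have := max_card (mem I); rewrite card_ord.
  have -> : (Q ^+ n / (Q ^+ #|I| * Q ^+ mu)) ^+ j =
      (Q ^- mu) ^+ j * ((Q ^+ j)^-1 * (Q ^+ j) ^+ (n.+1 - #|I|)).
    have E1 : (Q ^+ j) ^+ (n.+1 - #|I|) * (Q ^+ #|I|) ^+ j = Q ^+ j * (Q ^+ n) ^+ j.
      by rewrite -!exprM -!exprD [(#|I| * j)%N]mulnC -mulnDr subnK // mulnS mulnC [(n * j)%N]mulnC.
    have I0 : (Q ^+ #|I|) ^+ j != 0 by rewrite !expf_neq0.
    have m0 : (Q ^+ mu) ^+ j != 0 by rewrite !expf_neq0.
    rewrite expr_div_n exprMn exprVn; apply: (mulIf I0); apply: (mulIf m0).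
    rewrite -[LHS]mulrA divfK ?mulf_neq0 //.
    have aux (K : fieldType) (u v x z t : K) : z != 0 -> x != 0 -> u * v = z * t ->
        t = x^-1 * (z^-1 * u) * v * x.
      move=> z0 x0 Euv; have -> : x^-1 * (z^-1 * u) * v * x = x^-1 * x * z^-1 * (u * v) by ring.
      by rewrite Euv mulVf // mul1r mulKf.
    exact: aux E1.
  have aux (K : comNzRingType) (x1 x2 x3 x4 x5 x6 : K) :
      x1 * x2 * (x3 * (x4 * x5) * x6) = x3 * x1 * (x4 * (x2 * x5 * x6)) by ring.
  exact: aux.
have Ed : delta j = s * ((Q ^+ j)^-1 * (p%:R ^+ M * w)).
  rewrite /delta Em Ec [X in X - _]mulrA -/s.
  have aux (K : comNzRingType) (x1 x2 x3 x4 x5 : K) :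
      x1 * (x2 * (x3 + x4 * x5)) - x1 * (x2 * x3) = x1 * (x2 * (x4 * x5)) by ring.
  exact: aux.
(* M pays for the division by Q^(j(mu+1)), for the p-part of l <= k, and for one further p, which is
   0 modulo y - 1. *)
have [e Ee] : exists e, M = (k + (a * j * mu.+1 + e.+1))%N.
  have : (a * j * mu.+1 <= a * k * mu.+1)%N by rewrite leq_mul2r leq_mul2l jk !orbT.
  move=> H; have H1 : (k + (a * j * mu.+1 + 1) <= M)%N.
    by apply: leq_trans MK; rewrite addnA leq_add2r addnC leq_add2r.
  have aux x z m : (z + (x + 1) <= m)%N -> exists e, m = (z + (x + e.+1))%N.
    by move=> H2; exists (m - (z + (x + 1)))%N; rewrite -addSnnS -[x.+1]addn1 addnA subnKC.
  exact: aux H1.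
have Epq : p%:R ^+ (a * j * mu.+1) = Q ^+ j * (Q ^+ mu) ^+ j :> algC.
  rewrite natrX -!exprM -!exprD; congr (_ ^+ _).
  by move: mu => m; ring.
have -> : delta j / l%:R = p%:R * (p%:R ^+ e * (p%:R ^+ k / l%:R) * (-1) ^+ n * w).
  rewrite Ed /s Ee !exprD Epq exprS exprVn.
  have m0 : (Q ^+ mu) ^+ j != 0 by rewrite !expf_neq0.
  have aux (K : fieldType) (u v x1 x2 x3 x4 x5 x6 : K) : u != 0 -> v != 0 ->
      v^-1 * x4 * (u^-1 * (x1 * (u * v * (x6 * x2)) * x5)) * x3 =
      x6 * (x2 * (x1 * x3) * x4 * x5) by move=> u0 v0; field; rewrite u0 v0.
  exact: aux.
apply: eqm0M; last exact: p_eqm0.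
rewrite rpredM // rpredM ?rpredX ?rpredN ?rpred1 // rpredM ?rpredX ?rpred_nat //.
apply: Zloc_O; apply: Zloc_pow_div => //.
by apply: leq_trans (ltnW (ltn_logl _ l0)) lk.
Qed.

Lemma zeta_delta_mem :
  truncs k.+1 (zeta_series delta) \in polyO O /\
  eqm (polyO O) lmb%:P (truncs k.+1 (zeta_series delta)) 1.
Proof.
have small j : (0 < j <= k)%N -> eqm O lmb (zeta_series delta j) 0.
  by apply: zeta_series_small => // i l; apply: delta_small.
pose w : {poly algC} := \poly_(j < k.+1) (if j == 0%N then 0 else zeta_series delta j / lmb).
have lmb0 := lam_neq0 pp yp.
have Ow : w \in polyO O.
  apply/polyOP => j; rewrite coef_poly; case: ltnP => jk; last exact: rpred0.
  case: eqP => [_|/eqP j0]; first exact: rpred0.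
  have [|v Ov ->] := small j; first by rewrite lt0n j0.
  by rewrite add0r mulrC mulKf.
have Ew : truncs k.+1 (zeta_series delta) = 1 + lmb%:P * w.
  apply/polyP => j; rewrite coefD coef1 coefCM !coef_poly; case: ltnP => jk.
    case: eqP => [->|_]; first by rewrite zeta_series0 mulr0 addr0.
    by rewrite add0r mulrC divfK.
  by rewrite mulr0 addr0 gtn_eqF // (leq_trans _ jk).
split; last by exists w.
rewrite Ew rpredD ?rpred1 // rpredM //; apply/polyOP => j.
by rewrite coefC; case: eqP; rewrite ?rpred0.
Qed.

Lemma scaled_red I :
  fredholm (scaled I) \in polyO O /\ eqm (polyO O) lmb%:P (fredholm (scaled I)) (target I).
Proof.
set h := ((#|I| + d.-1) %/ d)%N.
have cI : (#|I| <= n.+1)%N by have := max_card (mem I); rewrite card_ord.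
have [le_e eq_e] := exponent_gap d2 cI; rewrite -muE -/h in le_e eq_e.
(* Writing n - |I| - mu as e - h distributes the scalar: p^(h a) divides Theta exactly as far as
   [Bprod_red] allows, and the truncated subtraction is harmless by [exponent_gap]. *)
pose e := (n + h - (#|I| + mu))%N.
have Ee : (n + h = #|I| + mu + e)%N by rewrite /e subnKC.
have EX : scaled I = Q ^+ e *: (p%:R ^- (h * a) *: Theta I).
  rewrite scalerA /scaled; congr (_ *: _).
  have -> : p%:R ^+ (h * a) = Q ^+ h :> algC by rewrite natrX -exprM mulnC.
  have m0 i : Q ^+ i != 0 by rewrite expf_neq0.
  apply/eqP; rewrite -[X in _ == X]/(_ / _) eqr_div ?mulf_neq0 //.
  by rewrite -!exprD Ee addnC.
have Red := @Bprod_red p n d N D T expo pi lmb O Ls I pp d0 pD (TU I) lamO Zloc_O piO piu pi_lam Ls_O a.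
rewrite -/h -/(Theta I) in Red.
have [e0|e0] := posnP e.
  have XE : eqm_mx O lmb (scaled I) (redprod p d D T expo Ls I a).
    by rewrite EX e0 expr0 scale1r.
  split; first by apply: fredholm_mem => i j; have [] := XE i j.
  apply: eqm_trans (eqm_fredholm lamO XE) _.
  have ext : extremal I by rewrite /extremal -eq_e Ee e0 addn0.
  (* Here n >= 1 enters: extremal sets are nonempty, as [muIE] demands. *)
  have I0 : (0 < #|I|)%N.
    by move: ext; rewrite /extremal => /orP[/eqP ->|/andP[/eqP ->]].
  rewrite /target ext (fredholm_redprod pp d0 expoE pD (TU I) lamO piO I0 (LL := Lhat)) //.
  exact: eqm_refl.
have XE : eqm_mx O lmb (scaled I) 0.
  move=> i j; rewrite EX mxE; have [OR _] := Red i j.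
  have Oq : Q ^+ e \in O by rewrite rpredX ?rpred_nat.
  split; first exact: rpredM.
  rewrite [X in eqm _ _ _ X]mxE; apply: eqm0M => //.
  case: e e0 {Ee EX Oq} => // e _; rewrite exprS; apply: eqm0M.
    by rewrite rpredX ?rpred_nat.
  case: a a0 => // a' _; rewrite natrX exprS; apply: eqm0M; last exact: p_eqm0.
  by rewrite rpredX ?rpred_nat.
split; first by apply: fredholm_mem => i j; have [] := XE i j.
have ext : extremal I = false.
  rewrite /extremal -eq_e Ee; apply/eqP => H; move: e0; rewrite -(ltn_add2l (#|I| + mu)) -H addn0.
  by rewrite ltnn.
rewrite /target ext; exact: fredholm_small.
Qed.

Lemma target_mem I : target I \in polyO O.
Proof.
have [XO XE] := scaled_red I; apply: eqm_mem XE XO.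
by apply/polyOP => j; rewrite coefC; case: eqP; rewrite ?rpred0.
Qed.

(** Both series solve quotient equations whose numerators and denominators are congruent modulo y -
    1 and whose denominators have constant term 1. *)
Lemma lhs_cong (G : {poly algC}) :
  eqX k.+1 (\prod_(I | ~~ osgn I) target I * G) (\prod_(I | osgn I) target I) ->
  lhs k \in O /\ eqm O lmb (lhs k) G`_k.
Proof.
move=> EG; set lc : {poly algC} := lmb%:P.
have Olc : lc \in polyO O.
  by apply/polyOP => j; rewrite coefC; case: eqP; rewrite ?rpred0.
have [Oz1 Ez1] := zeta_delta_mem.
have EL : eqX k.+1 (\prod_(I | ~~ osgn I) fredholm (scaled I) * truncs k.+1 lhs)
    (\prod_(I | osgn I) fredholm (scaled I) * truncs k.+1 (zeta_series delta)).
  apply: eqX_trans (eqXM (@eqX_refl _ _ _) lhs_zeta) _; exact: zeta_fredholm_prod.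
have prod0 (P : pred {set 'I_n.+1}) (f : {set 'I_n.+1} -> {poly algC}) :
    (forall I, (f I)`_0 = 1) -> (\prod_(I | P I) f I)`_0 = 1.
  by move=> f0; rewrite -horner_coef0 horner_prod big1 // => I _; rewrite horner_coef0.
have s0 I : (fredholm (scaled I))`_0 = 1 by exact: fredholm0.
have t0 I : (target I)`_0 = 1.
  by rewrite /target; case: ifP => _; [exact: fredholm0|rewrite coef1].
have sO P : \prod_(I | P I) fredholm (scaled I) \in polyO O.
  by apply: rpred_prod => I _; case: (scaled_red I).
have tO P : \prod_(I | P I) target I \in polyO O.
  by apply: rpred_prod => I _; apply: target_mem.
have stE P : eqm (polyO O) lc (\prod_(I | P I) fredholm (scaled I)) (\prod_(I | P I) target I).
  by apply: eqm_prod => // I _; case: (scaled_red I).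
have kk := ltnSn k.
rewrite -(coef_truncs lhs kk); split.
  apply: (quotient_mem (sO _) _ _ EL kk); last exact: prod0.
  by rewrite rpredM.
have EH : eqm (polyO O) lc (\prod_(I | osgn I) fredholm (scaled I) *
    truncs k.+1 (zeta_series delta)) (\prod_(I | osgn I) target I).
  by rewrite -[X in eqm _ _ _ X]mulr1; apply: eqmM => //; rewrite rpred1.
apply: (quotient_eqm _ _ _ _ _ _ _ _ EH EL EG kk) => //.
- exact: sO.
- by rewrite rpredM.
- exact: tO.
- exact: tO.
- exact: prod0.
- exact: prod0.
Qed.

End Precision.

(** Parity separates the extremal sets: n + |I| is odd for the full set and even for the complements
    of points. *)
Lemma prod_num : \prod_(I | osgn I) target I = Adet d p expo [set: 'I_n.+1] Lhat a.
Proof.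
have oT : osgn [set: 'I_n.+1].
  by rewrite /osgn cardsT card_ord addnS /= oddD addbb.
rewrite (bigD1 _ oT) /= big1 ?mulr1 => [|I /andP[oI IT]].
  by rewrite /target /extremal cardsT card_ord eqxx.
rewrite /target; case: ifP => // /orP[/eqP cI|/andP[/eqP cI _]].
  by case/eqP: IT; apply/eqP; rewrite eqEcard subsetT cardsT card_ord cI /=.
by move: oI; rewrite /osgn cI oddD addbb.
Qed.

Lemma prod_den : \prod_(I | ~~ osgn I) target I =
  if (d %| n)%N then \prod_(i < n.+1) Adet d p expo [set~ i] Lhat a else 1.
Proof.
have oN (I : {set 'I_n.+1}) : #|I| = n -> ~~ osgn I by move=> cI; rewrite /osgn cI oddD addbb.
have oS (I : {set 'I_n.+1}) : #|I| = n.+1 -> osgn I.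
  by move=> cI; rewrite /osgn cI addnS /= oddD addbb.
case: ifP => dn; last first.
  apply: big1 => I oI; rewrite /target /extremal dn andbF orbF.
  by case: eqP => // /oS; rewrite (negPf oI).
rewrite (bigID (fun I : {set 'I_n.+1} => #|I| == n)) /= [X in _ * X]big1 ?mulr1; last first.
  move=> I /andP[oI cI]; rewrite /target /extremal (negPf cI) andFb orbF.
  by case: eqP => // /oS; rewrite (negPf oI).
have cardC1 (i : 'I_n.+1) : #|[set~ i]| = n by rewrite cardsC1 card_ord.
have inj : injective (fun i : 'I_n.+1 => [set~ i]).
  by move=> i j /setC_inj/set1_inj.
transitivity (\prod_(I in [set [set~ i] | i : 'I_n.+1]) Adet d p expo I Lhat a).
  apply: eq_big => [I|I /andP[_ cI]]; last by rewrite /target /extremal cI dn orbT.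
  apply/andP/imsetP => [[_ /eqP cI]|[i _ ->]]; last by rewrite oN cardC1.
  have /cards1P[i Ei] : #|~: I| == 1%N by rewrite cardsCs setCK card_ord cI subSnn.
  by exists i => //; rewrite -Ei setCK.
by rewrite big_imset //= => i j _ _; apply: inj.
Qed.

Lemma target_integral I : target I \in polyO (Oz beta zeta).
Proof.
rewrite /target; case: ifP => [ext|_]; last exact: rpred1.
apply: Adet_mem => //; first exact: Zloc_Oz.
  by move: ext; rewrite /extremal => /orP[/eqP ->|/andP[/eqP ->]].
by move=> j; apply: teich_Oz.
Qed.

Lemma lhs_rat k : lhs k \in Crat.
Proof.
apply: rpredM; last by rewrite rpredV rpredX // rpred_nat.
by apply: Crat_P_series => r; rewrite rpredM ?rpredV ?rpred_nat.
Qed.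

Lemma main_congruence (rhs : series) k :
  eqX k.+1 (\prod_(I | ~~ osgn I) target I * truncs k.+1 rhs) (\prod_(I | osgn I) target I) ->
  [/\ p_integral beta zeta (lhs k), p_integral beta zeta (rhs k) &
      p_cong0 beta zeta (lhs k - rhs k)].
Proof.
(* The factor p in D covers both bounds required of it; T below dominates the closed walks as well
   as every U^I_min. *)
move=> EG; pose M := (a * k * mu.+1 + k + 1)%N; pose D := (p * M)%N.
have M0 : (0 < M)%N by rewrite /M addn1.
have D0 : (0 < D)%N by rewrite muln_gt0 p0.
have MD : (p.-1 * M <= D.+1)%N by apply: leqW; rewrite leq_mul2r leq_pred orbT.
have pD : (p <= D.+1)%N by apply: leqW; rewrite leq_pmulr.
have [pi pil [piO pi0 piy piu pis]] := exists_pi pp cF zq bq yp M0 D0 MD.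
pose T := (N * D * d + \sum_(I : {set 'I_n.+1}) Ubound d I)%N.
have TP : (N * D * d <= T)%N by apply: leq_addr.
have TU (I : {set 'I_n.+1}) : (Ubound d I <= T)%N.
  by rewrite /T (bigD1 I) //= addnCA leq_addr.
have [lO lE] := lhs_cong pil M0 piO pi0 piy piu pis TP (leqnn _) pD TU EG.
rewrite coef_truncs // in lE.
have red := red_zy pp cF zq bq yp.
(* A priori this coefficient lies only in the ring with y adjoined; being rational, it has
   denominator prime to p. *)
have lI : lhs k \in Oz beta zeta.
  by apply: (Zloc_Oz pp beta zeta pF); apply: (Oz_rat red pF) lO; apply: lhs_rat.
have t0 I : (target I)`_0 = 1.
  by rewrite /target; case: ifP => _; [exact: fredholm0|rewrite coef1].
have rI : rhs k \in Oz beta zeta.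
  rewrite -(coef_truncs rhs (ltnSn k)).
  have tI P : \prod_(I | P I) target I \in polyO (Oz beta zeta).
    by apply: rpred_prod => I _; apply: target_integral.
  apply: (quotient_mem (tI _) (tI _) _ EG (ltnSn k)).
  by rewrite -horner_coef0 horner_prod big1 // => I _; rewrite horner_coef0.
split; [exact/asboolP|exact/asboolP|].
(* If the difference were a unit of the ring of zeta, it would be a unit of O, yet it is 0 modulo y
   - 1. *)
have [//|[x0 xV]] := Oz_cong0_or_unit (reducible_prim zq bq) (rpredB lI rI).
have := cong0_nunit red (eqm_lam_cong0 pp cF zq bq yp (proj1 (eqm_subr0 _ _ _ _) lE)) x0.
by rewrite (Oz_zy cF zq yp xV).
Qed.

End Main.

Theorem theorem5p17 (p a n d N : nat) (F : finFieldType)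
  (E : nat -> finFieldType) (emb : forall r : nat, {rmorphism F -> E r})
  (expo : 'I_N -> 'I_n.+1 -> nat) (lam : 'I_N -> F) (zeta : algC) (beta : F) :
  prime p -> (0 < a)%N -> #|F| = (p ^ a)%N -> (1 <= n)%N -> (2 <= d)%N ->
  (forall j : 'I_N, \sum_(i < n.+1) expo j i = d)%N ->
  (forall r : nat, (0 < r)%N -> #|E r| = ((p ^ a) ^ r)%N) ->
  (#|F|.-1).-primitive_root zeta -> (#|F|.-1).-primitive_root beta ->
  let q := (p ^ a)%N in
  let Lhat := fun j : 'I_N => teich beta zeta (lam j) in
  let cnt := fun r : nat => proj_count expo (fun j : 'I_N => emb r (lam j)) in
  let mu := muI d [set: 'I_n.+1] in
  let lhs : series := fun k => P_series n q cnt k * (q%:R ^- (mu * k)%N) in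
  let DS := Adet d p expo [set: 'I_n.+1] Lhat a in
  let Dden := \prod_(i < n.+1) Adet d p expo [set~ i] Lhat a in
  if (d %| n)%N then cong_mod_p beta zeta lhs (smul (polyser DS) (sinv (polyser Dden)))
  else cong_mod_p beta zeta lhs (polyser DS).
Proof.
move=> pp a0 cF n1 d2 expoE cE zq bq q Lhat cnt mu lhs DS Dden.
have [y yp] := C_prim_root_exists (prime_gt0 pp).
have main rhs k : eqX k.+1 ((if (d %| n)%N then Dden else 1) * truncs k.+1 rhs) DS ->
    [/\ p_integral beta zeta (lhs k), p_integral beta zeta (rhs k) &
        p_cong0 beta zeta (lhs k - rhs k)].
  move=> H; refine (main_congruence emb pp a0 cF n1 d2 expoE cE zq bq yp _).
  by rewrite prod_num // prod_den.
have polE (f : {poly algC}) K : eqX K (truncs K (polyser f)) f by apply: eqX_truncs.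
case: ifP main => dn main k; apply: main; last by rewrite mul1r.
have D0 : polyser Dden 0%N = 1.
  rewrite /polyser -horner_coef0 horner_prod big1 // => i _.
  rewrite horner_coef0; exact: fredholm0.
have E1 := eqX_trans (eqXM (eqX_sym (polE Dden k.+1)) (@eqX_refl _ _ _))
  (@truncs_sinv k.+1 _ (ltn0Sn k) D0).
apply: eqX_trans (eqXM (@eqX_refl _ _ _) (@truncs_smul k.+1 _ _)) _.
rewrite mulrCA -[X in eqX _ _ X]mulr1; apply: eqXM => //.
Qed.
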